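(* Let $m,n\ge 2$ be integers and let $R=[0,m-1]\times[0,n-1]\subset\mathbb{R}^2$. The number of tilings of $R$ by the tiles described in the context is $2^\beta+2^\omega-2$, where $c=\gcd(m+1,n+1)-1$, $2\beta=c+(c \bmod 2)$ and $2\omega=c-(c\bmod 2)$.
   Context: The tiles are the following closed polygons, where $a,b$ denote arbitrary positive integers; each tile may be translated and rotated by integer multiples of $\pi/2$. (T1) An axis-parallel square of side $2$. (T2) A square of side $\sqrt2$ with sides in the diagonal directions, e.g. with vertices $(0,0),(1,1),(0,2),(-1,1)$. (T3) The octagon with vertices $(0,0),(2,0),(2+a,a),(2+a,a+2),(2+a-b,a+b+2),(a-b,a+b+2),(-b,b+2),(-b,b)$ (all angles $3\pi/4$; horizontal and vertical sides of length $2$, diagonal sides of lengths $a\sqrt2$ and $b\sqrt2$). (T4) The hexagon with vertices $(0,0),(2,0),(2,2),(2-a,2+a),(-a,2+a),(-a,a)$. (T5) The trapezoid with vertices $(0,0),(2a+2,0),(a+2,a),(a,a)$, whose long base (the side from $(0,0)$ to $(2a+2,0)$) is called dashed. (T6) The right isosceles triangle with vertices $(0,0),(a,0),(0,a)$, whose two legs are called dashed. A tiling of $R$ is a covering of $R$ by finitely many such tiles with pairwise disjoint interiors, such that every dashed side of every tile is contained in the boundary $\partial R$. *)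

(* Defs.v *)
From HB Require Import structures.
From mathcomp Require Import all_boot all_order all_algebra.
From mathcomp Require Import all_classical all_reals all_analysis.
Set Implicit Arguments.
Unset Strict Implicit.
Unset Printing Implicit Defensive.
Import Order.TTheory GRing.Theory Num.Theory.
Import numFieldNormedType.Exports.
Local Open Scope classical_set_scope.
Local Open Scope ring_scope.

Section Tilings.
Variable R : realType.

Notation plane := (R * R)%type.

Definition convex_hull (s : seq plane) : set plane :=
  [set p | exists w : 'I_(size s) -> R,
    [/\ forall i, 0 <= w i, \sum_i w i = 1 & p = \sum_i w i *: s`_i]].

Definition segment (e : plane * plane) : set plane := convex_hull [:: e.1; e.2].

Definition boundary (A : set plane) : set plane := closure A `\` interior A.

(* [prototile vs ds]: [vs] lists the vertices in cyclic order and [ds] the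
   dashed sides, each given by its two endpoints. *)
Variant prototile : seq plane -> seq (plane * plane) -> Prop :=
| T1 : prototile [:: (0, 0); (2, 0); (2, 2); (0, 2)] [::]
| T2 : prototile [:: (0, 0); (1, 1); (0, 2); (-1, 1)] [::]
| T3 (i j : nat) (a := i%:R : R) (b := j%:R : R) of (0 < i)%N & (0 < j)%N :
    prototile [:: (0, 0); (2, 0); (2 + a, a); (2 + a, a + 2);
                  (2 + a - b, a + b + 2); (a - b, a + b + 2);
                  (- b, b + 2); (- b, b)] [::]
| T4 (i : nat) (a := i%:R : R) of (0 < i)%N :
    prototile [:: (0, 0); (2, 0); (2, 2); (2 - a, 2 + a);
                  (- a, 2 + a); (- a, a)] [::]
| T5 (i : nat) (a := i%:R : R) of (0 < i)%N :
    prototile [:: (0, 0); (2 * a + 2, 0); (a + 2, a); (a, a)]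
              [:: ((0, 0), (2 * a + 2, 0))]
| T6 (i : nat) (a := i%:R : R) of (0 < i)%N :
    prototile [:: (0, 0); (a, 0); (0, a)]
              [:: ((0, 0), (a, 0)); ((0, 0), (0, a))].

(* Rotation by [k * pi / 2] about the origin, then translation by [v];
   negative multiples of [pi / 2] are redundant since the rotation has
   order 4. *)
Definition place (k : nat) (v p : plane) : plane :=
  iter k (fun q : plane => (- q.2, q.1)) p + v.

Record polygon := Polygon {
  region : set plane;
  dashed : set (set plane) }.

(* All prototiles are convex, so each is the convex hull of its vertices. *)
Definition tile (t : polygon) : Prop :=
  exists vs ds k v, prototile vs ds /\
    t = Polygon (convex_hull [seq place k v p | p <- vs])
          [set segment (place k v e.1, place k v e.2) | e in [set` ds]].

Definition tiling (X : set plane) (T : set polygon) : Prop :=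
  [/\ finite_set T,
      T `<=` tile,
      \bigcup_(t in T) region t = X,
      trivIset T (fun t => interior (region t)) &
      forall t s, T t -> dashed t s -> s `<=` boundary X].

Definition rectangle (m n : nat) : set plane :=
  `[0, m%:R - 1]%classic `*` `[0, n%:R - 1]%classic.

End Tilings.

(* Main.v *)
(* Comparing tiles along a common edge shows that all their vertices, except
   the right angles of corner triangles, are integer points whose coordinates
   have a sum of one and the same parity. Writing these points as
   [x = p + q + e - 1], [y = p - q - 1] with [e] in [{0, 1}], every tile is
   either a "cell", the square [i <= p <= i + 1], [j <= q <= j + 1] in these
   coordinates, or a "block", the part in the rectangle of the octagon
   surrounding the points [(p, q)] with [i0 <= p <= i1] and [j0 <= q <= j1].
   Let [phi p q] be 1 if [(p, q)] is a point of the rectangle that is not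
   surrounded by a block. Around every integer point of the other parity [phi]
   sums to an even number, hence [phi p q = G p + G q (mod 2)] for a
   2-colouring [G] of the integers which is invariant under [p -> - e - p],
   [p -> p + m + 1] and [p -> p + n + 1]. The blocks are the pairs of maximal
   runs of the same colour, and the cells the pairs of adjacent equal colours
   [G i = G (i + 1) <> G j = G (j + 1)]. Conversely every nonconstant such [G]
   gives a tiling, which determines [e] and, if [G 0] is normalised to 0, [G].
   With [d = gcd (m + 1) (n + 1)], a normalised [G] is given by its values at
   the [p > 0] with [2 p + e <= d], so there are [2 ^ beta - 1] nonconstant
   ones for [e = 0] and [2 ^ omega - 1] for [e = 1]. *)

Require Import Defs.
From mathcomp Require Import all_boot all_order all_algebra.
From mathcomp Require Import all_classical all_reals all_analysis.
From mathcomp Require Import finmap zify ring lra.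
Set Implicit Arguments.
Unset Strict Implicit.
Unset Printing Implicit Defensive.
Import Order.TTheory GRing.Theory Num.Theory.
Import numFieldNormedType.Exports.
Local Open Scope classical_set_scope.
Local Open Scope ring_scope.
Local Open Scope card_scope.

(** * Convex polygons as intersections of half-planes *)

Section HalfPlanes.
Variable R : realType.
Notation plane := (R * R)%type.
Notation hplane := (plane * R)%type.
Implicit Types (z w : plane) (hs : seq hplane) (h : hplane).

Definition dot (a z : plane) : R := a.1 * z.1 + a.2 * z.2.
Arguments dot : simpl never.

Definition turn (a : plane) : plane := (- a.2, a.1).

Definition poly hs : set plane :=
  [set z | forall h, h \in hs -> dot h.1 z <= h.2].

Definition spoly hs : set plane :=
  [set z | forall h, h \in hs -> dot h.1 z < h.2].

Definition mix (t : R) z w : plane :=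
  (z.1 + t * (w.1 - z.1), z.2 + t * (w.2 - z.2)).

Lemma dot_mix a t z w : dot a (mix t z w) = dot a z + t * (dot a w - dot a z).
Proof. rewrite /dot /mix /=; ring. Qed.

Lemma plane_eqP z w : z.1 = w.1 -> z.2 = w.2 -> z = w.
Proof. by case: z w => [? ?] [? ?] /= -> ->. Qed.

Lemma dot_turn_inj a z w : a != 0 ->
  dot a z = dot a w -> dot (turn a) z = dot (turn a) w -> z = w.
Proof.
case: a z w => [a b] [x y] [x' y']; rewrite xpair_eqE negb_and /dot /turn /=.
move=> ab h1 h2; have ab2 : a ^+ 2 + b ^+ 2 != 0.
  rewrite paddr_eq0 ?sqr_ge0 // !expf_eq0 /= negb_and; exact: ab.
congr pair; apply: (mulfI ab2).
  have : a * (a * x + b * y) - b * (- b * x + a * y) =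
         a * (a * x' + b * y') - b * (- b * x' + a * y') by rewrite h1 h2.
  by move=> e; rewrite !expr2; nra.
have : b * (a * x + b * y) + a * (- b * x + a * y) =
         b * (a * x' + b * y') + a * (- b * x' + a * y') by rewrite h1 h2.
by move=> e; rewrite !expr2; nra.
Qed.

Lemma interiorE (A : set plane) z : interior A z <->
  exists2 e : R, 0 < e & forall z', `|z'.1 - z.1| < e -> `|z'.2 - z.2| < e -> A z'.
Proof.
split.
  move=> /nbhs_ballP[e /= e0 eA]; exists e => // z' h1 h2; apply: eA.
  by split; rewrite /ball /= distrC.
case=> e e0 eA; apply/nbhs_ballP; exists e => // z' [h1 h2].
by apply: eA; rewrite distrC.
Qed.

Lemma closureE (A : set plane) z : closure A z <->
  forall e : R, 0 < e ->
    exists z', [/\ A z', `|z'.1 - z.1| < e & `|z'.2 - z.2| < e].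
Proof.
split.
  move=> cA e e0.
  have [z' [Az' [h1 h2]]] := cA _ (nbhsx_ballx z _ e0).
  by exists z'; split=> //; rewrite distrC.
move=> cA B /nbhs_ballP[e /= e0 eB].
have [z' [Az' h1 h2]] := cA e e0; exists z'; split=> //; apply: eB.
by split; rewrite /ball /= distrC.
Qed.

Definition nondeg hs := all (fun h => h.1 != 0) hs.

Lemma dot_le a z z' e : `|z'.1 - z.1| < e -> `|z'.2 - z.2| < e ->
  dot a z' <= dot a z + (`|a.1| + `|a.2|) * e.
Proof.
move=> h1 h2; have -> : dot a z' = dot a z + (a.1 * (z'.1 - z.1) + a.2 * (z'.2 - z.2)).
  by rewrite /dot; ring.
rewrite lerD2l mulrDl; apply: lerD; apply: le_trans (ler_norm _) _;
  rewrite normrM ler_wpM2l // ltW //.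
Qed.

Lemma interior_poly hs : nondeg hs -> interior (poly hs) = spoly hs.
Proof.
move=> nd; apply/seteqP; split => z.
  move=> /interiorE[e e0 eA] h hin.
  have /allP/(_ _ hin) := nd; case: h hin => -[a b] c hin /=.
  rewrite xpair_eqE negb_and => ab.
  have n0 : 0 < 1 + `|a| + `|b| by have := normr_ge0 a; have := normr_ge0 b; lra.
  pose t := e / 2 / (1 + `|a| + `|b|).
  have t0 : 0 < t by rewrite !divr_gt0.
  have ht : t * (1 + `|a| + `|b|) = e / 2 by rewrite divfK // gt_eqF.
  move: (t) t0 ht => {}t t0 ht.
  have [ta tb] : t * `|a| < e /\ t * `|b| < e.
    have := normr_ge0 a; have := normr_ge0 b => hb ha.
    have h1 := mulr_ge0 (ltW t0) hb; have h2 := mulr_ge0 (ltW t0) ha.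
    by split; lra.
  have := eA (z.1 + t * a, z.2 + t * b); rewrite /= [z.1 + _]addrC addrK [z.2 + _]addrC addrK.
  rewrite !normrM (gtr0_norm t0) => /(_ ta tb _ hin) /=; rewrite /dot /=.
  move=> hle; have : 0 < t * (a ^+ 2 + b ^+ 2).
    rewrite mulr_gt0 // lt_neqAle addr_ge0 ?sqr_ge0 // andbT eq_sym.
    by rewrite paddr_eq0 ?sqr_ge0 // !expf_eq0 /= negb_and.
  by rewrite !expr2; nra.
move=> zs; apply/interiorE.
elim: hs zs {nd} => [|h hs IH] zs; first by exists 1 => // ? _ _ ?.
have [|e e0 eA] := IH; first by move=> h' h'in; apply: zs; rewrite inE h'in orbT.
have := zs h; rewrite inE eqxx => /(_ isT) hz.
pose n := 1 + `|h.1.1| + `|h.1.2|.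
have n0 : 0 < n by rewrite /n; have := normr_ge0 h.1.1; have := normr_ge0 h.1.2; lra.
exists (Order.min e ((h.2 - dot h.1 z) / n)).
  by rewrite lt_min e0 divr_gt0 // subr_gt0.
move=> z' h1 h2 h'; rewrite inE => /orP[/eqP ->|]; last first.
  apply: eA; [apply: lt_le_trans h1 _|apply: lt_le_trans h2 _]; by rewrite ge_min lexx.
set t := (h.2 - dot h.1 z) / n in h1 h2.
have t0 : 0 < t by rewrite divr_gt0 // subr_gt0.
have tn : t * n = h.2 - dot h.1 z by rewrite divfK // gt_eqF.
have := @dot_le h.1 z z' t.
rewrite (lt_le_trans h1) ?ge_min ?lexx ?orbT // (lt_le_trans h2) ?ge_min ?lexx ?orbT //.
move=> /(_ isT isT); move: tn; rewrite /n => tn; nra.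
Qed.

Lemma poly_mix hs t z w : 0 <= t <= 1 -> poly hs z -> poly hs w ->
  poly hs (mix t z w).
Proof.
move=> /andP[t0 t1] hz hw h hin; rewrite dot_mix.
have := hz h hin; have := hw h hin; nra.
Qed.

Lemma spoly_mix hs t z w : 0 < t <= 1 -> poly hs z -> spoly hs w ->
  spoly hs (mix t z w).
Proof.
move=> /andP[t0 t1] hz hw h hin; rewrite dot_mix.
have := hz h hin; have := hw h hin; nra.
Qed.

Lemma spolyW hs z : spoly hs z -> poly hs z.
Proof. by move=> hz h /hz /ltW. Qed.

Lemma poly_lim hs z w :
  (forall d : R, 0 < d -> exists2 t, 0 <= t < d & poly hs (mix t z w)) ->
  poly hs z.
Proof.
move=> hd h hin; rewrite leNgt; apply/negP => hz.
pose D := 1 + `|dot h.1 w - dot h.1 z|.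
have D0 : 0 < D by rewrite /D; have := normr_ge0 (dot h.1 w - dot h.1 z); lra.
have [|t /andP[t0 td] /(_ h hin)] := hd ((dot h.1 z - h.2) / D).
  by rewrite divr_gt0 // subr_gt0.
rewrite dot_mix => hh.
move: td; rewrite ltr_pdivlMr // => td.
have : - (t * (dot h.1 w - dot h.1 z)) <= t * `|dot h.1 w - dot h.1 z|.
  by rewrite -mulrN ler_wpM2l // -normrN ler_norm.
by rewrite /D mulrDr mulr1 in td *; lra.
Qed.

Lemma mix_near (e : R) z w : 0 < e -> exists2 d : R, 0 < d & forall t, 0 <= t < d ->
  `|(mix t z w).1 - z.1| < e /\ `|(mix t z w).2 - z.2| < e.
Proof.
move=> e0; pose D := 1 + `|w.1 - z.1| + `|w.2 - z.2|.
have [h1 h2] := (normr_ge0 (w.1 - z.1), normr_ge0 (w.2 - z.2)).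
have D0 : 0 < D by rewrite /D; lra.
exists (e / D); first by rewrite divr_gt0.
move=> t /andP[t0 td]; rewrite /mix /= [z.1 + _]addrC addrK [z.2 + _]addrC addrK.
rewrite !normrM (ger0_norm t0).
move: td; rewrite ltr_pdivlMr // /D => td.
have [h3 h4] := (mulr_ge0 t0 h1, mulr_ge0 t0 h2).
by split; nra.
Qed.

Lemma spoly_near hs z w : spoly hs z -> exists2 d : R, 0 < d &
  forall t, 0 <= t < d -> spoly hs (mix t z w).
Proof.
elim: hs => [|h hs IH] zs; first by exists 1.
have [|d d0 dA] := IH; first by move=> h' h'in; apply: zs; rewrite inE h'in orbT.
have := zs h; rewrite inE eqxx => /(_ isT) hz.
pose D := 1 + `|dot h.1 w - dot h.1 z|.
have D0 : 0 < D by rewrite /D; have := normr_ge0 (dot h.1 w - dot h.1 z); lra.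
exists (Order.min d ((h.2 - dot h.1 z) / D)).
  by rewrite lt_min d0 divr_gt0 // subr_gt0.
move=> t /andP[t0]; rewrite lt_min => /andP[td th] h'.
rewrite inE => /orP[/eqP ->|]; last by apply: dA; rewrite t0.
rewrite dot_mix; move: th; rewrite ltr_pdivlMr // => th.
have : t * (dot h.1 w - dot h.1 z) <= t * `|dot h.1 w - dot h.1 z|.
  by rewrite ler_wpM2l // ler_norm.
by rewrite /D mulrDr mulr1 in th *; lra.
Qed.

Lemma poly_cat hs hs' : poly (hs ++ hs') = poly hs `&` poly hs'.
Proof.
apply/seteqP; split => z.
  by move=> hz; split => h hin; apply: hz; rewrite mem_cat hin ?orbT.
by case=> h1 h2 h; rewrite mem_cat => /orP[/h1|/h2].
Qed.

Lemma spoly_cat hs hs' : spoly (hs ++ hs') = spoly hs `&` spoly hs'.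
Proof.
apply/seteqP; split => z.
  by move=> hz; split => h hin; apply: hz; rewrite mem_cat hin ?orbT.
by case=> h1 h2 h; rewrite mem_cat => /orP[/h1|/h2].
Qed.

Lemma nondeg_cat hs hs' : nondeg (hs ++ hs') = nondeg hs && nondeg hs'.
Proof. exact: all_cat. Qed.

End HalfPlanes.
Arguments dot {R} a z : simpl never.

Section Pigeonhole.
Variable R : realType.

Lemma finite_pigeonhole (T : Type) (A : set T) (Q : T -> R -> Prop) :
  finite_set A ->
  (forall d : R, 0 < d -> exists2 a, A a & exists2 t, 0 <= t < d & Q a t) ->
  exists2 a, A a & forall d : R, 0 < d -> exists2 t, 0 <= t < d & Q a t.
Proof.
move=> fA hQ; apply: contrapT => hn.
have hd : forall a, A a -> exists2 d : R, 0 < d & forall t, 0 <= t < d -> ~ Q a t.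
  move=> a Aa; apply: contrapT => hd; apply: hn; exists a => // d d0.
  apply: contrapT => ht; apply: hd; exists d => // t td Qt; apply: ht.
  by exists t.
have [d d0 dA] : exists2 d : R, 0 < d & forall a, A a -> forall t, 0 <= t < d -> ~ Q a t.
  have /(@finite_seqP {classic T})[s sA] := fA.
  have {}hd : forall a, a \in s -> exists2 d : R, 0 < d &
      forall t, 0 <= t < d -> ~ Q a t by move=> a ain; apply: hd; rewrite sA.
  rewrite sA; elim: s hd {sA} => [|a s IH] hd; first by exists 1.
  have [|d d0 dQ] := IH; first by move=> b bin; apply: hd; rewrite inE bin orbT.
  have [|d' d'0 d'Q] := hd a; first by rewrite inE eqxx.
  exists (Order.min d d'); first by rewrite lt_min d0.
  move=> b /=; rewrite inE => /orP[/eqP ->|bs] t; rewrite lt_min => /and3P[t0 td td'].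
    by apply: d'Q; rewrite t0.
  by apply: (dQ b) => //; rewrite t0.
have [a Aa [t td Qt]] := hQ d d0; exact: dA Aa _ td Qt.
Qed.

End Pigeonhole.

Section Hull.
Variable R : realType.
Notation plane := (R * R)%type.
Implicit Types (z w a b : plane) (s : seq plane).

Lemma dot_sum a (I : finType) (w : I -> R) (f : I -> plane) :
  dot a (\sum_i w i *: f i) = \sum_i w i * dot a (f i).
Proof.
rewrite (big_morph (dot a) (id1 := 0) (op1 := +%R)).
- by apply: eq_bigr => i _; rewrite /dot /=; case: (f i) => x y /=;
    rewrite /GRing.scale /=; ring.
- by move=> x y; rewrite /dot /=; ring.
- by rewrite /dot /=; ring.
Qed.

Lemma hull_dot_le a c s z : (forall p, p \in s -> dot a p <= c) ->
  convex_hull s z -> dot a z <= c.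
Proof.
move=> hs [w [w0 w1 ->]]; rewrite dot_sum -[c]mul1r -w1 mulr_suml.
by apply: ler_sum => i _; rewrite ler_wpM2l // hs // mem_nth.
Qed.

Lemma hull_face a b c s z : (forall p, p \in s -> dot a p <= c) ->
  convex_hull s z -> dot a z = c ->
  exists p, [/\ p \in s, dot a p = c & dot b z <= dot b p].
Proof.
move=> hs [w [w0 w1 zE]] az; apply: contrapT => hn.
have key i : 0 < w i -> dot a s`_i = c.
  move=> wi; apply/eqP; rewrite -subr_eq0 -oppr_eq0 opprB.
  have sz : \sum_i w i * (c - dot a s`_i) = 0.
    under eq_bigr do rewrite mulrBr.
    by rewrite sumrB -mulr_suml w1 mul1r -dot_sum -zE az subrr.
  have : \sum_i w i * (c - dot a s`_i) == 0 by rewrite sz.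
  rewrite psumr_eq0 => [/allP/(_ i)|j _]; last first.
    by rewrite mulr_ge0 // subr_ge0 hs // mem_nth.
  by rewrite mem_index_enum => /(_ isT) /=; rewrite mulf_eq0 gt_eqF.
have lt i : 0 < w i -> dot b s`_i < dot b z.
  move=> wi; rewrite ltNge; apply/negP => h; apply: hn.
  by exists s`_i; rewrite mem_nth // key.
have [i wi] : exists i, 0 < w i.
  apply: contrapT => hw; have : \sum_i w i = 0.
    apply: big1 => i _; apply/eqP; rewrite eq_le w0 andbT leNgt.
    by apply/negP => wi; apply: hw; exists i.
  by rewrite w1 => /eqP; rewrite oner_eq0.
have nn j : 0 <= w j * (dot b z - dot b s`_j).
  by have := w0 j; rewrite le_eqVlt => /predU1P[<-|wj];
    rewrite ?mul0r // mulr_ge0 // subr_ge0 ltW // lt.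
have : \sum_j w j * (dot b z - dot b s`_j) == 0.
  under eq_bigr do rewrite mulrBr.
  by rewrite sumrB -mulr_suml w1 mul1r -dot_sum -zE subrr.
rewrite psumr_eq0 => [/allP/(_ i)|j _ //].
rewrite mem_index_enum => /(_ isT) /=; rewrite mulf_eq0 gt_eqF //= subr_eq0.
by move=> /eqP e; have := lt i wi; rewrite e ltxx.
Qed.

Lemma hull_vertex s z : z \in s -> convex_hull s z.
Proof.
move=> zs; have zi : (index z s < size s)%N by rewrite index_mem.
exists (fun i => (i == Ordinal zi)%:R); split=> [i||].
- exact: ler0n.
- by rewrite (bigD1 (Ordinal zi)) //= eqxx big1 ?addr0 // => i /negPf ->.
- rewrite (bigD1 (Ordinal zi)) //= eqxx scale1r big1 ?addr0 ?nth_index //.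
  by move=> i /negPf ->; rewrite scale0r.
Qed.

Lemma mixE t z w : mix t z w = (1 - t) *: z + t *: w.
Proof.
by case: z w => [? ?] [? ?]; congr pair => /=; rewrite /GRing.scale /=; ring.
Qed.

Lemma hull_mix t s z w : 0 <= t <= 1 -> convex_hull s z -> convex_hull s w ->
  convex_hull s (mix t z w).
Proof.
move=> /andP[t0 t1] [f [f0 f1 ->]] [g [g0 g1 ->]].
exists (fun i => (1 - t) * f i + t * g i); split=> [i||].
- by rewrite addr_ge0 // mulr_ge0 // subr_ge0.
- by rewrite big_split /= -!mulr_sumr f1 g1; ring.
- rewrite mixE !scaler_sumr -big_split /=; apply: eq_bigr => i _.
  by rewrite !scalerA scalerDl.
Qed.

Definition affine (g : plane -> plane) := exists a b v, forall z,
  g z = (dot a z + v.1, dot b z + v.2).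

Lemma hull_map (g : plane -> plane) s z : affine g ->
  convex_hull s z -> convex_hull [seq g p | p <- s] (g z).
Proof.
move=> [a [b [v gE]]] [w [w0 w1 ->]].
have sz : size [seq g p | p <- s] = size s by rewrite size_map.
exists (fun i => w (cast_ord sz i)); split=> [i||] //.
- by rewrite -w1 (reindex (cast_ord sz)) //=; exists (cast_ord (esym sz)) => i _;
    apply: val_inj.
rewrite [RHS](reindex (cast_ord (esym sz))) /=; last first.
  by exists (cast_ord sz) => i _; apply: val_inj.
rewrite [RHS](eq_bigr (fun i => w i *: g s`_i)); last first.
  by move=> i _; rewrite cast_ordKV (nth_map 0).
have d1 (y : plane) : y.1 = dot (1, 0) y by rewrite /dot /=; ring.
have d2 (y : plane) : y.2 = dot (0, 1) y by rewrite /dot /=; ring.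
have e c : c = \sum_i w i * c by rewrite -mulr_suml w1 mul1r.
apply: plane_eqP.
  rewrite [RHS]d1 dot_sum gE /= dot_sum {1}(e v.1) -big_split /=.
  by apply: eq_bigr => i _; rewrite -d1 gE /= [RHS]mulrDr.
rewrite [RHS]d2 dot_sum gE /= dot_sum {1}(e v.2) -big_split /=.
by apply: eq_bigr => i _; rewrite -d2 gE /= [RHS]mulrDr.
Qed.

Lemma hull_map_can (g g' : plane -> plane) s z : affine g -> affine g' ->
  cancel g g' -> cancel g' g ->
  convex_hull [seq g p | p <- s] z <-> convex_hull s (g' z).
Proof.
move=> ag ag' gK g'K; split=> [/(hull_map ag')|/(hull_map ag)]; last by rewrite g'K.
by rewrite -map_comp map_id_in // => p _; exact: gK.
Qed.

End Hull.

Section Edges.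
Variable R : realType.
Notation plane := (R * R)%type.
Notation hplane := (plane * R)%type.
Implicit Types (z w a b : plane) (hs : seq hplane).

Definition sep a b := forall z w, dot a z = dot a w -> dot b z = dot b w -> z = w.

Lemma sep_turn a : a != 0 -> sep a (turn a).
Proof. by move=> a0 z w; apply: dot_turn_inj. Qed.

Lemma dotN a z : dot (- a) z = - dot a z.
Proof. by rewrite /dot /=; ring. Qed.

Lemma sepN a b : sep a b -> sep (- a) b.
Proof. by move=> h z w; rewrite !dotN => /oppr_inj; apply: h. Qed.

Lemma sepNr a b : sep a b -> sep a (- b).
Proof. by move=> h z w e; rewrite !dotN => /oppr_inj; apply: h. Qed.

Lemma sep_neq0 a b : sep a b -> a != 0.
Proof.
move=> h; apply/eqP => a0.
have : (b.2, - b.1) = (0, 0) :> plane by apply: h; rewrite ?a0 /dot /=; ring.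
move=> [b2 b1]; have : (1, 0) = (0, 0) :> plane.
  apply: h; rewrite ?a0 /dot /= ?b2; first ring.
  by move: b1 => /eqP; rewrite oppr_eq0 => /eqP ->; ring.
by case=> /eqP; rewrite oner_eq0.
Qed.

Lemma sep_mixE a b z w p t : sep a b -> dot a z = dot a p -> dot a w = dot a p ->
  dot b z < dot b w -> t = (dot b p - dot b z) / (dot b w - dot b z) ->
  p = mix t z w.
Proof.
move=> ab az aw zw ->; have d0 : dot b w - dot b z != 0 by rewrite subr_eq0 gt_eqF.
apply: ab; first by rewrite dot_mix az aw; ring.
by rewrite dot_mix divfK //; ring.
Qed.

Lemma sep_mix a b z w p : sep a b -> dot a z = dot a p -> dot a w = dot a p ->
  dot b z <= dot b p <= dot b w -> dot b z < dot b w ->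
  exists2 t, 0 <= t <= 1 & p = mix t z w.
Proof.
move=> ab az aw /andP[zp pw] zw.
have d0 : 0 < dot b w - dot b z by rewrite subr_gt0.
exists ((dot b p - dot b z) / (dot b w - dot b z)); last exact: (sep_mixE ab).
by rewrite divr_ge0 ?subr_ge0 ?(ltW zw) //= ler_pdivrMr // mul1r lerD2r.
Qed.

Lemma spoly_strict hs a c q : a != 0 -> (forall z, poly hs z -> dot a z <= c) ->
  spoly hs q -> dot a q < c.
Proof.
move=> a0 hc hq; have [d d0 dP] := spoly_near (q + a) hq.
have d20 : 0 <= d / 2 < d by lra.
have := hc _ (spolyW (dP _ d20)); rewrite dot_mix => h.
suff : 0 < dot a a by rewrite /dot /= in h *; nra.
case: a a0 {hc h dP} => x y; rewrite xpair_eqE negb_and /dot /= => xy.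
rewrite lt_neqAle addr_ge0 -?expr2 ?sqr_ge0 // andbT eq_sym.
by rewrite paddr_eq0 ?sqr_ge0 // !expf_eq0 /= negb_and.
Qed.

(* Near a relative interior point [p] of an edge, the polygon contains the
   whole half disc on its side of the edge. *)
Lemma edge_half_disc hs a b z w q p y : sep a b ->
  poly hs z -> poly hs w -> poly hs q ->
  dot a z = dot a p -> dot a w = dot a p -> dot b z < dot b p < dot b w ->
  dot a p < dot a q -> dot a p <= dot a y ->
  exists2 d : R, 0 < d & forall t, 0 <= t < d -> poly hs (mix t p y).
Proof.
move=> ab hz hw hq az aw /andP[zp pw] pq py.
have zw := lt_trans zp pw.
pose th := (dot b p - dot b z) / (dot b w - dot b z).
have d0 : 0 < dot b w - dot b z by rewrite subr_gt0.
have th01 : 0 < th < 1.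
  by rewrite divr_gt0 ?subr_gt0 //= ltr_pdivrMr // mul1r ltrD2r.
have pE : p = mix th z w.
  exact: (sep_mixE ab).
have hp h : h \in hs -> exists2 d : R, 0 < d &
    forall t, 0 <= t < d -> dot h.1 (mix t p y) <= h.2.
  move=> hin; have hz' := hz h hin; have hw' := hw h hin; have hq' := hq h hin.
  have hpE : dot h.1 p = dot h.1 z + th * (dot h.1 w - dot h.1 z).
    by rewrite {1}pE dot_mix.
  have hp : dot h.1 p <= h.2 by rewrite hpE; nra.
  have [hlt|hge] := ltP (dot h.1 p) h.2.
    have [|d d0' dP] := @spoly_near _ [:: h] p y.
      by move=> ?; rewrite inE => /eqP ->.
    by exists d => // t /dP; move=> /spolyW; apply; rewrite inE.
  have hpe : dot h.1 p = h.2 by apply/le_anti/andP.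
  have zwe : dot h.1 z = dot h.1 w by rewrite hpe in hpE; nra.
  exists 1 => // t /andP[t0 _]; rewrite dot_mix hpe.
  suff : dot h.1 y <= dot h.1 p by rewrite hpe; nra.
  have par : dot a a * (dot h.1 y - dot h.1 p) = dot h.1 a * (dot a y - dot a p) /\
             dot a a * (dot h.1 q - dot h.1 p) = dot h.1 a * (dot a q - dot a p).
    have aw0 : dot a z = dot a w by rewrite az aw.
    have : h.1.1 * a.2 = h.1.2 * a.1.
      have wz : w.1 - z.1 != 0 \/ w.2 - z.2 != 0.
        apply/orP; rewrite -negb_and; apply/negP => /andP[/eqP e1 /eqP e2].
        by move: zw; rewrite /dot (subr0_eq e1) (subr0_eq e2) ltxx.
      have e1 : h.1.1 * (w.1 - z.1) + h.1.2 * (w.2 - z.2) = 0.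
        by move: zwe; rewrite /dot => e; lra.
      have e2 : a.1 * (w.1 - z.1) + a.2 * (w.2 - z.2) = 0.
        by move: aw0; rewrite /dot => e; lra.
      case: wz => wz; apply: (mulIf wz).
        have : a.2 * (h.1.1 * (w.1 - z.1) + h.1.2 * (w.2 - z.2)) -
           h.1.2 * (a.1 * (w.1 - z.1) + a.2 * (w.2 - z.2)) = 0 by rewrite e1 e2; ring.
        by move=> e; nra.
      have : a.1 * (h.1.1 * (w.1 - z.1) + h.1.2 * (w.2 - z.2)) -
           h.1.1 * (a.1 * (w.1 - z.1) + a.2 * (w.2 - z.2)) = 0 by rewrite e1 e2; ring.
      by move=> e; nra.
    move=> e; split; rewrite /dot; [move: (y.1) (y.2)|move: (q.1) (q.2)] => v1 v2.
      have : (h.1.1 * a.2 - h.1.2 * a.1) * ((v1 - p.1) * a.2 - (v2 - p.2) * a.1) = 0.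
        by rewrite e subrr mul0r.
      by move=> e'; lra.
    have : (h.1.1 * a.2 - h.1.2 * a.1) * ((v1 - p.1) * a.2 - (v2 - p.2) * a.1) = 0.
      by rewrite e subrr mul0r.
    by move=> e'; lra.
  case: par => e1 e2.
  have aa : 0 < dot a a.
    have := sep_neq0 ab; case: (a) => x1 x2; rewrite xpair_eqE negb_and /dot /= => xy.
    rewrite lt_neqAle addr_ge0 -?expr2 ?sqr_ge0 // andbT eq_sym.
    by rewrite paddr_eq0 ?sqr_ge0 // !expf_eq0 /= negb_and.
  have ha : dot h.1 a <= 0.
    rewrite leNgt; apply/negP => ha; have : 0 < dot h.1 a * (dot a q - dot a p).
      by rewrite mulr_gt0 // subr_gt0.
    by rewrite -e2 pmulr_rgt0 // subr_gt0 hpe ltNge hq'.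
  rewrite -subr_le0 -(pmulr_rle0 _ aa) e1 mulr_le0_ge0 // subr_ge0 //.
elim: hs hp {hz hw hq} => [|h hs IH] hp; first by exists 1.
have [|d dd0 dP] := IH; first by move=> h' h'in; apply: hp; rewrite inE h'in orbT.
have [|d' dd'0 d'P] := hp h; first by rewrite inE eqxx.
exists (Order.min d d'); first by rewrite lt_min dd0.
move=> t; rewrite lt_min => /and3P[t0 td td'] h'; rewrite inE => /orP[/eqP ->|h'in].
  by apply: d'P; rewrite t0.
by apply: (dP t _ h' h'in); rewrite t0.
Qed.

End Edges.

Lemma seq_max (R : realType) (T : eqType) (s : seq T) (P : T -> Prop) (f : T -> R) :
  (exists2 x, x \in s & P x) ->
  exists2 x, x \in s & P x /\ forall y, y \in s -> P y -> f y <= f x.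
Proof.
elim: s => [|x s IH]; first by case.
case: (pselect (exists2 y, y \in s & P y)) => [/IH[y ys [Py ymax]] _|nP [y]].
  case: (pselect (P x)) => Px; last first.
    exists y; rewrite ?inE ?ys ?orbT //; split => // z.
    by rewrite inE => /predU1P[-> //|]; apply: ymax.
  have [xy|yx] := leP (f x) (f y).
    exists y; rewrite ?inE ?ys ?orbT //; split => // z.
    by rewrite inE => /predU1P[-> //|]; apply: ymax.
  exists x; rewrite ?inE ?eqxx //; split => // z.
  rewrite inE => /predU1P[-> //|zs Pz].
  exact: le_trans (ymax z zs Pz) (ltW yx).
rewrite inE => /predU1P[-> Px|ys Py]; last by case: nP; exists y.
exists x; rewrite ?inE ?eqxx //; split => // z.
by rewrite inE => /predU1P[-> //|zs Pz]; case: nP; exists z.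
Qed.

(** * Propagation of the vertex lattice through a tiling *)

Section Rigidity.
Variable R : realType.
Notation plane := (R * R)%type.
Notation hplane := (plane * R)%type.
Variables (T : Type) (A : set T) (K : T -> set plane) (hs : T -> seq hplane).
Variables (V : T -> seq plane) (S : T -> set plane) (X L : set plane).
Hypothesis finA : finite_set A.
Hypothesis K_hull : forall t, A t -> K t = convex_hull (V t).
Hypothesis K_poly : forall t, A t -> K t = poly (hs t).
Hypothesis hs_nondeg : forall t h, A t -> h \in hs t -> h.1 != 0.
Hypothesis hs_int : forall t h, A t -> h \in hs t ->
  h.1.1 \is a Num.int /\ h.1.2 \is a Num.int.
Hypothesis K_int : forall t, A t -> exists c, spoly (hs t) c.
Hypothesis cover : forall z, X z <-> exists2 t, A t & K t z.
Hypothesis X_mix : forall (t : R) z w, 0 <= t <= 1 -> X z -> X w -> X (mix t z w).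
Hypothesis X_box : forall z w, X z -> X w -> X (w.1, z.2).
Hypothesis X_bounded : forall a, exists B, forall z, X z -> dot a z <= B.
Hypothesis disj : forall t s z, A t -> A s ->
  spoly (hs t) z -> spoly (hs s) z -> t = s.
Hypothesis S_neq0 : forall t, A t -> exists p, S t p.
Hypothesis S_solid : forall t p a q, A t -> p \in V t ->
  (forall z, K t z -> dot a z <= dot a p) -> X q -> dot a p < dot a q -> S t p.
Hypothesis L_add : forall z w, L z -> L w -> L (z + w).
Hypothesis L_opp : forall z, L z -> L (- z).
Hypothesis L_int : forall z, L z -> z.1 \is a Num.int /\ z.2 \is a Num.int.
Hypothesis S_lat : forall t p q, A t -> S t p -> S t q -> L (p - q).

Let KX t z : A t -> K t z -> X z.
Proof. by move=> At Kz; apply/cover; exists t. Qed.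

Let V_K t p : A t -> p \in V t -> K t p.
Proof. by move=> At pV; rewrite K_hull //; apply: hull_vertex. Qed.

Lemma touch_interior t s z : A t -> A s -> K t z -> spoly (hs s) z -> t = s.
Proof.
move=> At As Kz sz; have [c tc] := K_int At.
have [d d0 dP] := spoly_near c sz.
pose e := Order.min (d / 2) 1.
have e0 : 0 < e by rewrite lt_min ltr01 divr_gt0.
apply: (@disj t s (mix e z c)) => //.
  by apply: spoly_mix => //; rewrite ?e0 /= ?ge_min ?lexx ?orbT // -K_poly.
by apply: dP; rewrite ltW //= gt_min; apply/orP; left; lra.
Qed.

Definition below t a c := forall z, K t z -> dot a z <= c.

Definition contact a b c t s := [/\ below t a c, below s (- a) (- c) &
  exists z w : plane, [/\ K t z, K s z, K t w & K s w] /\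
    [/\ dot a z = c, dot a w = c & dot b z < dot b w]].

Definition top t a b c p := [/\ p \in V t, dot a p = c &
  forall z, K t z -> dot a z = c -> dot b z <= dot b p].

Lemma topP t a b c z : A t -> below t a c -> K t z -> dot a z = c ->
  exists p, top t a b c p.
Proof.
move=> At ta Kz az.
have fP z' : K t z' -> dot a z' = c ->
    exists2 p, p \in V t & dot a p = c /\ dot b z' <= dot b p.
  move=> Kz' az'; have [p [p1 p2 p3]] : exists p, [/\ p \in V t, dot a p = c & dot b z' <= dot b p].
    apply: hull_face az'; first by move=> q qV; apply: ta; apply: V_K.
    by rewrite -K_hull.
  by exists p.
have [p pV [ap _]] := fP z Kz az.
have [|q qV [aq qm]] := @seq_max R _ (V t) (fun p => dot a p = c) (dot b).
  by exists p.
exists q; split=> // z' Kz' /(fP z' Kz')[p' p'V [ap' zp']].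
exact: le_trans zp' (qm _ _ _).
Qed.

Lemma one_side a b c t s z w q p : sep a b -> A t -> A s -> t <> s ->
  K t z -> K t w -> K t q -> dot a z = c -> dot a w = c -> dot a p = c ->
  dot b z < dot b p < dot b w -> c < dot a q -> K s p -> below s a c.
Proof.
move=> ab At As ts Kz Kw Kq az aw ap zpw cq sp y Ky; rewrite leNgt; apply/negP => cy.
have [r sr] := K_int As.
have [d d0 dP] : exists2 d : R, 0 < d & forall e, 0 <= e < d -> c < dot a (mix e y r).
  have [|d d0 dP] := @spoly_near _ [:: (- a, - c)] y r.
    by move=> h; rewrite inE => /eqP -> /=; rewrite dotN ltrN2.
  exists d => // e /dP /(_ (- a, - c)); rewrite inE eqxx => /(_ isT) /=.
  by rewrite dotN ltrN2.
pose e := Order.min (d / 2) 1.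
have e0 : 0 < e by rewrite lt_min ltr01 divr_gt0.
have e1 : e <= 1 by rewrite ge_min lexx orbT.
have ed : e < d by rewrite gt_min; apply/orP; left; lra.
have sy : spoly (hs s) (mix e y r).
  by apply: spoly_mix; rewrite ?e0 // -K_poly.
have [d' d'0 d'P] : exists2 d : R, 0 < d &
    forall e', 0 <= e' < d -> poly (hs t) (mix e' p (mix e y r)).
  apply: (@edge_half_disc _ _ a b z w q) => //; rewrite ?ap -?K_poly //.
  by rewrite ltW // dP // ltW.
pose e' := Order.min (d' / 2) 1.
have e'0 : 0 < e' by rewrite lt_min ltr01 divr_gt0.
apply: ts; apply: (@touch_interior t s (mix e' p (mix e y r))) => //.
  rewrite K_poly //; apply: d'P; rewrite ltW //= gt_min; apply/orP; left; lra.
apply: spoly_mix => //; last by rewrite -K_poly.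
by rewrite e'0 ge_min lexx orbT.
Qed.

(* Along the common line, the tile following [t] on the side of [t] starts at
   the end point [p] of [t]. *)
Lemma next_along a b c t s p q : sep a b -> A t -> A s ->
  contact a b c t s -> top t a b c p -> K s q -> dot a q = c ->
  dot b p < dot b q ->
  exists r p', [/\ A r, contact a b c r s, p \in V r, top r a b c p' &
    dot b p < dot b p'].
Proof.
move=> ab At As [ta sa [z [w [[tz sz tw sw] [az aw zw]]]]] [pV ap pmax] sq aq pq.
have a0 := sep_neq0 ab.
have tp := V_K At pV.
have wp : dot b w <= dot b p by apply: pmax.
have zp : dot b z < dot b p by apply: lt_le_trans wp.
have sp : K s p.
  have [e e01 ->] : exists2 e, 0 <= e <= 1 & p = mix e w q.
    by apply: (sep_mix ab); rewrite ?aw ?aq ?ap ?wp ?(ltW pq) // (le_lt_trans wp).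
  by rewrite K_poly //; apply: poly_mix; rewrite // -K_poly.
have [oc ot] := K_int At; have [oc' so'] := K_int As.
have aoc : dot a oc < c.
  by apply: (@spoly_strict _ (hs t)) => // y; rewrite -K_poly //; apply: ta.
have aoc' : c < dot a oc'.
  rewrite -ltrN2 -dotN; apply: (@spoly_strict _ (hs s)) => //.
    by rewrite oppr_eq0.
  by move=> y; rewrite -K_poly //; apply: sa.
have Ko : K t oc by rewrite K_poly //; apply: spolyW.
have Ko' : K s oc' by rewrite K_poly //; apply: spolyW.
pose seg e := mix e p q.
have aseg e : dot a (seg e) = c by rewrite dot_mix ap aq; ring.
have sseg e : 0 <= e <= 1 -> K s (seg e).
  by move=> e01; rewrite K_poly //; apply: poly_mix; rewrite // -K_poly.
have step e : 0 <= e <= 1 -> exists r, [/\ A r, K r (seg e) &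
    exists2 y, K r y & dot a y < c].
  move=> e01.
  have [|r Ar hr] := @finite_pigeonhole R T A
    (fun r e' => 0 < e' /\ K r (mix e' (seg e) oc)) finA.
    move=> d d0; pose e' := Order.min (d / 2) 1.
    have e'0 : 0 < e' by rewrite lt_min ltr01 divr_gt0.
    have : X (mix e' (seg e) oc).
      apply: X_mix; [|exact: KX (sseg _ e01)|exact: KX Ko].
      by rewrite ltW //= ge_min lexx orbT.
    move=> /cover[r Ar Kr]; exists r => //; exists e' => //.
    by rewrite ltW //= gt_min; apply/orP; left; lra.
  exists r; split=> //.
    rewrite K_poly //; apply: (@poly_lim _ _ _ oc) => d /hr[e' e'd [_ h]].
    by exists e'; rewrite -?K_poly.
  have [e' _ [e'0 h]] := hr 1 ltr01; exists (mix e' (seg e) oc) => //.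
  by rewrite dot_mix aseg; have := mulr_gt0 e'0 (_ : 0 < c - dot a oc);
    rewrite subr_gt0 => /(_ aoc); lra.
have [|r Ar hr] := @finite_pigeonhole R T A (fun r e => [/\ 0 < e <= 1, K r (seg e) &
    exists2 y, K r y & dot a y < c]) finA.
  move=> d d0; pose e' := Order.min (d / 2) 1.
  have e'0 : 0 < e' by rewrite lt_min ltr01 divr_gt0.
  have e'1 : e' <= 1 by rewrite ge_min lexx orbT.
  have [|r [Ar Kr hy]] := step e'; first by rewrite ltW.
  exists r => //; exists e'; last by rewrite e'0.
  by rewrite ltW //= gt_min; apply/orP; left; lra.
have rp : K r p.
  rewrite K_poly //; apply: (@poly_lim _ _ _ q) => d /hr[e' e'd [_ h _]].
  by exists e'; rewrite -?K_poly.
have [e _ [/andP[e0 e1] re [y ry ay]]] := hr 1 ltr01.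
have bseg e' : dot b (seg e') = dot b p + e' * (dot b q - dot b p) by rewrite dot_mix.
have pe : dot b p < dot b (seg e) by rewrite bseg ltrDl mulr_gt0 // subr_gt0.
have sr : s <> r by move=> sr; move: (sa y); rewrite sr dotN lerN2 leNgt ay => /(_ ry).
have tr : t <> r.
  by move=> tr; have := pmax (seg e); rewrite tr aseg leNgt pe => /(_ re erefl).
have ra : below r a c.
  have e2 : 0 < e / 2 <= 1 by apply/andP; split; lra.
  have e3 : e / 2 < e by lra.
  have pq0 : 0 < dot b q - dot b p by rewrite subr_gt0.
  have := @one_side a b c s r p q oc' (seg (e / 2)) ab As Ar sr sp sq Ko' ap aq.
  apply=> //; rewrite ?aseg //.
    case/andP: e2 => ? ?; rewrite bseg; apply/andP; split; first by rewrite ltrDl mulr_gt0.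
    by nra.
  have -> : seg (e / 2) = mix 2^-1 p (seg e).
    by rewrite /seg /mix; congr pair => /=; lra.
  rewrite K_poly //; apply: poly_mix; rewrite -?K_poly //; lra.
have [oc'' ro''] := K_int Ar.
have aoc'' : dot a oc'' < c.
  by apply: (@spoly_strict _ (hs r)) => // y'; rewrite -K_poly //; apply: ra.
have bot y' : K r y' -> dot a y' = c -> dot b p <= dot b y'.
  move=> ry' ay'; rewrite leNgt; apply/negP => yp.
  pose m := Order.max (dot b y') (dot b z).
  have mp : m < dot b p by rewrite gt_max yp.
  pose m' := (m + dot b p) / 2.
  have mm' : m < m' < dot b p by rewrite /m'; apply/andP; split; lra.
  pose p1 := mix ((m' - dot b y') / (dot b p - dot b y')) y' p.
  have ym : dot b y' <= m by rewrite le_max lexx.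
  have zm : dot b z <= m by rewrite le_max lexx orbT.
  have d0 : 0 < dot b p - dot b y' by rewrite subr_gt0.
  have rp1 : K r p1.
    rewrite K_poly //; apply: poly_mix; rewrite -?K_poly //.
    case/andP: mm' => ? ?.
    rewrite divr_ge0 ?(ltW d0) //= ?ler_pdivrMr //; lra.
  have ap1 : dot a p1 = c by rewrite dot_mix ap ay'; ring.
  have bp1 : dot b p1 = m' by rewrite dot_mix divfK ?gt_eqF //; ring.
  have : below r (- a) (- c).
    apply: (@one_side (- a) b (- c) t r z p oc p1) => //; rewrite ?dotN ?az ?ap ?ap1 //.
    - exact: sepN.
    - by rewrite bp1; case/andP: mm' => m1 m2; rewrite m2 andbT (le_lt_trans zm).
    - by rewrite ltrN2.
  by move=> /(_ y ry); rewrite dotN lerN2 leNgt ay.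
have [p' ptop] := topP b Ar ra rp ap.
exists r, p'; split => //.
- split=> //; exists p, (seg e); split; split=> //.
  by apply: sseg; rewrite ltW.
- have [p1 [p1V ap1 bp1]] :
      exists p1, [/\ p1 \in V r, dot a p1 = c & dot (- b) p <= dot (- b) p1].
    apply: hull_face ap; first by move=> p1 p1V; apply: ra; apply: V_K.
    by rewrite -K_hull.
  suff -> : p = p1 by [].
  apply: ab; first by rewrite ap ap1.
  apply/le_anti; rewrite bot //; first by move: bp1; rewrite !dotN lerN2.
  exact: V_K.
- by case: ptop => _ _ /(_ _ re (aseg e)); apply: lt_le_trans.
Qed.

Definition congruent t s := forall p q, S t p -> S s q -> L (p - q).

Lemma congruent_common t s p : S t p -> S s p -> A t -> A s -> congruent t s.
Proof.
move=> tp sp At As p' q' tp' sq'.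
have -> : p' - q' = (p' - p) + (p - q').
  by rewrite addrA subrK.
by apply: L_add; [apply: S_lat tp' tp|apply: S_lat sp sq'].
Qed.

Lemma congruent_sym t s : congruent t s -> congruent s t.
Proof.
move=> h p q sp tq; have -> : p - q = - (q - p) by rewrite opprB.
by apply: L_opp; apply: h.
Qed.

Lemma congruent_trans t r s : A r -> congruent t r -> congruent r s -> congruent t s.
Proof.
move=> Ar tr rs p q tp sq; have [oc ro] := S_neq0 Ar.
have -> : p - q = (p - oc) + (oc - q) by rewrite addrA subrK.
by apply: L_add; [apply: tr|apply: rs].
Qed.

Lemma contact_sym a b c t s : contact a b c t s -> contact (- a) b (- c) s t.
Proof.
move=> [ta sa [z [w [[tz sz tw sw] [az aw zw]]]]]; split => //.
  by rewrite /below !opprK.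
by exists z, w; split; split; rewrite // dotN ?az ?aw.
Qed.

Lemma contact_solid a b c t s p : sep a b -> A t -> A s -> contact a b c t s ->
  p \in V t -> dot a p = c -> S t p.
Proof.
move=> ab At As [ta sa _] pV ap; have [oc so] := K_int As.
have Ko : K s oc by rewrite K_poly //; apply: spolyW.
apply: (@S_solid t p a oc) => //; first by move=> z Kz; rewrite ap; apply: ta.
  exact: KX Ko.
rewrite ap -ltrN2 -dotN; apply: (@spoly_strict _ (hs s)) => //.
  by rewrite oppr_eq0 (sep_neq0 ab).
by move=> y; rewrite -K_poly //; apply: sa.
Qed.

Lemma contact_congruent a b c t s : sep a b -> a.1 \is a Num.int -> a.2 \is a Num.int ->
  b.1 \is a Num.int -> b.2 \is a Num.int -> A t -> A s -> contact a b c t s ->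
  congruent t s.
Proof.
move=> ab _ _ b1 b2 At As ts.
have bL z : L z -> dot b z \is a Num.int.
  by move=> /L_int[z1 z2]; rewrite /dot; apply: rpredD; apply: rpredM.
have [B BP] := X_bounded b.
have [p pt] : exists p, top t a b c p.
  by case: (ts) => [ta _ [z [_ [[? _ _ _] [? _ _]]]]]; apply: (@topP t a b c z).
have [q qt] : exists q, top s (- a) b (- c) q.
  case: (ts) => [_ sa [z [_ [[_ ? _ _] [az _ _]]]]]; apply: (@topP s _ _ _ z) => //.
  by rewrite dotN az.
have [n hn] : exists n : nat, B + B < dot b p + dot b q + n%:R.
  exists (Num.bound `|B + B - (dot b p + dot b q)|).
  by rewrite -ltrBlDl (le_lt_trans (ler_norm _)) // archi_boundP.
elim: n a c t s ab At As ts p pt q qt hn => [|n IH] a c t s ab At As ts p pt q qt hn.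
  have Bp : dot b p <= B by apply: BP; apply: (KX At); apply: (V_K At); case: pt.
  have Bq : dot b q <= B by apply: BP; apply: (KX As); apply: (V_K As); case: qt.
  by exfalso; move: hn; rewrite addr0; lra.
have aux (a' : plane) c' t' s' p' q' : sep a' b -> A t' -> A s' -> contact a' b c' t' s' ->
    top t' a' b c' p' -> top s' (- a') b (- c') q' -> dot b p' < dot b q' ->
    B + B < dot b p' + dot b q' + n.+1%:R -> congruent t' s'.
  move=> {}ab At' As' ts' pt' [qV aq qm] pq hn'.
  have aq' : dot a' q' = c' by apply: oppr_inj; rewrite -dotN.
  have [r [p1 [Ar rs pr ptop pp1]]] := next_along ab At' As' ts' pt' (V_K As' qV) aq' pq.
  have Sr : S r p'.
    by apply: contact_solid rs pr _ => //; case: pt'.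
  have St : S t' p' by apply: contact_solid ts' _ _ => //; case: pt'.
  have S1 : S r p1 by apply: contact_solid rs _ _ => //; case: ptop.
  apply: (congruent_trans Ar); first exact: congruent_common St Sr _ _.
  apply: (IH a' c' r s' ab Ar As' rs p1 ptop q') => //.
  have := bL _ (S_lat Ar S1 Sr).
  have -> : dot b (p1 - p') = dot b p1 - dot b p' by rewrite /dot /=; ring.
  move=> /intrP[m mE]; have m1 : 0 < m.
    by rewrite -(ltr0z R) -mE subr_gt0.
  have : 1 <= m%:~R :> R by rewrite (ler_int R 1).
  by rewrite -mE; move: hn'; rewrite -natr1; lra.
have [pq|qp|pq] := ltgtP (dot b p) (dot b q).
- exact: (aux a c t s p q).
- apply: congruent_sym; apply: (aux (- a) (- c) s t q p) => //; rewrite ?opprK //.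
  + exact: sepN.
  + exact: contact_sym.
  + by rewrite [_ + dot b p]addrC.
- have pqE : p = q.
    apply: ab => //; case: pt => _ -> _; case: qt => _ aq _.
    by apply: oppr_inj; rewrite -dotN.
  apply: (@congruent_common t s p) => //.
    by apply: contact_solid ts _ _ => //; case: pt.
  rewrite pqE; apply: (@contact_solid (- a) b (- c) s t) => //; try by case: qt.
    exact: sepN.
  exact: contact_sym.
Qed.

Lemma touch_congruent t s p : A t -> A s -> K t p -> K s p ->
  p \notin V t -> p \notin V s -> congruent t s.
Proof.
move=> At As tp sp ptV psV.
case: (pselect (t = s)) => [<- z w|ts]; first exact: S_lat.
have [h hin hp] : exists2 h, h \in hs t & dot h.1 p = h.2.
  apply: contrapT => hn; have : spoly (hs t) p.
    move=> h hin; rewrite lt_neqAle; apply/andP; split.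
      by apply/eqP => e; apply: hn; exists h.
    by move: tp; rewrite K_poly //; apply.
  by move=> /(touch_interior As At sp)/esym.
pose a := h.1; pose b := turn a; pose c := h.2.
have a0 : a != 0 := hs_nondeg At hin.
have ab : sep a b := sep_turn a0.
have tac : below t a c by move=> z; rewrite K_poly //; apply.
have strict (b' : plane) s' a' c' : sep a' b' -> A s' -> K s' p -> p \notin V s' ->
    below s' a' c' -> dot a' p = c' ->
    exists q, [/\ K s' q, dot a' q = c' & dot b' p < dot b' q].
  move=> ab' As' s'p ps' bel ap.
  have [q [qV aq bq]] :
      exists q, [/\ q \in V s', dot a' q = c' & dot b' p <= dot b' q].
    apply: hull_face ap; first by move=> q qV; apply: bel; apply: V_K.
    by rewrite -K_hull.
  exists q; split=> //; first exact: V_K.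
  rewrite lt_neqAle bq andbT; apply: contra ps' => /eqP e.
  by rewrite (_ : p = q) //; apply: ab'; rewrite ?ap ?aq.
have [w [tw aw pw]] := strict b t a c ab At tp ptV tac hp.
have [z [tz az]] := strict (- b) t a c (sepNr ab) At tp ptV tac hp.
rewrite !dotN ltrN2 => zp.
have [oc ot] := K_int At.
have aoc : dot a oc < c.
  by apply: (@spoly_strict _ (hs t)) => // y; rewrite -K_poly //; apply: tac.
have sac : below s (- a) (- c).
  apply: (@one_side (- a) b (- c) t s z w oc p) => //.
  - exact: sepN.
  - by rewrite K_poly //; apply: spolyW.
  - by rewrite dotN az.
  - by rewrite dotN aw.
  - by rewrite dotN hp.
  - by rewrite zp.
  - by rewrite dotN ltrN2.
have [|w' [sw' aw' pw']] := strict b s (- a) (- c) (sepN ab) As sp psV sac.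
  by rewrite dotN hp.
have {}aw' : dot a w' = c by apply: oppr_inj; rewrite -dotN.
have [i1 i2] := hs_int At hin.
apply: (@contact_congruent a b c t s) => //.
  by rewrite /b /turn /= rpredN.
split=> //; have [ww|ww] := leP (dot b w) (dot b w').
  exists p, w; split; split => //.
  have [e e01 ->] : exists2 e, 0 <= e <= 1 & w = mix e p w'.
    by apply: (sep_mix ab); rewrite ?hp ?aw ?aw' ?ww ?(ltW pw).
  by rewrite K_poly //; apply: poly_mix; rewrite // -K_poly.
exists p, w'; split; split => //.
have [e e01 ->] : exists2 e, 0 <= e <= 1 & w' = mix e p w.
  by apply: (sep_mix ab); rewrite ?hp ?aw ?aw' ?(ltW ww) ?(ltW pw').
by rewrite K_poly //; apply: poly_mix; rewrite // -K_poly.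
Qed.

Lemma mixD (e f : R) (z w : plane) :
  mix (e - f) z w = mix f (mix e z w) (mix (e - 1) z w).
Proof. by rewrite /mix /=; congr pair; ring. Qed.

Lemma mixD' (e f : R) (z w : plane) :
  mix (e + f) z w = mix f (mix e z w) (mix (e + 1) z w).
Proof. by rewrite /mix /=; congr pair; ring. Qed.

Lemma segment_congruent t s z w : A t -> A s -> K t z -> K s w -> X z -> X w ->
  (forall r e, A r -> 0 <= e <= 1 -> mix e z w \notin V r) -> congruent t s.
Proof.
move=> At As tz sw Xz Xw gen.
pose D := [set e : R | 0 <= e <= 1 /\ exists r, [/\ A r, K r (mix e z w) & congruent t r]].
have mix0 : mix 0 z w = z by apply: plane_eqP; rewrite /mix /=; ring.
have mix1 : mix 1 z w = w by apply: plane_eqP; rewrite /mix /=; ring.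
have D0 : D 0.
  split; first by rewrite lexx ler01.
  by exists t; split=> //; [rewrite mix0|move=> p q; apply: S_lat].
have supD : has_sup D.
  by split; [exists 0|exists 1 => e [/andP[]]].
pose e := sup D.
have e0 : 0 <= e by apply: ub_le_sup => //; case: supD.
have e1 : e <= 1 by apply: ge_sup; [exists 0|move=> ? [/andP[]]].
have [r [Ar er tr]] : exists r, [/\ A r, K r (mix e z w) & congruent t r].
  have [|r Ar hr] := @finite_pigeonhole R T A
    (fun r f => K r (mix (e - f) z w) /\ congruent t r) finA.
    move=> d d0; have [f [f01 [r [Ar fr tr]]] fe] := sup_adherent d0 supD.
    exists r => //; exists (e - f); last by rewrite subKr.
    have : f <= e by apply: ub_le_sup; [case: supD|split => //; exists r].
    by rewrite -/e in fe => ?; apply/andP; split; lra.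
  have [_ _ [_ tr]] := hr 1 ltr01.
  exists r; split=> //.
  rewrite K_poly //; apply: (@poly_lim _ _ _ (mix (e - 1) z w)) => d /hr[f fd [h _]].
  by exists f; rewrite // -mixD -K_poly.
have e01 : 0 <= e <= 1 by rewrite e0.
have eE : e = 1.
  apply/le_anti; rewrite e1 leNgt; apply/negP => {}e1.
  have [|r' Ar' hr] := @finite_pigeonhole R T A
    (fun r f => 0 < f /\ e + f <= 1 /\ K r (mix (e + f) z w)) finA.
    move=> d d0; pose f := Order.min (d / 2) (1 - e).
    have f0 : 0 < f by rewrite lt_min subr_gt0 e1 divr_gt0.
    have f1 : e + f <= 1 by rewrite -lerBrDl ge_min lexx orbT.
    have : X (mix (e + f) z w).
      by apply: X_mix => //; rewrite f1 andbT addr_ge0 // ltW.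
    move=> /cover[r' Ar' Kr']; exists r' => //; exists f => //.
    by rewrite ltW //= gt_min; apply/orP; left; lra.
  have er' : K r' (mix e z w).
    rewrite K_poly //; apply: (@poly_lim _ _ _ (mix (e + 1) z w)) => d /hr[f fd [_ [_ h]]].
    by exists f; rewrite // -mixD' -K_poly.
  have [f _ [f0 [f1 fr']]] := hr 1 ltr01.
  have : e + f <= e.
    apply: ub_le_sup; first by case: supD.
    split; first by rewrite f1 andbT addr_ge0 // ltW.
    exists r'; split=> //; apply: (congruent_trans Ar tr).
    by apply: touch_congruent er er' _ _ => //; apply: gen.
  by rewrite gerDl leNgt f0.
apply: (congruent_trans Ar tr).
apply: (@touch_congruent r s w) => //; first by rewrite -mix1 -eE.
  by rewrite -mix1; apply: gen => //; rewrite ler01 lexx.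
by rewrite -mix1; apply: gen => //; rewrite ler01 lexx.
Qed.

Lemma avoid (F : seq R) (x y : R) : x < y -> exists2 z, x < z < y & z \notin F.
Proof.
elim: F y => [|f F IH] y xy; first by exists ((x + y) / 2) => //; apply/andP; split; lra.
have [fx|xf] := leP f x.
  have [z /andP[xz zy] zF] := IH y xy; exists z; rewrite ?xz // inE negb_or zF andbT.
  by rewrite gt_eqF // (le_lt_trans fx).
have [|z /andP[xz zy] zF] := IH (Order.min f y); first by rewrite lt_min xf.
move: zy; rewrite lt_min => /andP[zf zy].
by exists z; rewrite ?xz // inE negb_or zF andbT lt_eqF.
Qed.

Theorem all_congruent t s : A t -> A s -> congruent t s.
Proof.
move=> At As.
have [F FP] : exists F : seq plane, forall r p, A r -> p \in V r -> p \in F.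
  have /(@finite_seqP {classic T})[l lA] := finA.
  exists (flatten [seq V r | r <- (l : seq {classic T})]) => r p Ar pV.
  apply/flattenP; exists (V r) => //; apply/(@mapP {classic T} (seq plane : eqType) V).
  exists r => //.
  by move: Ar; rewrite lA.
have [z tz] := K_int At; have [w sw] := K_int As.
have [d d0 dP] := spoly_near (z.1, z.2 + 1) tz.
have [d' d'0 d'P] := spoly_near (w.1 + 1, w.2) sw.
have [y /andP[zy yd] yF] := @avoid [seq p.2 | p <- F] z.2 (z.2 + d) (ltac:(lra)).
have [x /andP[wx xd] xF] := @avoid [seq p.1 | p <- F] w.1 (w.1 + d') (ltac:(lra)).
have {dP}tzy : K t (z.1, y).
  have : 0 <= y - z.2 < d by apply/andP; split; lra.
  move=> /dP /spolyW; rewrite -K_poly //; congr (K t _).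
  by apply: plane_eqP; rewrite /mix /=; ring.
have {d'P}sxw : K s (x, w.2).
  have : 0 <= x - w.1 < d' by apply/andP; split; lra.
  move=> /d'P /spolyW; rewrite -K_poly //; congr (K s _).
  by apply: plane_eqP; rewrite /mix /=; ring.
have Xzy := KX At tzy; have Xxw := KX As sxw.
have Xxy : X (x, y) := X_box Xzy Xxw.
have [r Ar rxy] : exists2 r, A r & K r (x, y) by apply/cover.
apply: (congruent_trans Ar).
  apply: segment_congruent tzy rxy Xzy Xxy _ => // r' e Ar' _.
  apply: contra yF => /(FP _ _ Ar') h; apply/mapP; exists (mix e (z.1, y) (x, y)) => //.
  by rewrite /mix /=; ring.
apply: segment_congruent rxy sxw Xxy Xxw _ => // r' e Ar' _.
apply: contra xF => /(FP _ _ Ar') h; apply/mapP; exists (mix e (x, y) (x, w.2)) => //.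
by rewrite /mix /=; ring.
Qed.

End Rigidity.

(** * Tiles as octagons and their codes *)

Lemma forall_nil (T : eqType) (P : T -> Prop) : forall x, x \in [::] -> P x.
Proof. by []. Qed.

Lemma forall_cons (T : eqType) (P : T -> Prop) y (s : seq T) :
  P y -> (forall x, x \in s -> P x) -> forall x, x \in y :: s -> P x.
Proof. by move=> Py sP x; rewrite inE => /predU1P[->|/sP]. Qed.

Ltac mem_seq := rewrite in_cons; apply/orP;
  first [by left; apply/eqP; congr pair; lra | right; mem_seq].

Ltac forall_seq :=
  first [exact: forall_nil | apply: forall_cons; [idtac | forall_seq]].

Section Octagons.
Variable R : realType.
Notation plane := (R * R)%type.
Notation hplane := (plane * R)%type.

(* The octagon [x0 <= x <= x1], [y0 <= y <= y1], [u0 <= x + y <= u1],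
   [v0 <= x - y <= v1]. *)
Record oct := Oct { ox0 : R; ox1 : R; oy0 : R; oy1 : R;
                    ou0 : R; ou1 : R; ov0 : R; ov1 : R }.

Definition octhp (q : oct) : seq hplane :=
  [:: ((1, 0), ox1 q); ((-1, 0), - ox0 q); ((0, 1), oy1 q); ((0, -1), - oy0 q);
      ((1, 1), ou1 q); ((-1, -1), - ou0 q); ((1, -1), ov1 q); ((-1, 1), - ov0 q)].

Lemma nondeg_octhp q : nondeg (octhp q).
Proof.
by rewrite /nondeg /= !xpair_eqE !oppr_eq0 !oner_eq0 !eqxx /=.
Qed.

Lemma octhp_int q h : h \in octhp q -> h.1.1 \is a Num.int /\ h.1.2 \is a Num.int.
Proof.
rewrite !inE => h8; repeat (case/orP: h8 => [/eqP ->|h8]); last move/eqP: h8 => ->;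
  by rewrite /= ?rpredN ?rpred0 ?rpred1.
Qed.

Lemma octP q z : poly (octhp q) z <->
  [/\ ox0 q <= z.1 <= ox1 q, oy0 q <= z.2 <= oy1 q,
      ou0 q <= z.1 + z.2 <= ou1 q & ov0 q <= z.1 - z.2 <= ov1 q].
Proof.
split=> [h|[/andP[h1 h2] /andP[h3 h4] /andP[h5 h6] /andP[h7 h8]]].
  have g i : (i < 8)%N -> dot (nth ((0,0),0) (octhp q) i).1 z <= (nth ((0,0),0) (octhp q) i).2.
    by move=> i8; apply: h; apply: mem_nth.
  have := (g 0%N isT, g 1%N isT, g 2%N isT, g 3%N isT).
  have := (g 4%N isT, g 5%N isT, g 6%N isT, g 7%N isT).
  rewrite /dot /= => -[[[e1 e2] e3] e4] [[[e5 e6] e7] e8].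
  by split; apply/andP; split; lra.
move=> h; rewrite !inE => h9; repeat (case/orP: h9 => [/eqP ->|h9]); last move/eqP: h9 => ->;
  rewrite /dot /=; lra.
Qed.

Lemma octPb q z : poly (octhp q) z <->
  [&& ox0 q <= z.1, z.1 <= ox1 q, oy0 q <= z.2, z.2 <= oy1 q,
     ou0 q <= z.1 + z.2, z.1 + z.2 <= ou1 q, ov0 q <= z.1 - z.2 & z.1 - z.2 <= ov1 q].
Proof.
rewrite octP; split.
  by move=> [/andP[-> ->] /andP[-> ->] /andP[-> ->] /andP[-> ->]].
by move=> /and5P[-> -> -> -> /and4P[-> -> -> ->]].
Qed.

Lemma soctP q z : spoly (octhp q) z <->
  [/\ ox0 q < z.1 < ox1 q, oy0 q < z.2 < oy1 q,
      ou0 q < z.1 + z.2 < ou1 q & ov0 q < z.1 - z.2 < ov1 q].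
Proof.
split=> [h|[/andP[h1 h2] /andP[h3 h4] /andP[h5 h6] /andP[h7 h8]]].
  have g i : (i < 8)%N -> dot (nth ((0,0),0) (octhp q) i).1 z < (nth ((0,0),0) (octhp q) i).2.
    by move=> i8; apply: h; apply: mem_nth.
  have := (g 0%N isT, g 1%N isT, g 2%N isT, g 3%N isT).
  have := (g 4%N isT, g 5%N isT, g 6%N isT, g 7%N isT).
  rewrite /dot /= => -[[[e1 e2] e3] e4] [[[e5 e6] e7] e8].
  by split; apply/andP; split; lra.
move=> h; rewrite !inE => h9; repeat (case/orP: h9 => [/eqP ->|h9]); last move/eqP: h9 => ->;
  rewrite /dot /=; lra.
Qed.

Definition octV (q : oct) : seq plane :=
  [:: (ou0 q - oy0 q, oy0 q); (ov1 q + oy0 q, oy0 q);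
      (ox1 q, ox1 q - ov1 q); (ox1 q, ou1 q - ox1 q);
      (ou1 q - oy1 q, oy1 q); (ov0 q + oy1 q, oy1 q);
      (ox0 q, ox0 q - ov0 q); (ox0 q, ou0 q - ox0 q)].

Definition tight (q : oct) : bool :=
  [&& ou0 q - oy0 q <= ov1 q + oy0 q, oy0 q <= ox1 q - ov1 q,
      ox1 q - ov1 q <= ou1 q - ox1 q, ou1 q - ox1 q <= oy1 q,
      ov0 q + oy1 q <= ou1 q - oy1 q, ox0 q - ov0 q <= oy1 q,
      ou0 q - ox0 q <= ox0 q - ov0 q & oy0 q <= ou0 q - ox0 q].

Lemma sep_horizontal (a : plane) : a.1 != 0 -> sep a (0, 1).
Proof.
move=> a1 [x y] [x' y'] /= e1 e2; have yy : y = y' by move: e2; rewrite /dot /=; lra.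
congr pair => //; apply: (mulfI a1); move: e1; rewrite yy /dot /=; lra.
Qed.

Lemma hull_edge (s : seq plane) (a z w p : plane) : a.1 != 0 ->
  convex_hull s z -> convex_hull s w -> dot a z = dot a p -> dot a w = dot a p ->
  z.2 <= p.2 <= w.2 -> convex_hull s p.
Proof.
move=> a1 sz sw az aw zpw; have ab := sep_horizontal a1.
have bE q : dot (0, 1) q = q.2 by rewrite /dot /=; ring.
have [e|ne] := eqVneq z.2 w.2.
  by rewrite -(_ : z = p) //; apply: ab; rewrite ?bE //; lra.
have [t t01 ->] : exists2 t, 0 <= t <= 1 & p = mix t z w.
  apply: (sep_mix ab); rewrite ?bE // lt_neqAle ne.
  by case/andP: zpw; apply: le_trans.
exact: hull_mix.
Qed.

Lemma hull_oct (s : seq plane) (q : oct) : tight q ->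
  (forall z, z \in s -> poly (octhp q) z) -> {subset octV q <= s} ->
  convex_hull s = poly (octhp q).
Proof.
case: q => x0 x1 y0 y1 u0 u1 v0 v1; rewrite /tight /octV /=.
move=> /andP[t1 /and5P[t2 t3 t4 t5 /and3P[t6 t7 t8]]] sq qs; apply/seteqP; split => z.
  by move=> hz h hin; apply: hull_dot_le hz => p /sq; apply.
move=> /octP /= [/andP[h1 h2] /andP[h3 h4] /andP[h5 h6] /andP[h7 h8]].
have hv p : p \in [:: (u0 - y0, y0); (v1 + y0, y0); (x1, x1 - v1); (x1, u1 - x1);
      (u1 - y1, y1); (v0 + y1, y1); (x0, x0 - v0); (x0, u0 - x0)] -> convex_hull s p.
  by move=> pin; apply: hull_vertex; apply: qs.
have [xl hl ll] : exists2 xl, convex_hull s (xl, z.2) & xl <= z.1.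
  have [c1|c1] := leP z.2 (u0 - x0).
    exists (u0 - z.2); last by lra.
    apply: (@hull_edge s (1, 1) (u0 - y0, y0) (x0, u0 - x0)); rewrite ?oner_neq0 //=;
      rewrite ?h3 //; try (apply: hv; rewrite !inE eqxx ?orbT //); rewrite /dot /=; ring.
  have [c2|c2] := leP z.2 (x0 - v0).
    exists x0; last by lra.
    apply: (@hull_edge s (1, 0) (x0, u0 - x0) (x0, x0 - v0)); rewrite ?oner_neq0 //=;
      rewrite ?(ltW c1) //; try (apply: hv; rewrite !inE eqxx ?orbT //); rewrite /dot /=; ring.
  exists (v0 + z.2); last by lra.
  apply: (@hull_edge s (1, -1) (x0, x0 - v0) (v0 + y1, y1)); rewrite ?oner_neq0 //=;
    rewrite ?(ltW c2) //; try (apply: hv; rewrite !inE eqxx ?orbT //); rewrite /dot /=; ring.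
have [xr hr rr] : exists2 xr, convex_hull s (xr, z.2) & z.1 <= xr.
  have [c1|c1] := leP z.2 (x1 - v1).
    exists (v1 + z.2); last by lra.
    apply: (@hull_edge s (1, -1) (v1 + y0, y0) (x1, x1 - v1)); rewrite ?oner_neq0 //=;
      rewrite ?h3 //; try (apply: hv; rewrite !inE eqxx ?orbT //); rewrite /dot /=; ring.
  have [c2|c2] := leP z.2 (u1 - x1).
    exists x1; last by lra.
    apply: (@hull_edge s (1, 0) (x1, x1 - v1) (x1, u1 - x1)); rewrite ?oner_neq0 //=;
      rewrite ?(ltW c1) //; try (apply: hv; rewrite !inE eqxx ?orbT //); rewrite /dot /=; ring.
  exists (u1 - z.2); last by lra.
  apply: (@hull_edge s (1, 1) (x1, u1 - x1) (u1 - y1, y1)); rewrite ?oner_neq0 //=;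
    rewrite ?(ltW c2) //; try (apply: hv; rewrite !inE eqxx ?orbT //); rewrite /dot /=; ring.
have [e|ne] := eqVneq xl xr.
  by have -> : z = (xl, z.2) by apply: plane_eqP => //=; lra.
have lr : xl < xr by rewrite lt_neqAle ne (le_trans ll rr).
have [t t01 ->] : exists2 t, 0 <= t <= 1 & z = mix t (xl, z.2) (xr, z.2).
  apply: (@sep_mix _ (0, 1) (1, 0)); rewrite /dot /= ?mul0r ?mul1r ?addr0 ?ll //.
  by move=> w w'; rewrite /dot /= => e1 e2; apply: plane_eqP; lra.
exact: hull_mix.
Qed.

Definition rot (z : plane) : plane := (- z.2, z.1).
Definition rotO (q : oct) :=
  Oct (- oy1 q) (- oy0 q) (ox0 q) (ox1 q) (ov0 q) (ov1 q) (- ou1 q) (- ou0 q).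
Definition trO (v : plane) (q : oct) :=
  Oct (v.1 + ox0 q) (v.1 + ox1 q) (v.2 + oy0 q) (v.2 + oy1 q)
      (v.1 + v.2 + ou0 q) (v.1 + v.2 + ou1 q) (v.1 - v.2 + ov0 q) (v.1 - v.2 + ov1 q).

Lemma hull_rot s q : convex_hull s = poly (octhp q) ->
  convex_hull [seq rot z | z <- s] = poly (octhp (rotO q)).
Proof.
move=> sq.
have a1 : affine rot.
  exists (0, -1), (1, 0), (0, 0) => z; apply: plane_eqP; rewrite /dot /=; ring.
have a2 : affine (fun z : plane => (z.2, - z.1)).
  exists (0, 1), (-1, 0), (0, 0) => z; apply: plane_eqP; rewrite /dot /=; ring.
have K1 : cancel rot (fun z : plane => (z.2, - z.1)).
  by move=> w; apply: plane_eqP; rewrite /= ?opprK.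
have K2 : cancel (fun z : plane => (z.2, - z.1)) rot.
  by move=> w; apply: plane_eqP; rewrite /= ?opprK.
apply/seteqP; split => z.
  move=> /(hull_map_can s z a1 a2 K1 K2); rewrite sq !octP /=.
  by move=> [/andP[? ?] /andP[? ?] /andP[? ?] /andP[? ?]]; split; apply/andP; split; lra.
rewrite octP /= => -[/andP[? ?] /andP[? ?] /andP[? ?] /andP[? ?]].
apply/(hull_map_can s z a1 a2 K1 K2); rewrite sq octP /=.
by split; apply/andP; split; lra.
Qed.

Lemma hull_tr v s q : convex_hull s = poly (octhp q) ->
  convex_hull [seq z + v | z <- s] = poly (octhp (trO v q)).
Proof.
move=> sq.
have a1 : affine (fun z : plane => z + v).
  exists (1, 0), (0, 1), v => z; apply: plane_eqP; rewrite /dot /=; ring.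
have a2 : affine (fun z : plane => z - v).
  exists (1, 0), (0, 1), (- v) => z; apply: plane_eqP; rewrite /dot /=; ring.
have K1 : cancel (fun z : plane => z + v) (fun z => z - v) by move=> z; rewrite addrK.
have K2 : cancel (fun z : plane => z - v) (fun z => z + v) by move=> z; rewrite subrK.
apply/seteqP; split => z.
  move=> /(hull_map_can s z a1 a2 K1 K2); rewrite sq !octP /=.
  by move=> [/andP[? ?] /andP[? ?] /andP[? ?] /andP[? ?]]; split; apply/andP; split; lra.
rewrite octP /= => -[/andP[? ?] /andP[? ?] /andP[? ?] /andP[? ?]].
apply/(hull_map_can s z a1 a2 K1 K2); rewrite sq octP /=.
by split; apply/andP; split; lra.
Qed.

Lemma hull_place k v s q : convex_hull s = poly (octhp q) ->
  convex_hull [seq place k v z | z <- s] = poly (octhp (trO v (iter k rotO q))).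
Proof.
move=> sq; have -> : [seq place k v z | z <- s] = [seq z + v | z <- [seq iter k rot z | z <- s]].
  by rewrite -map_comp.
apply: hull_tr; elim: k => [|k IH] /=; first by rewrite map_id.
by rewrite (map_comp rot); apply: hull_rot.
Qed.

Definition oB (a b : nat) : oct :=
  Oct (- b%:R) (2 + a%:R) 0 (a%:R + b%:R + 2) 0 (2 * a%:R + 4) (- (2 * b%:R) - 2) 2.
Definition oC : oct := Oct (-1) 1 0 2 0 2 (-2) 0.
Definition o5 (a : nat) : oct :=
  Oct 0 (2 * a%:R + 2) 0 a%:R 0 (2 * a%:R + 2) 0 (2 * a%:R + 2).
Definition o6 (a : nat) : oct := Oct 0 a%:R 0 a%:R 0 a%:R (- a%:R) a%:R.
Definition vB (a b : nat) : seq plane :=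
  [:: (0, 0); (2, 0); (2 + a%:R, a%:R); (2 + a%:R, a%:R + 2);
     (2 + a%:R - b%:R, a%:R + b%:R + 2); (a%:R - b%:R, a%:R + b%:R + 2);
     (- b%:R, b%:R + 2); (- b%:R, b%:R)].

Lemma hull_vB a b : convex_hull (vB a b) = poly (octhp (oB a b)).
Proof.
have := ler0n R a; have := ler0n R b; rewrite /vB /oB; move: (a%:R) (b%:R) => {}a {}b a0 b0.
apply: hull_oct; rewrite /tight /octV /=.
- apply/andP; split; [lra|]; apply/and5P; split; last apply/and3P; try split; lra.
- forall_seq; apply/octP => /=; split; lra.
- forall_seq; mem_seq.
Qed.

Lemma hull_T1 : convex_hull [:: (0, 0); (2, 0); (2, 2); (0, 2)] = poly (octhp (oB 0 0)).
Proof.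
apply: hull_oct; rewrite /tight /octV /=.
- apply/andP; split; [lra|]; apply/and5P; split; last apply/and3P; try split; lra.
- forall_seq; apply/octP => /=; split; lra.
- forall_seq; mem_seq.
Qed.

Lemma hull_T2 : convex_hull [:: (0, 0); (1, 1); (0, 2); (-1, 1)] = poly (octhp oC).
Proof.
apply: hull_oct; rewrite /tight /octV /=.
- apply/andP; split; [lra|]; apply/and5P; split; last apply/and3P; try split; lra.
- forall_seq; apply/octP => /=; split; lra.
- forall_seq; mem_seq.
Qed.

Lemma hull_T4 (i : nat) : convex_hull [:: (0, 0); (2, 0); (2, 2); (2 - i%:R, 2 + i%:R);
    (- i%:R, 2 + i%:R); (- i%:R, i%:R)] = poly (octhp (oB 0 i)).
Proof.
have := ler0n R i; rewrite /oB; move: (i%:R) => {}i i0.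
apply: hull_oct; rewrite /tight /octV /=.
- apply/andP; split; [lra|]; apply/and5P; split; last apply/and3P; try split; lra.
- forall_seq; apply/octP => /=; split; lra.
- forall_seq; mem_seq.
Qed.

Lemma hull_T5 (i : nat) : convex_hull [:: (0, 0); (2 * i%:R + 2, 0); (i%:R + 2, i%:R);
    (i%:R, i%:R)] = poly (octhp (o5 i)).
Proof.
have := ler0n R i; rewrite /o5; move: (i%:R) => {}i i0.
apply: hull_oct; rewrite /tight /octV /=.
- apply/andP; split; [lra|]; apply/and5P; split; last apply/and3P; try split; lra.
- forall_seq; apply/octP => /=; split; lra.
- forall_seq; mem_seq.
Qed.

Lemma hull_T6 (i : nat) : convex_hull [:: (0, 0); (i%:R, 0); (0, i%:R)] = poly (octhp (o6 i)).
Proof.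
have := ler0n R i; rewrite /o6; move: (i%:R) => {}i i0.
apply: hull_oct; rewrite /tight /octV /=.
- apply/andP; split; [lra|]; apply/and5P; split; last apply/and3P; try split; lra.
- forall_seq; apply/octP => /=; split; lra.
- forall_seq; mem_seq.
Qed.

Lemma hull_H (c : R) : 0 <= c ->
  convex_hull [:: (0, 0); (c, 0)] = poly (octhp (Oct 0 c 0 0 0 c 0 c)).
Proof.
move=> c0; apply: hull_oct; rewrite /tight /octV /=.
- apply/andP; split; [lra|]; apply/and5P; split; last apply/and3P; try split; lra.
- forall_seq; apply/octP => /=; split; lra.
- forall_seq; mem_seq.
Qed.

Lemma hull_V (c : R) : 0 <= c ->
  convex_hull [:: (0, 0); (0, c)] = poly (octhp (Oct 0 0 0 c 0 c (- c) 0)).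
Proof.
move=> c0; apply: hull_oct; rewrite /tight /octV /=.
- apply/andP; split; [lra|]; apply/and5P; split; last apply/and3P; try split; lra.
- forall_seq; apply/octP => /=; split; lra.
- forall_seq; mem_seq.
Qed.

End Octagons.

Section Codes.
Variable R : realType.
Notation plane := (R * R)%type.
Notation hplane := (plane * R)%type.
Variables m n e : int.
Hypothesis m2 : 2 <= m.
Hypothesis n2 : 2 <= n.
Hypothesis e01 : 0 <= e <= 1.

Definition recthp : seq hplane :=
  [:: ((1, 0), m%:~R - 1); ((-1, 0), 0); ((0, 1), n%:~R - 1); ((0, -1), 0)].

Lemma nondeg_recthp : nondeg recthp.
Proof. by rewrite /nondeg /= !xpair_eqE !oppr_eq0 !oner_eq0 !eqxx /=. Qed.

Lemma rectP z : poly recthp z <->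
  0 <= z.1 <= m%:~R - 1 /\ 0 <= z.2 <= n%:~R - 1.
Proof.
split=> [h|[/andP[h1 h2] /andP[h3 h4]]].
  have g i : (i < 4)%N -> dot (nth ((0,0),0) recthp i).1 z <= (nth ((0,0),0) recthp i).2.
    by move=> i8; apply: h; apply: mem_nth.
  have := (g 0%N isT, g 1%N isT, g 2%N isT, g 3%N isT).
  rewrite /dot /= => -[[[e1 e2] e3] e4].
  by split; apply/andP; split; lra.
rewrite /poly /=; forall_seq; rewrite /dot /=; lra.
Qed.

Lemma rectPb z : poly recthp z <->
  [&& 0 <= z.1, z.1 <= m%:~R - 1, 0 <= z.2 & z.2 <= n%:~R - 1].
Proof.
rewrite rectP; split.
  by move=> [/andP[-> ->] /andP[-> ->]].
by move=> /and4P[-> -> -> ->].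
Qed.

Lemma srectP z : spoly recthp z <->
  0 < z.1 < m%:~R - 1 /\ 0 < z.2 < n%:~R - 1.
Proof.
split=> [h|[/andP[h1 h2] /andP[h3 h4]]].
  have g i : (i < 4)%N -> dot (nth ((0,0),0) recthp i).1 z < (nth ((0,0),0) recthp i).2.
    by move=> i8; apply: h; apply: mem_nth.
  have := (g 0%N isT, g 1%N isT, g 2%N isT, g 3%N isT).
  rewrite /dot /= => -[[[e1 e2] e3] e4].
  by split; apply/andP; split; lra.
rewrite /spoly /=; forall_seq; rewrite /dot /=; lra.
Qed.

Lemma rect_boundaryP z : boundary (poly recthp) z <->
  poly recthp z /\ [\/ z.1 = 0, z.1 = m%:~R - 1, z.2 = 0 | z.2 = n%:~R - 1].
Proof.
rewrite /boundary interior_poly ?nondeg_recthp //; split.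
  case=> cz nz; have pz : poly recthp z.
    move=> h hin; rewrite leNgt; apply/negP => hz.
    have D0 : 0 < 1 + `|h.1.1| + `|h.1.2|.
      by have := normr_ge0 h.1.1; have := normr_ge0 h.1.2; lra.
    pose d := (dot h.1 z - h.2) / (1 + `|h.1.1| + `|h.1.2|).
    have d0 : 0 < d by rewrite divr_gt0 // subr_gt0.
    have dE : d * (1 + `|h.1.1| + `|h.1.2|) = dot h.1 z - h.2.
      by rewrite divfK // gt_eqF.
    move/closureE: cz => /(_ d d0)[z' [/(_ h hin) hz' h1 h2]].
    have := @dot_le R h.1 z' z d; rewrite distrC h1 distrC h2 => /(_ isT isT).
    by move: dE; rewrite !mulrDr mulr1; lra.
  split=> //; move/rectP: (pz) => [/andP[z1 z2] /andP[z3 z4]].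
  have [e1|e1] := eqVneq z.1 0; first by constructor 1.
  have [e2|e2] := eqVneq z.1 (m%:~R - 1); first by constructor 2.
  have [e3|e3] := eqVneq z.2 0; first by constructor 3.
  have [e4|e4] := eqVneq z.2 (n%:~R - 1); first by constructor 4.
  by case: nz; apply/srectP; rewrite !lt_neqAle z1 z2 z3 z4 e2 e4 !(eq_sym 0) e1 e3.
case=> pz bz; split; first exact: subset_closure.
by move=> /srectP[/andP[z1 z2] /andP[z3 z4]]; case: bz; lra.
Qed.

Lemma oct_in_rect q : tight q -> poly (octhp q) `<=` poly recthp ->
  [/\ 0 <= ox0 q, ox1 q <= m%:~R - 1, 0 <= oy0 q & oy1 q <= n%:~R - 1].
Proof.
case: q => x0 x1 y0 y1 u0 u1 v0 v1; rewrite /tight /=.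
move=> /andP[t1 /and5P[t2 t3 t4 t5 /and3P[t6 t7 t8]]] sub; split.
- have : poly recthp (x0, u0 - x0) by apply: sub; apply/octP => /=; split; lra.
  by move=> /rectP /=; lra.
- have : poly recthp (x1, u1 - x1) by apply: sub; apply/octP => /=; split; lra.
  by move=> /rectP /=; lra.
- have : poly recthp (u0 - y0, y0) by apply: sub; apply/octP => /=; split; lra.
  by move=> /rectP /=; lra.
- have : poly recthp (u1 - y1, y1) by apply: sub; apply/octP => /=; split; lra.
  by move=> /rectP /=; lra.
Qed.

Lemma tight_rot (q : oct R) : tight q -> tight (rotO q).
Proof.
case: q => x0 x1 y0 y1 u0 u1 v0 v1; rewrite /tight /=.
move=> /andP[t1 /and5P[t2 t3 t4 t5 /and3P[t6 t7 t8]]].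
by apply/andP; split; [lra|]; apply/and5P; split; last apply/and3P; try split; lra.
Qed.

Lemma tight_tr v (q : oct R) : tight q -> tight (trO v q).
Proof.
case: q => x0 x1 y0 y1 u0 u1 v0 v1; rewrite /tight /=.
move=> /andP[t1 /and5P[t2 t3 t4 t5 /and3P[t6 t7 t8]]].
by apply/andP; split; [lra|]; apply/and5P; split; last apply/and3P; try split; lra.
Qed.

Lemma tight_placed k v (q : oct R) : tight q -> tight (trO v (iter k (@rotO R) q)).
Proof.
by move=> tq; apply: tight_tr; elim: k => //= k IH; apply: tight_rot.
Qed.

(* The points with integer coordinates whose sum has the parity of [e]. *)
Definition ept (p q : int) : plane := ((p + q + e - 1)%:~R, (p - q - 1)%:~R).

(* The block of the points [ept p q] with [i0 <= p <= i1] and [j0 <= q <= j1]. *)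
Record code := Code { i0 : int; i1 : int; j0 : int; j1 : int }.
Implicit Type c : code.

(* Invariance of a block under the reflections in the lines at distance 1 beyond
   the four sides of the rectangle: such a block is cut by that side. *)
Definition symL c := (j0 c == - e - i1 c) && (j1 c == - e - i0 c).
Definition symR c := (j0 c == m + 1 - e - i1 c) && (j1 c == m + 1 - e - i0 c).
Definition symB c := (j0 c == i0 c) && (j1 c == i1 c).
Definition symT c := (j0 c == i0 c - (n + 1)) && (j1 c == i1 c - (n + 1)).

Definition valid c := [&& i0 c <= i1 c, j0 c <= j1 c,
  (2 <= i0 c + j0 c + e) || symL c, (i1 c + j1 c + e <= m - 1) || symR c,
  (2 <= i0 c - j1 c) || symB c, (i1 c - j0 c <= n - 1) || symT c &
  [|| symL c, symR c, symB c | symT c] ==> (i0 c < i1 c)].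

Definition oblk c : oct R :=
  Oct (i0 c + j0 c + e - 2)%:~R (i1 c + j1 c + e)%:~R
      (i0 c - j1 c - 2)%:~R (i1 c - j0 c)%:~R
      (2 * i0 c + e - 4)%:~R (2 * i1 c + e)%:~R
      (2 * j0 c + e - 2)%:~R (2 * j1 c + e + 2)%:~R.

Definition blkhp c := octhp (oblk c) ++ recthp.

Definition bdash c : set (set plane) := [set s |
  [\/ symL c /\ s = poly (blkhp c) `&` [set z | z.1 = 0],
      symR c /\ s = poly (blkhp c) `&` [set z | z.1 = m%:~R - 1],
      symB c /\ s = poly (blkhp c) `&` [set z | z.2 = 0] |
      symT c /\ s = poly (blkhp c) `&` [set z | z.2 = n%:~R - 1]]].

Definition blk c : polygon R := Polygon (poly (blkhp c)) (bdash c).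

Definition ocell (i j : int) : oct R :=
  Oct (i + j + e - 1)%:~R (i + j + e + 1)%:~R (i - j - 2)%:~R (i - j)%:~R
      (2 * i + e - 2)%:~R (2 * i + e)%:~R (2 * j + e)%:~R (2 * j + e + 2)%:~R.

Definition vcell (i j : int) := [&& 1 <= i + j + e, i + j + e + 2 <= m,
  2 <= i - j & i - j <= n - 1].

Definition cell i j : polygon R := Polygon (poly (octhp (ocell i j))) set0.

Lemma blkP c z : poly (blkhp c) z <-> poly (octhp (oblk c)) z /\ poly recthp z.
Proof. by rewrite poly_cat. Qed.

Lemma sblkP c z : spoly (blkhp c) z <-> spoly (octhp (oblk c)) z /\ spoly recthp z.
Proof. by rewrite spoly_cat. Qed.

Lemma nondeg_blkhp c : nondeg (blkhp c).
Proof. by rewrite nondeg_cat nondeg_octhp nondeg_recthp. Qed.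

Definition placed k (v : plane) (vs : seq plane) (ds : seq (plane * plane)) : polygon R :=
  Polygon (convex_hull [seq place k v p | p <- vs])
    [set segment (place k v s.1, place k v s.2) | s in [set` ds]].

Lemma place_mod k v p : place k v p = place (k %% 4) v p :> plane.
Proof.
rewrite {1}(divn_eq k 4) /place; congr (_ + v).
rewrite addnC iterD; congr (iter _ _ _).
elim: (k %/ 4)%N => // d IH; rewrite mulSn iterD IH.
by case: p {IH} => x y /=; rewrite !opprK.
Qed.

Lemma placed_mod k v vs ds : placed k v vs ds = placed (k %% 4) v vs ds.
Proof.
rewrite /placed; congr Polygon.
  by congr (convex_hull _); apply: eq_map => p; rewrite place_mod.
by congr (image _ _); apply: funext => s; rewrite !(place_mod k).
Qed.

Definition inside c := [&& i0 c <= i1 c, j0 c <= j1 c, 2 <= i0 c + j0 c + e,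
  i1 c + j1 c + e <= m - 1, 2 <= i0 c - j1 c & i1 c - j0 c <= n - 1].

Definition codeB k (p q : int) (a b : nat) := match k with
  | 0%N => Code (p + 1) (p + 1 + a%:Z) (q - b%:Z) q
  | 1%N => Code (p - b%:Z) p (q - 1 - a%:Z) (q - 1)
  | 2%N => Code (p - 1 - a%:Z) (p - 1) q (q + b%:Z)
  | _ => Code p (p + b%:Z) (q + 1) (q + 1 + a%:Z)
  end.

Lemma inside_blk c : inside c -> bdash c = set0 /\ poly (blkhp c) = poly (octhp (oblk c)).
Proof.
case: c => a1 a2 b1 b2; rewrite /inside /=.
move=> /and5P[h1 h2 h3 h4 /andP[h5 h6]]; split.
  apply/seteqP; split => // s; rewrite /bdash /symL /symR /symB /symT /=.
  by case=> -[]; lia.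
apply/seteqP; split => z; first by case/blkP.
move=> hz; apply/blkP; split=> //; move/octP: hz => /= [/andP[z1 z2] /andP[z3 z4] _ _].
move: h3 h4 h5 h6; rewrite -!(ler_int R) => h3 h4 h5 h6.
by apply/rectP; split; lra.
Qed.

Lemma placed_B k p q a b vs : (k < 4)%N ->
  convex_hull vs = poly (octhp (oB R a b)) -> inside (codeB k p q a b) ->
  placed k (ept p q) vs [::] = blk (codeB k p q a b).
Proof.
move=> k4 hv ins; have [d0 r0] := inside_blk ins.
rewrite /placed /blk d0 r0 (hull_place k _ hv).
have -> : [set segment (place k (ept p q) s.1, place k (ept p q) s.2) | s in [set` [::]]] = set0.
  by apply/seteqP; split => // s [].
congr Polygon; congr (poly (octhp _)).
by case: k k4 {ins d0 r0} => [|[|[|[|//]]]] _; rewrite /trO /oblk /=; congr Oct; lra.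
Qed.

Lemma placed_C k p q vs : (k < 4)%N -> convex_hull vs = poly (octhp (oC R)) ->
  placed k (ept p q) vs [::] =
  cell (nth 0 [:: p; p - 1; p - 1; p] k) (nth 0 [:: q - 1; q - 1; q; q] k).
Proof.
move=> k4 hv; rewrite /placed /cell (hull_place k _ hv).
have -> : [set segment (place k (ept p q) s.1, place k (ept p q) s.2) | s in [set` [::]]] = set0.
  by apply/seteqP; split => // s [].
congr Polygon; congr (poly (octhp _)).
by case: k k4 => [|[|[|[|//]]]] _; rewrite /trO /ocell /=; congr Oct; lra.
Qed.

Definition code5 k (p q : int) (a : nat) := match k with
  | 0%N => Code p (p + a%:Z) p (p + a%:Z)
  | 1%N => Code (p + 1) (p + 1 + a%:Z) (q - a%:Z) q
  | 2%N => Code (p - a%:Z) p (q - 1 - a%:Z) (q - 1)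
  | _ => Code (p - 1 - a%:Z) (p - 1) q (q + a%:Z)
  end.

Definition cond5 k (p q : int) (a : nat) := match k with
  | 0%N => [&& p - q == 1, 1 <= p + q + e, p + q + e + 2 * a%:Z + 2 <= m & a%:Z <= n - 1]
  | 1%N => [&& p + q + e == m, 1 <= p - q, p - q + 2 * a%:Z + 2 <= n & a%:Z <= m - 1]
  | 2%N => [&& p - q == n, p + q + e <= m, 2 * a%:Z + 3 <= p + q + e & a%:Z <= n - 1]
  | _ => [&& p + q + e == 1, p - q <= n, 2 * a%:Z + 3 <= p - q & a%:Z <= m - 1]
  end.

Definition v5 (a : nat) : seq plane :=
  [:: (0, 0); (2 * a%:R + 2, 0); (a%:R + 2, a%:R); (a%:R, a%:R)].
Definition d5 (a : nat) : seq (plane * plane) := [:: ((0, 0), (2 * a%:R + 2, 0))].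

Lemma dashed1 k v (s : plane * plane) :
  [set segment (place k v s.1, place k v s.2) | s in [set` [:: s]]] =
  [set convex_hull [seq place k v p | p <- [:: s.1; s.2]]].
Proof.
apply/seteqP; split => [y [x]|y ->]; first by rewrite /= inE => /eqP -> <-.
by exists s => //=; rewrite inE.
Qed.

Lemma region5 k p q a : (0 < a)%N -> (k < 4)%N -> cond5 k p q a ->
  poly (octhp (trO (ept p q) (iter k (@rotO R) (o5 R a)))) = poly (blkhp (code5 k p q a)).
Proof.
move=> a0 k4 cd.
have {}a0 : 1 <= a%:R :> R by rewrite (ler_nat R 1).
apply/seteqP; split => z; rewrite blkP ?octPb ?rectPb.
  by case: k k4 cd => [|[|[|[|//]]]] _ /= /and4P[/eqP h1]; rewrite -!(ler_int R) => h2 h3 h4;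
    (have {}h1 := congr1 (fun x : int => x%:~R : R) h1) => h; split; lra.
by case: k k4 cd => [|[|[|[|//]]]] _ /= /and4P[/eqP h1]; rewrite -!(ler_int R) => h2 h3 h4;
  (have {}h1 := congr1 (fun x : int => x%:~R : R) h1) => -[h h']; lra.
Qed.

End Codes.

Section CornerTriangles.
Variable R : realType.
Notation plane := (R * R)%type.
Notation hplane := (plane * R)%type.
Variables m n e : int.
Hypothesis m2 : 2 <= m.
Hypothesis n2 : 2 <= n.
Hypothesis e01 : 0 <= e <= 1.
Local Notation ept := (ept R e).
Local Notation recthp := (recthp R m n).
Local Notation blkhp := (blkhp R m n e).
Local Notation blk := (blk R m n e).
Local Notation cell := (cell R e).

(* [code6 k p q a] is the corner triangle of which [ept p q] is the end point
   of the leg obtained from [((0, 0), (a, 0))]. *)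
Definition code6 k (p q : int) (a : nat) := match k with
  | 0%N => Code (1 - e - p) (p - 1) (1 - e - p) (p - 1)
  | 1%N => Code (q + 1) p (q + 1) p
  | 2%N => Code (p + 1) (m + n + 1 - e - p) (p - n) (m - e - p)
  | _ => Code (1 - e - q) (q + n) (- e - q - n) (q - 1)
  end.

Definition cond6 k (p q : int) (a : nat) := [&& a%:Z <= m - 1, a%:Z <= n - 1 & match k with
  | 0%N => (p - q == 1) && (p + q + e == a%:Z + 1)
  | 1%N => (p + q + e == m) && (p - q == a%:Z + 1)
  | 2%N => (p - q == n) && (p + q + e == m - a%:Z)
  | _ => (p + q + e == 1) && (p - q == n - a%:Z)
  end].

Definition v6 (a : nat) : seq plane := [:: (0, 0); (a%:R, 0); (0, a%:R)].
Definition d6 (a : nat) : seq (plane * plane) :=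
  [:: ((0, 0), (a%:R, 0)); ((0, 0), (0, a%:R))].

Lemma place6 k v a p q : (k < 4)%N -> place k v (a%:R, 0) = ept p q ->
  v = (nth 0 [:: (ept p q).1 - a%:R; (ept p q).1; (ept p q).1 + a%:R; (ept p q).1] k,
       nth 0 [:: (ept p q).2; (ept p q).2 - a%:R; (ept p q).2; (ept p q).2 + a%:R] k).
Proof.
move: k => [|[|[|[|//]]]] _ <-; apply: plane_eqP; rewrite /place /=; ring.
Qed.

Lemma region6 k v p q a : (0 < a)%N -> (k < 4)%N -> cond6 k p q a ->
  place k v (a%:R, 0) = ept p q ->
  poly (octhp (trO v (iter k (@rotO R) (o6 R a)))) = poly (blkhp (code6 k p q a)).
Proof.
move=> a0 k4 cd /(place6 k4) ->.
have {}a0 : 1 <= a%:R :> R by rewrite (ler_nat R 1).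
case/and3P: cd; rewrite -!(ler_int R) => b1 b2 cd.
apply/seteqP; split => z; rewrite blkP ?octPb ?rectPb.
  by case: k k4 cd => [|[|[|[|//]]]] _ /= /andP[/eqP h1 /eqP h2];
    (have {}h1 := congr1 (fun x : int => x%:~R : R) h1);
    (have {}h2 := congr1 (fun x : int => x%:~R : R) h2) => h; split; lra.
by case: k k4 cd => [|[|[|[|//]]]] _ /= /andP[/eqP h1 /eqP h2];
  (have {}h1 := congr1 (fun x : int => x%:~R : R) h1);
  (have {}h2 := congr1 (fun x : int => x%:~R : R) h2) => -[h h']; lra.
Qed.

Lemma dashed2 k v (s t : plane * plane) :
  [set segment (place k v s.1, place k v s.2) | s in [set` [:: s; t]]] =
  [set convex_hull [seq place k v p | p <- [:: s.1; s.2]];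
       convex_hull [seq place k v p | p <- [:: t.1; t.2]]].
Proof.
apply/seteqP; split => [y [x]|y [->|->]].
- by rewrite /= !inE => /orP[/eqP ->|/eqP ->] <-; [left|right].
- by exists s => //=; rewrite !inE eqxx.
- by exists t => //=; rewrite !inE eqxx orbT.
Qed.

Lemma placed5 k p q a : (0 < a)%N -> (k < 4)%N -> cond5 m n e k p q a ->
  placed k (ept p q) (v5 R a) (d5 R a) = blk (code5 k p q a).
Proof.
move=> a0 k4 cd; rewrite /placed (hull_place k _ (hull_T5 R a)) dashed1 /blk.
have rg := region5 R a0 k4 cd; rewrite rg; congr Polygon.
rewrite (hull_place k _ (hull_H _)); last by rewrite addr_ge0 // mulr_ge0.
have a0' : 1 <= a%:R :> R by rewrite (ler_nat R 1).
have seg : poly (octhp (trO (ept p q) (iter k (@rotO R)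
     (Oct 0 (2 * a%:R + 2) 0 0 0 (2 * a%:R + 2) 0 (2 * a%:R + 2))))) =
   poly (blkhp (code5 k p q a)) `&`
   [set z | nth 0 [:: z.2; z.1; z.2; z.1] k = nth 0 [:: 0; m%:~R - 1; n%:~R - 1; 0] k].
  rewrite -rg; apply/seteqP; split => z; rewrite /setI /= !octPb;
  by case: k k4 cd {rg} => [|[|[|[|//]]]] _ /= /and4P[/eqP h1 _ _ _];
    (have {}h1 := congr1 (fun x : int => x%:~R : R) h1) => h; first [split; lra|case: h; lra].
rewrite /= in seg; rewrite seg; apply/seteqP; split => s.
  move=> ->; case: k k4 cd {rg seg} => [|[|[|[|//]]]] _ /= cd.
  - by constructor 3; split; rewrite // /symB /=; lia.
  - by constructor 2; split; rewrite // /symR /=; lia.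
  - by constructor 4; split; rewrite // /symT /=; lia.
  - by constructor 1; split; rewrite // /symL /=; lia.
rewrite /bdash /symL /symR /symB /symT /=.
by case: k k4 cd {rg seg} => [|[|[|[|//]]]] _ /= cd; case=> -[h ->] //; exfalso; lia.
Qed.

Lemma placed6 k v p q a : (0 < a)%N -> (k < 4)%N -> cond6 k p q a ->
  place k v (a%:R, 0) = ept p q ->
  placed k v (v6 a) (d6 a) = blk (code6 k p q a).
Proof.
move=> a0 k4 cd ve; rewrite /placed (hull_place k _ (hull_T6 R a)) dashed2 /blk.
have rg := region6 a0 k4 cd ve; rewrite rg; congr Polygon.
rewrite (hull_place k _ (hull_H _)) // (hull_place k _ (hull_V _)) //.
have a0' : 1 <= a%:R :> R by rewrite (ler_nat R 1).
have vE := place6 k4 ve.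
have seg1 : poly (octhp (trO v (iter k (@rotO R)
     (Oct 0 a%:R 0 0 0 a%:R 0 a%:R)))) =
   poly (blkhp (code6 k p q a)) `&`
   [set z | nth 0 [:: z.2; z.1; z.2; z.1] k = nth 0 [:: 0; m%:~R - 1; n%:~R - 1; 0] k].
  rewrite -rg vE; apply/seteqP; split => z; rewrite /setI /= !octPb;
  by case: k k4 cd {rg ve vE} => [|[|[|[|//]]]] _ /= /and3P[_ _ /andP[/eqP h1 /eqP h2]];
    (have {}h1 := congr1 (fun x : int => x%:~R : R) h1);
    (have {}h2 := congr1 (fun x : int => x%:~R : R) h2) => h; first [split; lra|case: h; lra].
have seg2 : poly (octhp (trO v (iter k (@rotO R)
     (Oct 0 0 0 a%:R 0 a%:R (- a%:R) 0)))) =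
   poly (blkhp (code6 k p q a)) `&`
   [set z | nth 0 [:: z.1; z.2; z.1; z.2] k = nth 0 [:: 0; 0; m%:~R - 1; n%:~R - 1] k].
  rewrite -rg vE; apply/seteqP; split => z; rewrite /setI /= !octPb;
  by case: k k4 cd {rg ve vE seg1} => [|[|[|[|//]]]] _ /= /and3P[_ _ /andP[/eqP h1 /eqP h2]];
    (have {}h1 := congr1 (fun x : int => x%:~R : R) h1);
    (have {}h2 := congr1 (fun x : int => x%:~R : R) h2) => h; first [split; lra|case: h; lra].
rewrite /cond6 in cd; rewrite seg1 seg2 /bdash /symL /symR /symB /symT; apply/seteqP; split => s.
  by case=> ->; case: k k4 cd {rg seg1 seg2 ve vE} => [|[|[|[|//]]]] _ /= cd;
    first [by constructor 1; split; [lia|] | by constructor 2; split; [lia|]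
     | by constructor 3; split; [lia|] | by constructor 4; split; [lia|]].
by case: k k4 cd {rg seg1 seg2 ve vE} => [|[|[|[|//]]]] _ /= cd; case=> -[h ->] //;
  first [by left|by right|by exfalso; lia].
Qed.

End CornerTriangles.

Section TileCodes.
Variable R : realType.
Notation plane := (R * R)%type.
Notation hplane := (plane * R)%type.
Variables m n e : int.
Hypothesis m2 : 2 <= m.
Hypothesis n2 : 2 <= n.
Hypothesis e01 : 0 <= e <= 1.
Local Notation ept := (ept R e).
Local Notation recthp := (recthp R m n).
Local Notation blkhp := (blkhp R m n e).
Local Notation blk := (blk R m n e).
Local Notation cell := (cell R e).
Local Notation valid := (valid m n e).
Local Notation vcell := (vcell m n e).

Lemma place0 k (v : plane) : place k v (0, 0) = v.
Proof.
rewrite /place (_ : iter k _ _ = (0, 0)); first by rewrite add0r.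
by elim: k => //= k ->; rewrite oppr0.
Qed.

Lemma tile_cell i j : tile (cell i j).
Proof.
exists [:: (0, 0); (1, 1); (0, 2); (-1, 1)], [::], 0%N, (ept i (j + 1)); split; first exact: T2.
by have := @placed_C R e 0 i (j + 1) _ isT (hull_T2 R) => /= /esym; rewrite addrK.
Qed.

Lemma int_diff (x y : int) : x <= y -> exists a : nat, y = x + a%:Z.
Proof. by move=> xy; exists `|y - x|%N; lia. Qed.

Lemma tile_blk c : valid c -> tile (blk c).
Proof.
case: c => a1 a2 b1 b2; rewrite /valid /symL /symR /symB /symT /= => vc.
have [a aE] : exists a : nat, a2 = a1 + a%:Z by apply: int_diff; lia.
have [b bE] : exists b : nat, b2 = b1 + b%:Z by apply: int_diff; lia.
have placeS k v (w : plane) : place k (w - place k 0 v) v = w.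
  by rewrite /place addr0 addrC subrK.
have [ins|out] := boolP (inside m n e (Code a1 a2 b1 b2)).
  case: a aE => [|a] aE; last case: b bE => [|b] bE.
  - case: b bE => [|b] bE.
      exists [:: (0, 0); (2, 0); (2, 2); (0, 2)], [::], 0%N, (ept (a1 - 1) b2).
      split; first exact: T1.
      have cE : Code a1 a2 b1 b2 = codeB 0 (a1 - 1) b2 0 0 by congr Code; lia.
      by rewrite cE in ins *; rewrite -(placed_B m2 n2 e01 _ (hull_T1 R) ins).
    exists [:: (0, 0); (2, 0); (2, 2); (2 - b.+1%:R, 2 + b.+1%:R);
      (- b.+1%:R, 2 + b.+1%:R); (- b.+1%:R, b.+1%:R)], [::], 0%N, (ept (a1 - 1) b2).
    split; first exact: (@T4 R b.+1 isT).
    have cE : Code a1 a2 b1 b2 = codeB 0 (a1 - 1) b2 0 b.+1 by congr Code; lia.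
    by rewrite cE in ins *; rewrite -(placed_B m2 n2 e01 _ (hull_T4 R _) ins).
  - exists [:: (0, 0); (2, 0); (2, 2); (2 - a.+1%:R, 2 + a.+1%:R);
      (- a.+1%:R, 2 + a.+1%:R); (- a.+1%:R, a.+1%:R)], [::], 1%N, (ept a2 (b2 + 1)).
    split; first exact: (@T4 R a.+1 isT).
    have cE : Code a1 a2 b1 b2 = codeB 1 a2 (b2 + 1) 0 a.+1 by congr Code; lia.
    by rewrite cE in ins *; rewrite -(placed_B m2 n2 e01 _ (hull_T4 R _) ins).
  exists (vB R a.+1 b.+1), [::], 0%N, (ept (a1 - 1) b2).
  split; first exact: (@T3 R a.+1 b.+1 isT isT).
  have cE : Code a1 a2 b1 b2 = codeB 0 (a1 - 1) b2 a.+1 b.+1 by congr Code; lia.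
  by rewrite cE in ins *; rewrite -(placed_B m2 n2 e01 _ (hull_vB R _ _) ins).
rewrite /inside /= in out.
have a0 : (0 < a)%N by lia.
suff [k [p [q [k4 [[cd cE]|[cd cE]]]]]] : exists k p q, (k < 4)%N /\
    (cond5 m n e k p q a /\ Code a1 a2 b1 b2 = code5 k p q a \/
     cond6 m n e k p q a /\ Code a1 a2 b1 b2 = code6 m n e k p q a).
- exists (v5 R a), (d5 R a), k, (ept p q); split; first exact: (@T5 R a a0).
  by rewrite cE -(placed5 R m2 n2 e01 a0 k4 cd).
- exists (v6 R a), (d6 R a), k, (ept p q - place k 0 (a%:R, 0)).
  split; first exact: (@T6 R a a0).
  by rewrite cE -(placed6 m2 n2 e01 a0 k4 cd (placeS _ _ _)).
move: vc; clear placeS; case: (boolP ((b1 == - e - a2) && _)) => [/andP[/eqP L1 /eqP L2]|_];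
  case: (boolP ((b1 == m + 1 - e - a2) && _)) => [/andP[/eqP R1 /eqP R2]|_];
  case: (boolP ((b1 == a1) && _)) => [/andP[/eqP B1 /eqP B2]|_];
  case: (boolP ((b1 == a1 - (n + 1)) && _)) => [/andP[/eqP T1 /eqP T2]|_];
  rewrite /= ?orbT ?orbF ?andbT /= => vc;
  try by [exfalso; clear out; lia|exfalso; lia].
- exists 0%N, (a2 + 1), a2; split=> //; right.
  by rewrite /cond6; clear out; split; [lia|congr Code; lia].
- exists 3%N, (1 - e - b2 - 1), (b2 + 1); split=> //; right.
  by rewrite /cond6; clear out; split; [lia|congr Code; lia].
- exists 3%N, (a2 + 1), b1; split=> //; left.
  by clear out; split; [rewrite /=; lia|congr Code; lia].
- exists 1%N, a2, (a1 - 1); split=> //; right.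
  by rewrite /cond6; clear out; split; [lia|congr Code; lia].
- exists 2%N, (a1 - 1), (a1 - 1 - n); split=> //; right.
  by rewrite /cond6; clear out; split; [lia|congr Code; lia].
- exists 1%N, (a1 - 1), b2; split=> //; left.
  by clear out; split; [rewrite /=; lia|congr Code; lia].
- exists 0%N, a1, (a1 - 1); split=> //; left.
  by clear out; split; [rewrite /=; lia|congr Code; lia].
- exists 2%N, a2, (b2 + 1); split=> //; left.
  by clear out; split; [rewrite /=; lia|congr Code; lia].
Qed.

Lemma code_inside k p q a b vs : (k < 4)%N ->
  convex_hull vs = poly (octhp (oB R a b)) ->
  convex_hull [seq place k (ept p q) z | z <- vs] `<=` poly recthp ->
  inside m n e (codeB k p q a b).
Proof.
move=> k4 hv; rewrite (hull_place k _ hv) => /oct_in_rect.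
have a0 := ler0n R a; have b0 := ler0n R b.
have : tight (oB R a b).
  by rewrite /tight /=; apply/andP; split; [lra|];
      apply/and5P; split; last apply/and3P; try split; lra.
move=> /(tight_placed k (ept p q)) tq /(_ tq) [].
by rewrite /inside; case: k k4 {tq} => [|[|[|[|//]]]] _ /= h1 h2 h3 h4;
  rewrite -!(ler_int R); lra.
Qed.

Lemma inside_valid c : inside m n e c -> valid c.
Proof. by case: c => a1 a2 b1 b2; rewrite /inside /valid /symL /symR /symB /symT /=; lia. Qed.

Lemma tight_o5 i : tight (o5 R i).
Proof.
have := ler0n R i; rewrite /tight /= => i0.
by apply/andP; split; [lra|];
      apply/and5P; split; last apply/and3P; try split; lra.
Qed.

Lemma tight_o6 i : tight (o6 R i).
Proof.
have := ler0n R i; rewrite /tight /= => i0.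
by apply/andP; split; [lra|];
      apply/and5P; split; last apply/and3P; try split; lra.
Qed.

Lemma placed6_corner k (v : plane) (i : nat) : (k < 4)%N -> (0 < i)%N ->
  region (placed k v (v6 R i) (d6 R i)) `<=` poly recthp ->
  (forall s, dashed (placed k v (v6 R i) (d6 R i)) s -> s `<=` boundary (poly recthp)) ->
  [/\ v.1 = nth 0 [:: 0; m%:~R - 1; m%:~R - 1; 0] k,
     v.2 = nth 0 [:: 0; 0; n%:~R - 1; n%:~R - 1] k,
     i%:R <= m%:~R - 1 :> R & i%:R <= n%:~R - 1 :> R].
Proof.
move=> k4 i0; have a1 : 1 <= i%:R :> R by rewrite (ler_nat R 1).
rewrite /= (hull_place k _ (hull_T6 R _)) => /oct_in_rect.
move=> /(_ (tight_placed k v (tight_o6 i))) bds bd; pose a : R := i%:R.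
have b1 : boundary (poly recthp) (place k v (a / 2, 0)).
  apply: (bd (segment (place k v (0, 0), place k v (a, 0)))).
    by exists ((0, 0), (a, 0)) => //=; rewrite !inE eqxx.
  have : convex_hull [seq place k v z | z <- [:: (0, 0); (a, 0)]]
     (place k v (a / 2, 0)); last by [].
  rewrite (hull_place k _ (hull_H _)); last by rewrite /a; lra.
  by apply/octPb; rewrite /place /a; case: k k4 {bd bds} => [|[|[|[|//]]]] _ /=; lra.
have b2 : boundary (poly recthp) (place k v (0, a / 2)).
  apply: (bd (segment (place k v (0, 0), place k v (0, a)))).
    by exists ((0, 0), (0, a)) => //=; rewrite !inE eqxx orbT.
  have : convex_hull [seq place k v z | z <- [:: (0, 0); (0, a)]]
     (place k v (0, a / 2)); last by [].
  rewrite (hull_place k _ (hull_V _)); last by rewrite /a; lra.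
  by apply/octPb; rewrite /place /a; case: k k4 {bd bds b1} => [|[|[|[|//]]]] _ /=; lra.
move/rect_boundaryP: b1 => [_ b1]; move/rect_boundaryP: b2 => [_ b2].
case: bds; case: k k4 {bd} b1 b2 => [|[|[|[|//]]]] _ /= b1 b2 h1 h2 h3 h4;
  rewrite /place /= /a in b1 b2; split; first [lra|case: b1; lra|case: b2; lra].
Qed.

Lemma code_of_placed k (v : plane) vs ds : (k < 4)%N -> prototile vs ds ->
  region (placed k v vs ds) `<=` poly recthp ->
  (forall s, dashed (placed k v vs ds) s -> s `<=` boundary (poly recthp)) ->
  (forall z, z \in vs -> (size ds = 2 -> z != 0) -> exists p q, place k v z = ept p q) ->
  (exists2 c, valid c & placed k v vs ds = blk c) \/
  (exists i j, vcell i j /\ placed k v vs ds = cell i j).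
Proof.
move=> k4 pt; have box a b ws : convex_hull ws = poly (octhp (oB R a b)) -> (0, 0) \in ws ->
    convex_hull [seq place k v z | z <- ws] `<=` poly recthp ->
    (forall z, z \in ws -> (0 = 2%N -> z != 0) -> exists p q, place k v z = ept p q) ->
    exists2 c, valid c & placed k v ws [::] = blk c.
  move=> hw w0 sub /(_ _ w0) [//|p [q]]; rewrite place0 => ve; rewrite ve in sub *.
  have ins := code_inside k4 hw sub.
  by exists (codeB k p q a b); [apply: inside_valid|apply: placed_B].
case: pt => [||i j a b i0 j0|i a i0|i a i0|i a i0] /= sub bd sol.
- by left; apply: (box 0%N 0%N); rewrite // ?hull_T1 // inE eqxx.
- right; have [//|p [q]] := sol (0, 0) (mem_head _ _); rewrite place0 => ve; rewrite ve in sub *.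
  exists (nth 0 [:: p; p - 1; p - 1; p] k), (nth 0 [:: q - 1; q - 1; q; q] k).
  split; last exact: (placed_C _ _ _ k4 (hull_T2 R)).
  move: sub; rewrite (hull_place k _ (hull_T2 R)) => /oct_in_rect.
  have : tight (oC R).
    by rewrite /tight /=; apply/andP; split; [lra|];
      apply/and5P; split; last apply/and3P; try split; lra.
  move=> /(tight_placed k (ept p q)) tq /(_ tq) [].
  by rewrite /vcell; case: k k4 {tq ve box bd sol} => [|[|[|[|//]]]] _ /= h1 h2 h3 h4;
    rewrite -!(ler_int R); lra.
- by left; apply: (box i j); rewrite // ?hull_vB // inE eqxx.
- by left; apply: (box 0%N i); rewrite // ?hull_T4 // inE eqxx.
- left; have [//|p [q]] := sol (0, 0) (mem_head _ _); rewrite place0 => ve; rewrite ve in sub bd *.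
  have a1 : 1 <= i%:R :> R by rewrite (ler_nat R 1).
  suff cd : cond5 m n e k p q i.
    exists (code5 k p q i); last exact: placed5.
    rewrite /valid /symL /symR /symB /symT.
    by case: k k4 cd {sub bd sol ve box} => [|[|[|[|//]]]] _ /= cd; lia.
  move: sub; rewrite (hull_place k _ (hull_T5 R _)) => /oct_in_rect.
  move=> /(_ (tight_placed k (ept p q) (tight_o5 i))) bds.
  have : boundary (poly recthp) (place k (ept p q) (a + 1, 0)).
    apply: (bd (segment (place k (ept p q) (0, 0), place k (ept p q) (2 * a + 2, 0)))).
      by exists ((0, 0), (2 * a + 2, 0)) => //=; rewrite inE.
    have : convex_hull [seq place k (ept p q) z | z <- [:: (0, 0); (2 * a + 2, 0)]]
       (place k (ept p q) (a + 1, 0)); last by [].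
    rewrite (hull_place k _ (hull_H _)); last by rewrite /a; lra.
    by apply/octPb; rewrite /place /a; case: k k4 {sol ve box bd bds} => [|[|[|[|//]]]] _ /=; lra.
  move=> /rect_boundaryP[_].
  by case: bds; case: k k4 {sol ve box bd} => [|[|[|[|//]]]] _ /= h1 h2 h3 h4 bdr;
    apply/and4P; (split;
      [apply/eqP; apply: (@intr_inj R); rewrite /place /= /a in bdr *; case: bdr; lra| | |]);
    rewrite -!(ler_int R); lra.
left; have [||p [q ve]] := sol (i%:R, 0); first by rewrite !inE eqxx orbT.
  by rewrite xpair_eqE pnatr_eq0 negb_and -lt0n i0.
have a1 : 1 <= i%:R :> R by rewrite (ler_nat R 1).
suff cd : cond6 m n e k p q i.
  exists (code6 m n e k p q i); last exact: placed6.
  rewrite /valid /symL /symR /symB /symT; rewrite /cond6 in cd.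
  by case: k k4 cd {sub bd sol ve box} => [|[|[|[|//]]]] _ /= cd; lia.
have [v1 v2 bm bn] := placed6_corner k4 i0 sub bd.
rewrite (place6 k4 ve) in v1 v2.
rewrite /cond6 -!(ler_int R) in v1 v2 *.
by case: k k4 {sub ve box bd sol} v1 v2 => [|[|[|[|//]]]] _ /= v1 v2;
  (apply/and3P; split; [lra|lra|]);
  apply/andP; split; apply/eqP; apply: (@intr_inj R); lra.
Qed.

End TileCodes.

(** * The vertex lattice of a tiling of the rectangle *)

Section Integrality.
Variable R : realType.
Notation plane := (R * R)%type.
Notation hplane := (plane * R)%type.

Definition evenL : set plane :=
  [set z | exists p q : int, z = ((p + q)%:~R, (p - q)%:~R)].

Lemma evenL_add z w : evenL z -> evenL w -> evenL (z + w).
Proof.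
move=> [p [q ->]] [p' [q' ->]]; exists (p + p'), (q + q').
by apply: plane_eqP => /=; lra.
Qed.

Lemma evenL_opp z : evenL z -> evenL (- z).
Proof.
move=> [p [q ->]]; exists (- p), (- q).
by apply: plane_eqP => /=; lra.
Qed.

Lemma evenL_int z : evenL z -> z.1 \is a Num.int /\ z.2 \is a Num.int.
Proof. by move=> [p [q ->]]; rewrite /= !intr_int. Qed.

Lemma evenL_rot z : evenL z -> evenL (rot z).
Proof.
move=> [p [q ->]]; exists q, (- p).
by apply: plane_eqP => /=; lra.
Qed.

Lemma evenL_place k v z w : evenL (z - w) -> evenL (place k v z - place k v w).
Proof.
move=> h; have -> : place k v z - place k v w = iter k (@rot R) z - iter k (@rot R) w.
  by rewrite /place opprD addrACA subrr addr0.
elim: k => //= k /evenL_rot; congr evenL.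
by apply: plane_eqP => /=; ring.
Qed.

(* The two legs of a triangle are its dashed sides, and meet at the origin. *)
Definition solid (vs : seq plane) (ds : seq (plane * plane)) z :=
  z \in vs /\ (size ds = 2 -> z != 0).

Lemma proto_solid vs ds : prototile vs ds -> exists z, solid vs ds z.
Proof.
case=> [||i j a b i0 j0|i a i0|i a i0|i a i0];
  try by [exists (0, 0); split; rewrite ?mem_head].
exists (a, 0); split; first by rewrite !inE eqxx orbT.
by rewrite xpair_eqE pnatr_eq0 negb_and -lt0n i0.
Qed.

Lemma proto_lattice vs ds z w : prototile vs ds -> solid vs ds z -> solid vs ds w ->
  evenL (z - w).
Proof.
move=> pt; suff [w0 w0P] : exists w0, forall z, solid vs ds z -> evenL (z - w0).
  move=> /w0P h1 /w0P h2; have -> : z - w = (z - w0) + - (w - w0).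
    by apply: plane_eqP => /=; ring.
  by apply: evenL_add => //; apply: evenL_opp.
case: pt => [||i j a b i0 j0|i a i0|i a i0|i a i0].
- exists 0 => {}z [+ _]; move: z; forall_seq; rewrite subr0;
    [exists 0, 0|exists 1, 1|exists 2, 0|exists 1, (-1)]; by apply: plane_eqP => /=; lra.
- exists 0 => {}z [+ _]; move: z; forall_seq; rewrite subr0;
    [exists 0, 0|exists 1, 0|exists 1, (-1)|exists 0, (-1)]; by apply: plane_eqP => /=; lra.
- exists 0 => {}z [+ _]; move: z; forall_seq; rewrite subr0 /a /b;
    [exists 0, 0|exists 1, 1|exists (1 + i%:Z), 1|exists (2 + i%:Z), 0
    |exists (2 + i%:Z), (- j%:Z)|exists (1 + i%:Z), (-1 - j%:Z)
    |exists 1, (-1 - j%:Z)|exists 0, (- j%:Z)]; by apply: plane_eqP => /=; lra.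
- exists 0 => {}z [+ _]; move: z; forall_seq; rewrite subr0 /a;
    [exists 0, 0|exists 1, 1|exists 2, 0|exists 2, (- i%:Z)
    |exists 1, (-1 - i%:Z)|exists 0, (- i%:Z)]; by apply: plane_eqP => /=; lra.
- exists 0 => {}z [+ _]; move: z; forall_seq; rewrite subr0 /a;
    [exists 0, 0|exists (1 + i%:Z), (1 + i%:Z)|exists (1 + i%:Z), 1|exists i%:Z, 0];
    by apply: plane_eqP => /=; lra.
exists (a, 0) => {}z [+ /(_ erefl)]; move: z; forall_seq; rewrite ?eqxx // => _ ; rewrite /a;
  [exists 0, 0|exists 0, (- i%:Z)]; by apply: plane_eqP => /=; lra.
Qed.

Lemma proto_oct vs ds : prototile vs ds ->
  exists q : oct R, convex_hull vs = poly (octhp q) /\ exists c : plane, spoly (octhp q) c.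
Proof.
case=> [||i j a b i0 j0|i a i0|i a i0|i a i0].
- exists (oB R 0 0); rewrite hull_T1; split=> //; exists (1, 1); apply/soctP => /=.
  by split; lra.
- exists (oC R); rewrite hull_T2; split=> //; exists (0, 1); apply/soctP => /=.
  by split; lra.
- exists (oB R i j); rewrite -hull_vB; split=> //.
  have := ler0n R i; have := ler0n R j => *.
  exists (1 + a / 2 - b / 2, 1 + a / 2 + b / 2); apply/soctP => /=; rewrite /a /b.
  by split; lra.
- exists (oB R 0 i); rewrite hull_T4; split=> //.
  have := ler0n R i => *.
  exists (1 - a / 2, 1 + a / 2); apply/soctP => /=; rewrite /a.
  by split; lra.
- exists (o5 R i); rewrite hull_T5; split=> //.
  have a1 : 1 <= i%:R :> R by rewrite (ler_nat R 1).
  exists (a + 1, a / 2); apply/soctP => /=; rewrite /a.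
  by split; lra.
- exists (o6 R i); rewrite hull_T6; split=> //.
  have a1 : 1 <= i%:R :> R by rewrite (ler_nat R 1).
  exists (a / 4, a / 4); apply/soctP => /=; rewrite /a.
  by split; lra.
Qed.

Lemma spoly_place k v q (c : plane) : spoly (octhp q) c ->
  spoly (octhp (trO v (iter k (@rotO R) q))) (place k v c).
Proof.
move=> qc; have : spoly (octhp (iter k (@rotO R) q)) (iter k (@rot R) c).
  elim: k => //= k /soctP[/andP[? ?] /andP[? ?] /andP[? ?] /andP[? ?]].
  by apply/soctP => /=; split; lra.
have -> : place k v c = iter k (@rot R) c + v by [].
move: (iter k _ _) (iter k _ _) => c' q' /soctP[/andP[? ?] /andP[? ?] /andP[? ?] /andP[? ?]].
by apply/soctP => /=; split; lra.
Qed.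

Variables m n : int.
Hypothesis m2 : 2 <= m.
Hypothesis n2 : 2 <= n.
Local Notation recthp := (recthp R m n).

Lemma int_parity (x y : int) : exists2 e : int, 0 <= e <= 1 &
  forall p : plane, evenL (p - (x%:~R, y%:~R)) -> exists p' q', p = ept R e p' q'.
Proof.
exists ((x + y) %% 2)%Z; first by lia.
move=> p [a [b ab]]; exists (a + ((x + y) %/ 2)%Z + 1), (b + ((x + y) %/ 2)%Z - y).
have := divz_eq (x + y) 2; set d := (_ %/ _)%Z; set r := (_ %% _)%Z => xy.
have xy' : x%:~R + y%:~R = d%:~R * 2 + r%:~R :> R by rewrite -intrD xy; lra.
have -> : p = ((a + b)%:~R, (a - b)%:~R) + (x%:~R, y%:~R) by rewrite -ab subrK.
by apply: plane_eqP => /=; lra.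
Qed.

Lemma proto_two vs ds : prototile vs ds -> size ds = 2 ->
  exists2 i, (0 < i)%N & vs = v6 R i /\ ds = d6 R i.
Proof. by case=> // i a i0 _; exists i. Qed.

(* At its right angle, a triangle with both legs on the boundary spans the
   same cone as the rectangle. *)
Lemma corner_supports k (v a q : plane) i : (k < 4)%N -> (0 < i)%N ->
  region (placed k v (v6 R i) (d6 R i)) `<=` poly recthp ->
  (forall s, dashed (placed k v (v6 R i) (d6 R i)) s -> s `<=` boundary (poly recthp)) ->
  (forall z, region (placed k v (v6 R i) (d6 R i)) z -> dot a z <= dot a v) ->
  poly recthp q -> dot a q <= dot a v.
Proof.
move=> k4 i0 sub bd av /rectP[/andP[q1 q2] /andP[q3 q4]].
have [v1 v2 _ _] := placed6_corner k4 i0 sub bd.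
have i1 : 0 < i%:R :> R by rewrite ltr0n.
have r1 : dot a (place k v (i%:R, 0)) <= dot a v.
  by apply: av; apply: hull_vertex; apply/mapP; exists (i%:R, 0); rewrite // !inE eqxx orbT.
have r2 : dot a (place k v (0, i%:R)) <= dot a v.
  by apply: av; apply: hull_vertex; apply/mapP; exists (0, i%:R); rewrite // !inE eqxx !orbT.
rewrite /dot /place in r1 r2 *.
move: (i%:R : R) i1 r1 r2 => r i1.
have key (x y : R) : x * y <= 0 -> 0 < y -> x <= 0.
  by move=> xy y0; move: xy; rewrite pmulr_lle0.
case: k k4 {sub bd av} v1 v2 => [|[|[|[|//]]]] _ /= v1 v2 r1 r2.
- have a1 : a.1 <= 0 by apply: (key _ r) => //; lra.
  have a2 : a.2 <= 0 by apply: (key _ r) => //; lra.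
  by rewrite v1 v2; nra.
- have a1 : - a.1 <= 0 by apply: (key _ r) => //; lra.
  have a2 : a.2 <= 0 by apply: (key _ r) => //; lra.
  by rewrite v1 v2; nra.
- have a1 : - a.1 <= 0 by apply: (key _ r) => //; lra.
  have a2 : - a.2 <= 0 by apply: (key _ r) => //; lra.
  by rewrite v1 v2; nra.
- have a1 : a.1 <= 0 by apply: (key _ r) => //; lra.
  have a2 : - a.2 <= 0 by apply: (key _ r) => //; lra.
  by rewrite v1 v2; nra.
Qed.

Theorem tiling_codes (T : set (polygon R)) : tiling (poly recthp) T ->
  exists2 e : int, 0 <= e <= 1 & forall t, T t ->
    (exists2 c, valid m n e c & t = blk R m n e c) \/
    (exists i j, vcell m n e i j /\ t = cell R e i j).
Proof.
move=> [finT tileT coverT disjT dashT].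
have /choice[rep repP] (t : polygon R) : exists r : seq plane * seq (plane * plane) * nat * plane,
    T t -> [/\ prototile r.1.1.1 r.1.1.2, (r.1.2 < 4)%N &
            t = placed r.1.2 r.2 r.1.1.1 r.1.1.2].
  have [Tt|nT] := pselect (T t); last by exists ([::], [::], 0%N, 0).
  have [vs [ds [k [v [pt te]]]]] := tileT t Tt.
  exists (vs, ds, (k %% 4)%N, v) => _; split=> //=; first by rewrite ltn_mod.
  by rewrite -placed_mod.
pose VS t := (rep t).1.1.1; pose DS t := (rep t).1.1.2; pose kk t := (rep t).1.2.
pose vv t := (rep t).2.
have pt t : T t -> prototile (VS t) (DS t) by case/repP.
have k4 t : T t -> (kk t < 4)%N by case/repP.
have tE t : T t -> t = placed (kk t) (vv t) (VS t) (DS t) by case/repP.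
have /choice[oo ooP] (t : polygon R) : exists q : oct R,
    T t -> convex_hull (VS t) = poly (octhp q) /\
    exists c : plane, spoly (octhp q) c.
  have [Tt|nT] := pselect (T t); last by exists (oC R).
  by have [q qP] := proto_oct (pt t Tt); exists q.
pose V t := [seq place (kk t) (vv t) z | z <- VS t].
pose S t : set plane := [set p | exists z, solid (VS t) (DS t) z /\ p = place (kk t) (vv t) z].
pose hs t := octhp (trO (vv t) (iter (kk t) (@rotO R) (oo t))).
have K_hull t : T t -> region t = convex_hull (V t).
  by move=> Tt; rewrite {1}(tE t Tt).
have K_poly t : T t -> region t = poly (hs t).
  by move=> Tt; rewrite K_hull // /V (hull_place _ _ (ooP t Tt).1).
have sub t : T t -> region t `<=` poly recthp.
  by move=> Tt z tz; rewrite -coverT; exists t.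
have cover z : poly recthp z <-> exists2 t, T t & region t z.
  by rewrite -coverT; split=> -[t Tt tz]; exists t.
have disj t s z : T t -> T s -> spoly (hs t) z -> spoly (hs s) z -> t = s.
  move=> Tt Ts tz sz; apply: disjT => //; exists z.
  by split; rewrite K_poly // interior_poly // nondeg_octhp.
have K_int t : T t -> exists c : plane, spoly (hs t) c.
  move=> Tt; have [_ [c qc]] := ooP t Tt.
  by exists (place (kk t) (vv t) c); apply: spoly_place.
have X_box (z w : plane) : poly recthp z -> poly recthp w -> poly recthp (w.1, z.2).
  by rewrite !rectP /= => -[_ ?] [? _].
have X_bounded (a : plane) : exists B, forall z, poly recthp z -> dot a z <= B.
  pose d : R := m%:~R + n%:~R.
  exists (dot a 0 + (`|a.1| + `|a.2|) * d) => z /rectP[/andP[z1 z2] /andP[z3 z4]].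
  move: m2 n2; rewrite -!(ler_int R) => m2' n2'.
  by apply: dot_le; rewrite /= subr0 ger0_norm // /d; lra.
have S_solid t p a q : T t -> p \in V t -> (forall z, region t z -> dot a z <= dot a p) ->
    poly recthp q -> dot a p < dot a q -> S t p.
  move=> Tt /mapP[z zV ->] ap Xq aq; exists z; split=> //; split=> // ds2.
  apply/eqP => z0; subst z.
  have [i i0 [vE dE]] := proto_two (pt t Tt) ds2.
  have tP := tE t Tt; rewrite vE dE in tP; rewrite place0 in ap aq.
  suff : dot a q <= dot a (vv t) by rewrite leNgt aq.
  apply: (@corner_supports (kk t) (vv t) a q i) => //; try exact: k4.
  - by rewrite -tP; apply: sub.
  - by move=> s; rewrite -tP; apply: dashT.
  - by rewrite -tP.
have S_lat t p q : T t -> S t p -> S t q -> evenL (p - q).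
  move=> Tt [z [sz ->]] [w [sw ->]]; apply: evenL_place.
  exact: proto_lattice (pt t Tt) sz sw.
have S_neq0 t : T t -> exists p, S t p.
  move=> Tt; have [z sz] := proto_solid (pt t Tt).
  by exists (place (kk t) (vv t) z), z.
have all_cong := @all_congruent R (polygon R) T (@region R) hs V S (poly recthp) evenL
  finT K_hull K_poly (fun t h Tt hin => allP (nondeg_octhp _) h hin)
  (fun t h Tt hin => octhp_int hin) K_int cover
  (fun t z w t01 => @poly_mix R recthp t z w t01) X_box X_bounded disj S_neq0
  S_solid evenL_add evenL_opp evenL_int S_lat.
have [t0 [p0 [Tt0 Sp0 [x0 [y0 p0E]]]]] : exists t p, [/\ T t, S t p &
    exists x y : int, p = (x%:~R, y%:~R)].
  have X0 : poly recthp (0, 0).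
    move: m2 n2; rewrite -!(ler_int R) => m2' n2'.
    by apply/rectP => /=; split; lra.
  have [t Tt t0] : exists2 t, T t & region t (0, 0) by apply/cover.
  have [p [pV ap bp]] : exists p, [/\ p \in V t, dot (-1, 0) p = 0 &
      dot (0, -1) (0, 0) <= dot (0, -1) p].
    apply: hull_face; last by rewrite /dot /=; ring.
      move=> p pV; have : poly recthp p.
        by apply: (sub t Tt); rewrite K_hull //; apply: hull_vertex.
      by move=> /rectP; rewrite /dot /=; lra.
    by rewrite -K_hull.
  have : poly recthp p by apply: (sub t Tt); rewrite K_hull //; apply: hull_vertex.
  move=> /rectP[/andP[p1 _] /andP[p2 _]].
  have {ap bp p1 p2}p0 : p = (0, 0).
    by apply: plane_eqP => /=; rewrite /dot /= in ap bp; lra.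
  case/mapP: pV => z zV pz.
  have [/andP[/eqP ds2 /eqP z0]|sol] := boolP ((size (DS t) == 2) && (z == 0)).
    have [i i0 [vE dE]] := proto_two (pt t Tt) ds2.
    have v0 : vv t = 0.
      by rewrite -(_ : p = vv t) // pz z0; apply: place0.
    exists t, (place (kk t) (vv t) (i%:R, 0)); split=> //.
      exists (i%:R, 0); split=> //; split; first by rewrite vE !inE eqxx orbT.
      by rewrite xpair_eqE pnatr_eq0 negb_and -lt0n i0.
    have := k4 t Tt; rewrite v0 /place addr0.
    case: (kk t) => [|[|[|[|//]]]] _ /=; [exists i%:Z, 0|exists 0, i%:Z|
      exists (- i%:Z), 0|exists 0, (- i%:Z)]; by apply: plane_eqP => /=; lra.
  exists t, p; split=> //; last by exists 0, 0; rewrite p0.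
  exists z; split=> //; split=> // ds2; apply/negP => z0.
  by move: sol; rewrite ds2 eqxx z0.
have [e e01 eP] := int_parity x0 y0; exists e => // t Tt.
have := @code_of_placed R m n e m2 n2 e01 (kk t) (vv t) (VS t) (DS t) (k4 t Tt) (pt t Tt).
rewrite -(tE t Tt) => code; apply: code.
- exact: sub.
- by move=> s; apply: dashT.
move=> z zV zs; apply: eP; rewrite -p0E.
by apply: (all_cong t t0 Tt Tt0) => //; exists z.
Qed.

End Integrality.

(** * Symmetric colourings of the integers *)

Section SymmetricColourings.
Variable e : int.
Hypothesis e01 : 0 <= e <= 1.

Definition symcol (d : int) (G : int -> bool) :=
  (forall p, G (- e - p) = G p) /\ (forall p, G (p + d) = G p).

Lemma symcol_mul d G k p : symcol d G -> G (p + k * d) = G p.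
Proof.
case=> _ per; have nat_mul (i : nat) p' : G (p' + i%:Z * d) = G p'.
  elim: i p' => [|i IH] p'; first by rewrite mul0r addr0.
  by rewrite intS mulrDl mul1r addrA IH per.
case: k => i; first exact: nat_mul.
by rewrite NegzE mulNr -[LHS](nat_mul i.+1) subrK.
Qed.

Lemma symcol_gcd m n G : symcol m G -> symcol n G -> symcol (gcdz m n) G.
Proof.
move=> sm sn; split=> [p|p]; first by case: sm.
have [u [v <-]] := Bezoutz m n.
by rewrite addrA (symcol_mul _ _ sn) (symcol_mul _ _ sm).
Qed.

Lemma symcol_dvd d k G : symcol d G -> symcol (k * d) G.
Proof. by move=> sd; split=> p; [case: sd|apply: symcol_mul]. Qed.

(* Folds the integers onto [0 <= p <= (d - e) / 2], identifying points related
   by the symmetries of [symcol]. *)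
Definition fold (d p : int) : nat :=
  let r := (p %% d)%Z in if 2 * r + e <= d then absz r else absz (d - e - r)%R.

Variable d : int.
Hypothesis d1 : 1 <= d.

Let mod_bounds p : 0 <= (p %% d)%Z < d.
Proof. by rewrite modz_ge0 ?ltz_pmod //; lia. Qed.

Lemma fold_bound p : 2 * (fold d p)%:Z + e <= d.
Proof. have := mod_bounds p; rewrite /fold; case: ifP; lia. Qed.

Lemma fold_small p : 0 <= p -> 2 * p + e <= d -> (fold d p)%:Z = p.
Proof.
move=> p0 pd; have [pltd|pged] := ltP p d.
  by rewrite /fold modz_small ?p0 // pd; lia.
have -> : p = d by lia.
rewrite /fold modzz; case: ifP; lia.
Qed.

Lemma fold_mul k p : fold d (p + k * d) = fold d p.
Proof. by rewrite /fold [p + _]addrC modzMDl. Qed.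

Lemma fold_per p : fold d (p + d) = fold d p.
Proof. by have := fold_mul 1 p; rewrite mul1r. Qed.

Lemma fold_sym p : fold d (- e - p) = fold d p.
Proof.
have rb := mod_bounds p; set r := (p %% d)%Z in rb.
have pE : p = r + (p %/ d)%Z * d by rewrite addrC -divz_eq.
rewrite {2}pE fold_mul; have [h|h] := ltP (d - e - r) d.
  have -> : - e - p = (d - e - r) + (- (p %/ d)%Z - 1) * d by rewrite {1}pE; ring.
  rewrite fold_mul /fold !modz_small //; last by lia.
  by case: ifP; case: ifP; lia.
have [r0 e0] : r = 0 /\ e = 0 by lia.
have -> : - e - p = r + (- (p %/ d)%Z) * d by rewrite {1}pE r0 e0; ring.
by rewrite fold_mul.
Qed.

Lemma symcol_fold (g : nat -> bool) : symcol d (fun p => g (fold d p)).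
Proof. by split=> p; rewrite ?fold_sym ?fold_per. Qed.

Lemma fold_repr G p : symcol d G -> G (fold d p)%:Z = G p.
Proof.
move=> sG; have [sy pe] := sG; have rb := mod_bounds p.
have Gr : G (p %% d)%Z = G p.
  by rewrite [in RHS](divz_eq p d) addrC (symcol_mul _ _ sG).
rewrite /fold; case: ifP => h; first by rewrite gez0_abs ?Gr //; lia.
rewrite gez0_abs; last by lia.
have -> : d - e - (p %% d)%Z = - e - (p %% d)%Z + d by ring.
by rewrite pe sy.
Qed.

End SymmetricColourings.

Section ParityPatterns.
Variables m n e : int.
Hypothesis m2 : 2 <= m.
Hypothesis n2 : 2 <= n.
Hypothesis e01 : 0 <= e <= 1.

Definition inR (x y : int) := [&& 0 <= x, x <= m - 1, 0 <= y & y <= n - 1].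

Variable phi : int -> int -> bool.
Hypothesis phi_in : forall p q, phi p q -> inR (p + q + e - 1) (p - q - 1).
Hypothesis phi_even : forall p q, inR (p + q + e) (p - q - 1) ->
  phi p q (+) phi (p + 1) q (+) phi p (q + 1) (+) phi (p + 1) (q + 1) = false.

Let M := m + 1.
Let N := n + 1.

Fixpoint colour_row (k : nat) : bool :=
  if k is k'.+1 then colour_row k' (+) phi k'.+1 k' else false.

Let G p := colour_row (fold e M p).

Let M1 : 1 <= M. Proof. by rewrite /M; lia. Qed.

Let symG : symcol e M G. Proof. exact: symcol_fold. Qed.

Let G_left p q : p + q + e = 0 -> G p = G q.
Proof. by move=> h; rewrite -(symG.1 q); congr G; lia. Qed.

Let G_right p q : p + q + e = M -> G p = G q.
Proof. by move=> h; rewrite -(symG.1 q) -(symG.2 (- e - q)); congr G; lia. Qed.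

Let phi_out p q : ~~ inR (p + q + e - 1) (p - q - 1) -> phi p q = false.
Proof. by move=> h; apply/negP => /phi_in; apply/negP. Qed.

Let phi_row p : 0 <= 2 * p - 1 + e <= M -> phi p (p - 1) = G p (+) G (p - 1).
Proof.
move=> h; have [h0|h0] := eqVneq (2 * p - 1 + e) 0.
  rewrite (@G_left p (p - 1)) ?addbb; last by lia.
  by apply: phi_out; rewrite /inR; lia.
have [hM|hM] := eqVneq (2 * p - 1 + e) M.
  rewrite (@G_right p (p - 1)) ?addbb; last by lia.
  by apply: phi_out; rewrite /inR /M in hM *; lia.
have [k pE] : exists k : nat, p = k.+1%:Z by exists `|p - 1|%N; lia.
have f1 : fold e M p = k.+1 by apply: (can_inj absz_nat); rewrite (fold_small e01 M1); lia.
have f2 : fold e M (p - 1) = k by apply: (can_inj absz_nat); rewrite (fold_small e01 M1); lia.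
rewrite /G f1 f2 /= addbAC addbb addFb; congr phi; lia.
Qed.

Let phi_colour (y : nat) : forall p q, p - q = y%:Z -> y%:Z <= N ->
  0 <= p + q + e <= M -> phi p q = G p (+) G q.
Proof.
have [k] := ubnP y; elim: k y => // k IH [|[|y]] yk p q pq yN X.
- have -> : q = p by lia.
  by rewrite addbb; apply: phi_out; rewrite /inR; lia.
- have -> : q = p - 1 by lia.
  by apply: phi_row; lia.
have [h0|h0] := eqVneq (p + q + e) 0.
  rewrite (@G_left p q) ?addbb; last by lia.
  by apply: phi_out; rewrite /inR; lia.
have [hM|hM] := eqVneq (p + q + e) M.
  rewrite (@G_right p q) ?addbb; last by lia.
  by apply: phi_out; rewrite /inR /M in hM *; lia.
have := @phi_even (p - 1) q; rewrite subrK.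
rewrite (IH y.+1 _ (p - 1) q) ?(IH y.+1 _ p (q + 1)) ?(IH y _ (p - 1) (q + 1)); try lia.
rewrite /inR => /(_ ltac:(rewrite /M /N in yN X h0 hM *; lia)).
by case: (phi p q); case: (G p); case: (G q); case: (G (p - 1)); case: (G (q + 1)).
Qed.

Lemma parity_colouring : exists G, [/\ symcol e (gcdz M N) G, G 0 = false &
  forall p q, 0 <= p + q + e <= M -> 0 <= p - q <= N -> phi p q = G p (+) G q].
Proof.
have phiE p q : 0 <= p + q + e <= M -> 0 <= p - q <= N -> phi p q = G p (+) G q.
  by move=> X Y; apply: (@phi_colour `|p - q|%N) => //; lia.
exists G; split=> //; last first.
  rewrite /G (_ : fold e M 0 = 0%N) //; apply: (can_inj absz_nat).
  by rewrite (fold_small e01 M1); lia.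
apply: symcol_gcd => //; split=> [p|p]; first exact: symG.1.
have top q : 0 <= 2 * q + N + e <= M -> G (q + N) = G q.
  move=> h; have := phiE (q + N) q; rewrite phi_out; last by rewrite /inR /N; lia.
  move=> /(_ ltac:(lia) ltac:(rewrite /N; lia)).
  by case: (G _); case: (G _).
have top' q : - M <= 2 * q + N + e <= M -> G (q + N) = G q.
  move=> h; have [h0|h0] := leP 0 (2 * q + N + e); first by apply: top; lia.
  rewrite -(symG.1 q) -(symG.1 (q + N)).
  have -> : - e - q = - e - (q + N) + N by ring.
  by rewrite top //; lia.
have M2 : 0 < 2 * M by rewrite /M; lia.
set k := ((2 * p + N + e + M) %/ (2 * M))%Z.
have := divz_eq (2 * p + N + e + M) (2 * M); rewrite -/k.
have := modz_ge0 (2 * p + N + e + M) (lt0r_neq0 M2).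
have := ltz_pmod (2 * p + N + e + M) M2.
set r := (_ %% _)%Z => r1 r0 kr.
rewrite -(symcol_mul (- k) p symG) -(symcol_mul (- k) (p + N) symG) addrAC.
by apply: top'; lia.
Qed.

End ParityPatterns.

(** * Tilings and colourings *)

Section ColouredTiles.
Variable R : realType.
Notation plane := (R * R)%type.
Notation hplane := (plane * R)%type.

Lemma tile_open (t : polygon R) : tile t ->
  exists hs c, [/\ region t = poly hs, nondeg hs & spoly hs c].
Proof.
move=> [vs [ds [k [v [pt ->]]]]]; have [q [hq [c qc]]] := proto_oct pt.
exists (octhp (trO v (iter k (@rotO R) q))), (place k v c); split.
- by rewrite /= (hull_place k v hq).
- exact: nondeg_octhp.
- exact: spoly_place.
Qed.

Lemma tiling_unique X (T : set (polygon R)) t s z : tiling X T -> T t -> T s ->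
  region t z -> interior (region s) z -> t = s.
Proof.
move=> [_ tileT _ disjT _] Tt Ts tz sz.
have [hs [c [tE nt tc]]] := tile_open (tileT t Tt).
have [hs' [c' [sE ns sc']]] := tile_open (tileT s Ts).
rewrite sE interior_poly // in sz; have [d d0 dP] := spoly_near c sz.
pose f := Order.min (d / 2) 1.
have f0 : 0 < f by rewrite lt_min ltr01 divr_gt0.
apply: disjT => //; exists (mix f z c); split.
  rewrite tE interior_poly //; apply: spoly_mix; rewrite -?tE //.
  by rewrite f0 ge_min lexx orbT.
rewrite sE interior_poly //; apply: dP.
by rewrite ltW //= gt_min; apply/orP; left; lra.
Qed.

Variables m n : int.
Hypothesis m2 : 2 <= m.
Hypothesis n2 : 2 <= n.
Local Notation recthp := (recthp R m n).

(* [t] is a neighbourhood of [z] in the rectangle, and [z] lies on a dashed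
   side of [t] if it is a boundary point; the second condition excludes the
   right-angled corner of a square or an octagon at a corner of the rectangle. *)
Definition engulfs (t : polygon R) (z : plane) :=
  (exists2 d : R, 0 < d & forall z', `|z'.1 - z.1| < d -> `|z'.2 - z.2| < d ->
     poly recthp z' -> region t z') /\
  (boundary (poly recthp) z -> exists s, dashed t s /\ s z).

Lemma engulfs_unique T t s z : tiling (poly recthp) T -> T t -> T s ->
  engulfs t z -> region s z -> s = t.
Proof.
move=> tT Tt Ts [[d d0 dP] _] sz; have [_ tileT coverT _ _] := tT.
have [hs [c [sE ns sc]]] := tile_open (tileT s Ts).
have [d' d'0 d'P] := mix_near z c d0.
pose f := Order.min (d' / 2) 1.
have f0 : 0 < f by rewrite lt_min ltr01 divr_gt0.
have fd : 0 <= f < d' by rewrite ltW //= gt_min; apply/orP; left; lra.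
have [h1 h2] := d'P f fd.
have sm : spoly hs (mix f z c).
  by apply: spoly_mix; rewrite -?sE ?f0 ?ge_min ?lexx ?orbT.
apply/esym; apply: (tiling_unique tT Tt Ts) (_ : interior _ (mix f z c)); last first.
  by rewrite sE interior_poly.
apply: dP => //; rewrite -coverT; exists s => //.
by rewrite sE; apply: spolyW.
Qed.

Lemma engulfs_step t (z : plane) : engulfs t z -> poly recthp z ->
  [/\ z.1 < m%:~R - 1 -> exists2 d : R, 0 < d & region t (z.1 + d, z.2),
      0 < z.1 -> exists2 d : R, 0 < d & region t (z.1 - d, z.2),
      z.2 < n%:~R - 1 -> exists2 d : R, 0 < d & region t (z.1, z.2 + d) &
      0 < z.2 -> exists2 d : R, 0 < d & region t (z.1, z.2 - d)].
Proof.
move=> [[d d0 dP] _] /rectP[/andP[z1 z2] /andP[z3 z4]].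
have aux (f : R) : 0 < f -> let g := Order.min (d / 2) f in [/\ 0 < g, g <= f & g < d].
  move=> f0 /=; split; first by rewrite lt_min f0 divr_gt0.
    by rewrite ge_min lexx orbT.
  by rewrite gt_min; apply/orP; left; lra.
split=> h.
- have [|g0 gf gd] := aux (m%:~R - 1 - z.1); first by lra.
  exists (Order.min (d / 2) (m%:~R - 1 - z.1)) => //; move: (Order.min _ _) g0 gf gd => g g0 gf gd.
  apply: dP => /=; [by rewrite addrC addKr gtr0_norm|by rewrite subrr normr0|].
  by apply/rectP => /=; lra.
- have [|g0 gf gd] := aux z.1; first by lra.
  exists (Order.min (d / 2) z.1) => //; move: (Order.min _ _) g0 gf gd => g g0 gf gd.
  apply: dP => /=; [by rewrite addrC addKr normrN gtr0_norm|by rewrite subrr normr0|].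
  by apply/rectP => /=; lra.
- have [|g0 gf gd] := aux (n%:~R - 1 - z.2); first by lra.
  exists (Order.min (d / 2) (n%:~R - 1 - z.2)) => //; move: (Order.min _ _) g0 gf gd => g g0 gf gd.
  apply: dP => /=; [by rewrite subrr normr0|by rewrite addrC addKr gtr0_norm|].
  by apply/rectP => /=; lra.
- have [|g0 gf gd] := aux z.2; first by lra.
  exists (Order.min (d / 2) z.2) => //; move: (Order.min _ _) g0 gf gd => g g0 gf gd.
  apply: dP => /=; [by rewrite subrr normr0|by rewrite addrC addKr normrN gtr0_norm|].
  by apply/rectP => /=; lra.
Qed.

Variable e : int.
Hypothesis e01 : 0 <= e <= 1.
Local Notation ept := (ept R e).
Local Notation blkhp := (blkhp R m n e).
Local Notation blk := (blk R m n e).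
Local Notation cell := (cell R e).
Local Notation valid := (valid m n e).
Local Notation vcell := (vcell m n e).
Local Notation inR := (inR m n).

Definition inO c (x y : int) :=
  [&& i0 c + j0 c + e - 2 <= x, x <= i1 c + j1 c + e, i0 c - j1 c - 2 <= y, y <= i1 c - j0 c,
      2 * i0 c + e - 4 <= x + y, x + y <= 2 * i1 c + e, 2 * j0 c + e - 2 <= x - y &
      x - y <= 2 * j1 c + e + 2].

Definition inC i j (x y : int) :=
  [&& i + j + e - 1 <= x, x <= i + j + e + 1, i - j - 2 <= y, y <= i - j,
      2 * i + e - 2 <= x + y, x + y <= 2 * i + e, 2 * j + e <= x - y & x - y <= 2 * j + e + 2].

Lemma rect_int x y : poly recthp (x%:~R, y%:~R) <-> inR x y.
Proof. by rewrite rectPb /inR /= -!(ler_int R); split; lra. Qed.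

Lemma oct_int c x y : poly (octhp (oblk R e c)) (x%:~R, y%:~R) <-> inO c x y.
Proof. by rewrite octPb /inO /= -!(ler_int R); split; lra. Qed.

Lemma blk_int c x y : poly (blkhp c) (x%:~R, y%:~R) <-> inO c x y && inR x y.
Proof.
rewrite blkP oct_int rect_int; split; first by case=> -> ->.
by case/andP.
Qed.

Lemma cell_int i j x y : poly (octhp (ocell R e i j)) (x%:~R, y%:~R) <-> inC i j x y.
Proof. by rewrite octPb /inC /= -!(ler_int R); split; lra. Qed.

Lemma boundary_int x y : boundary (poly recthp) (x%:~R, y%:~R) <->
  inR x y /\ [\/ x = 0, x = m - 1, y = 0 | y = n - 1].
Proof.
rewrite rect_boundaryP rect_int /=; split=> -[h1 h2]; split=> //.
  case: h2 => h2; [constructor 1|constructor 2|constructor 3|constructor 4];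
    apply: (@intr_inj R); lra.
by case: h2 => ->; [constructor 1|constructor 2|constructor 3|constructor 4]; lra.
Qed.

Definition inB c p q := (i0 c <= p <= i1 c) && (j0 c <= q <= j1 c).

Lemma valid_bounds c : valid c ->
  [/\ - m <= i0 c + j0 c + e, i0 c + j0 c + e <= m + 1, 0 <= i1 c + j1 c + e &
      i1 c + j1 c + e <= 2 * m + 1] /\
  [/\ 0 <= i0 c - j0 c, i0 c - j0 c <= n + 1, 0 <= i1 c - j1 c & i1 c - j1 c <= n + 1].
Proof.
case/and5P => ii jj sL sR /and3P[sB sT _]; split; [clear sB sT|clear sL sR].
  move: sL sR; rewrite /symL /symR.
  by case/orP=> h1; case/orP=> h2; clear -m2 ii jj h1 h2; split; lia.
move: sB sT; rewrite /symB /symT.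
by case/orP=> h1; case/orP=> h2; clear -n2 ii jj h1 h2; split; lia.
Qed.

Lemma engulfs_blk c p q : valid c -> inR (p + q + e - 1) (p - q - 1) ->
  engulfs (blk c) (ept p q) <-> inB c p q.
Proof.
move=> vc pqR; split=> [eng|pqc].
  have zR : poly recthp (ept p q) by apply/rect_int.
  have [m1 m2' m3 m4] := engulfs_step eng zR.
  have cz : inO c (p + q + e - 1) (p - q - 1).
    case: eng => [[d d0 dP] _].
    have : region (blk c) (ept p q) by apply: dP => //; rewrite subrr normr0.
    by rewrite /= blk_int => /andP[].
  have c1 : p + q + e - 1 < m - 1 -> p <= i1 c /\ q <= j1 c.
    rewrite -(ltr_int R) => h; case: m1 => [|d d0 /blkP[/octPb]]; first by move: h => /=; lra.
    by rewrite /= => h' _; rewrite -!ltzD1 -!(ltr_int R); split; lra.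
  have c2 : 0 < p + q + e - 1 -> i0 c <= p /\ j0 c <= q.
    rewrite -(ltr_int R) => h; case: m2' => [|d d0 /blkP[/octPb]]; first by move: h => /=; lra.
    by rewrite /= => h' _; rewrite -!ltzD1 -!(ltr_int R); split; lra.
  have c3 : p - q - 1 < n - 1 -> p <= i1 c /\ j0 c <= q.
    rewrite -(ltr_int R) => h; case: m3 => [|d d0 /blkP[/octPb]]; first by move: h => /=; lra.
    by rewrite /= => h' _; rewrite -!ltzD1 -!(ltr_int R); split; lra.
  have c4 : 0 < p - q - 1 -> i0 c <= p /\ q <= j1 c.
    rewrite -(ltr_int R) => h; case: m4 => [|d d0 /blkP[/octPb]]; first by move: h => /=; lra.
    by rewrite /= => h' _; rewrite -!ltzD1 -!(ltr_int R); split; lra.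
  have c5 : [|| p + q + e - 1 == 0, p + q + e - 1 == m - 1, p - q - 1 == 0 | p - q - 1 == n - 1] ->
    [\/ symL e c /\ p + q + e - 1 = 0, symR m e c /\ p + q + e - 1 = m - 1,
      symB c /\ p - q - 1 = 0 | symT n c /\ p - q - 1 = n - 1].
    move=> hb; case: eng => _ [].
      apply/boundary_int; split=> //.
      by case/or4P: hb => /eqP; [constructor 1|constructor 2|constructor 3|constructor 4].
    move=> s [] /= [] [sy ->] [_ /= h];
      [constructor 1|constructor 2|constructor 3|constructor 4]; split=> //;
      apply: (@intr_inj R); rewrite h; lra.
  move: cz c5 pqR; rewrite /inO /inR /inB /symL /symR /symB /symT; clear -m2 n2 c1 c2 c3 c4.
  move=> cz c5 pqR.
  have [hb|hb] := boolP
    [|| p + q + e - 1 == 0, p + q + e - 1 == m - 1, p - q - 1 == 0 | p - q - 1 == n - 1].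
    by case: (c5 hb) => -[h1 h2]; clear c5 hb; lia.
  by clear c5; lia.
have zO : spoly (octhp (oblk R e c)) (ept p q).
  apply/soctP; rewrite /= -!intrD -!intrB !ltr_int.
  by move: pqc; rewrite /inB => pqc; split; lia.
have : interior (poly (octhp (oblk R e c))) (ept p q) by rewrite interior_poly ?nondeg_octhp.
move/interiorE => [d d0 dP]; split.
  by exists d => // z' h1 h2 h3; apply/blkP; split=> //; apply: dP.
have cz : poly (blkhp c) (ept p q).
  by apply/blkP; split; [apply: spolyW|apply/rect_int].
move=> /boundary_int[_ hb]; move: vc; rewrite /valid => /and5P[v1 v2 v3 v4 /and3P[v5 v6 v7]].
case: hb => hb; move: pqc; rewrite /inB => pqc.
- exists (poly (blkhp c) `&` [set z | z.1 = 0]); split.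
    by constructor 1; split=> //; move: v3; case: (symL e c) => //; lia.
  by split=> //; rewrite /= hb.
- exists (poly (blkhp c) `&` [set z | z.1 = m%:~R - 1]); split.
    by constructor 2; split=> //; move: v4; case: (symR m e c) => //; lia.
  by split=> //; rewrite /= hb; lra.
- exists (poly (blkhp c) `&` [set z | z.2 = 0]); split.
    by constructor 3; split=> //; move: v5; case: (symB c) => //; lia.
  by split=> //; rewrite /= hb.
- exists (poly (blkhp c) `&` [set z | z.2 = n%:~R - 1]); split.
    by constructor 4; split=> //; move: v6; case: (symT n c) => //; lia.
  by split=> //; rewrite /= hb; lra.
Qed.

Lemma engulfs_cell i j p q : inR (p + q + e - 1) (p - q - 1) ->
  ~ engulfs (cell i j) (ept p q).
Proof.
move=> pqR eng; have zR : poly recthp (ept p q) by apply/rect_int.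
have nb : ~ boundary (poly recthp) (ept p q).
  by move=> zb; case: eng => _ /(_ zb)[s []].
have {nb}int : [/\ 0 < p + q + e - 1, p + q + e - 1 < m - 1, 0 < p - q - 1 & p - q - 1 < n - 1].
  move: pqR; rewrite /inR => /and4P[h1 h2 h3 h4]; rewrite !lt_neqAle h1 h2 h3 h4 !andbT.
  have nb' := contra_not (proj2 (boundary_int (p + q + e - 1) (p - q - 1))) nb.
  by split; apply/negP => /eqP hb; apply: nb'; rewrite /inR h1 h2 h3 h4; split=> //;
    [constructor 1|constructor 2|constructor 3|constructor 4].
have [m1 m2' m3 m4] := engulfs_step eng zR.
case: int; rewrite -!(ltr_int R) => h1 h2 h3 h4.
case: m1 => [|d d0 /octPb /= c1]; first by move: h2 => /=; lra.
case: m2' => [|d' d0' /octPb /= c2]; first by move: h1 => /=; lra.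
have : 2 * i + e - 2 < 2 * p + e - 2 by rewrite -(ltr_int R); lra.
have : 2 * p + e - 2 < 2 * i + e by rewrite -(ltr_int R); lra.
by clear; lia.
Qed.

End ColouredTiles.

Section FromTilings.
Variable R : realType.
Notation plane := (R * R)%type.
Variables m n e : int.
Hypothesis m2 : 2 <= m.
Hypothesis n2 : 2 <= n.
Hypothesis e01 : 0 <= e <= 1.
Local Notation recthp := (recthp R m n).
Local Notation ept := (ept R e).
Local Notation blkhp := (blkhp R m n e).
Local Notation blk := (blk R m n e).
Local Notation cell := (cell R e).
Local Notation valid := (valid m n e).
Local Notation vcell := (vcell m n e).
Local Notation inR := (inR m n).
Local Notation inO := (inO e).
Local Notation engulfs := (engulfs m n).

Definition run (G : int -> bool) a b :=
  [/\ a <= b, forall p, a <= p <= b -> G p = G a, G (a - 1) != G a & G (b + 1) != G a].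

Definition colour_tiles (G : int -> bool) : set (polygon R) := [set t |
  (exists c, [/\ valid c, run G (i0 c) (i1 c), run G (j0 c) (j1 c),
     G (i0 c) = G (j0 c) & t = blk c]) \/
  (exists i j, [/\ vcell i j, G i = G (i + 1), G j = G (j + 1), G i != G j & t = cell i j])].

Variable T : set (polygon R).
Hypothesis tT : tiling (poly recthp) T.
Hypothesis codeT : forall t, T t ->
    (exists2 c, valid c & t = blk c) \/ (exists i j, vcell i j /\ t = cell i j).

Definition covered p q := exists c, [/\ valid c, T (blk c) & inB c p q].

Definition phi p q := inR (p + q + e - 1) (p - q - 1) && ~~ `[< covered p q >].

Lemma phi_block c p q : valid c -> T (blk c) -> inB c p q -> phi p q = false.
Proof.
move=> vc Tc pqc; rewrite /phi; case: inR => //=.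
by apply/negbTE; rewrite negbK; apply/asboolP; exists c.
Qed.

Lemma phi_side c p q : valid c -> T (blk c) -> inO c (p + q + e - 1) (p - q - 1) ->
  inR (p + q + e - 1) (p - q - 1) -> ~~ inB c p q -> phi p q.
Proof.
move=> vc Tc pqO pqR pqc; rewrite /phi pqR /=; apply/asboolP => -[c' [vc' Tc' pqc']].
have eng := (engulfs_blk R m2 n2 e01 vc' pqR).2 pqc'.
have cz : region (blk c) (ept p q) by apply/blk_int; rewrite pqO.
have E := engulfs_unique tT Tc' Tc eng cz.
by rewrite -E in eng; move/(engulfs_blk R m2 n2 e01 vc pqR): eng; apply/negP.
Qed.

Lemma phi_cell i j p q : vcell i j -> T (cell i j) -> inC e i j (p + q + e - 1) (p - q - 1) ->
  phi p q.
Proof.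
move=> vij Tij pqC; have pqR : inR (p + q + e - 1) (p - q - 1).
  by move: vij pqC; rewrite /inR /inC /vcell; clear -m2; lia.
rewrite /phi pqR /=; apply/asboolP => -[c' [vc' Tc' pqc']].
have eng := (engulfs_blk R m2 n2 e01 vc' pqR).2 pqc'.
have cz : region (cell i j) (ept p q) by apply/cell_int.
have E := engulfs_unique tT Tc' Tij eng cz.
by rewrite -E in eng; apply: engulfs_cell pqR eng.
Qed.

Lemma near_octagon c p q p' q' : inO c (p + q + e) (p - q - 1) ->
  p' = p \/ p' = p + 1 -> q' = q \/ q' = q + 1 ->
  (i0 c <= p' <= i1 c) || (j0 c <= q' <= j1 c) -> i0 c <= i1 c -> j0 c <= j1 c ->
  inO c (p' + q' + e - 1) (p' - q' - 1).
Proof. by rewrite /inO; clear; move=> h [->|->] [->|->]; lia. Qed.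

Lemma near_rect c p q p' q' : valid c -> inO c (p + q + e) (p - q - 1) ->
  inR (p + q + e) (p - q - 1) ->
  p' = p \/ p' = p + 1 -> q' = q \/ q' = q + 1 ->
  (i0 c <= p' <= i1 c) != (j0 c <= q' <= j1 c) ->
  inR (p' + q' + e - 1) (p' - q' - 1).
Proof.
case/and5P => ii jj sL sR /and3P[sB sT _].
case/and5P => x1 x2 y1 y2 /and4P[u1 u2 v1 v2] /and4P[x3 x4 y3 y4] hp hq ne.
apply/and4P; split; rewrite leNgt; apply/negP => out.
- have [pE qE xE] : [/\ p' = p, q' = q & p + q + e = 0].
    by clear -hp hq out x3; split; lia.
  move/negP: ne; apply; rewrite pE qE; apply/eqP.
  by apply/idP/idP; case/orP: sL => [h|/andP[/eqP h1 /eqP h2]];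
    first [clear -h1 h2 xE; lia|clear -h x1 u1 v1 xE; lia].
- have [pE qE xE] : [/\ p' = p + 1, q' = q + 1 & p + q + e = m - 1].
    by clear -hp hq out x4; split; lia.
  move/negP: ne; apply; rewrite pE qE; apply/eqP.
  by apply/idP/idP; case/orP: sR => [h|/andP[/eqP h1 /eqP h2]];
    first [clear -h1 h2 xE; lia|clear -h x2 u2 v2 xE; lia].
- have [pE qE xE] : [/\ p' = p, q' = q + 1 & p - q - 1 = 0].
    by clear -hp hq out y3; split; lia.
  move/negP: ne; apply; rewrite pE qE; apply/eqP.
  by apply/idP/idP; case/orP: sB => [h|/andP[/eqP h1 /eqP h2]];
    first [clear -h1 h2 xE; lia|clear -h y1 u1 v2 xE; lia].
- have [pE qE xE] : [/\ p' = p + 1, q' = q & p - q - 1 = n - 1].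
    by clear -hp hq out y4; split; lia.
  move/negP: ne; apply; rewrite pE qE; apply/eqP.
  by apply/idP/idP; case/orP: sT => [h|/andP[/eqP h1 /eqP h2]];
    first [clear -h1 h2 xE; lia|clear -h y2 u2 v1 xE; lia].
Qed.

Lemma near_block c p q p' q' p'' q'' : valid c -> inR (p + q + e) (p - q - 1) ->
  (p' = p /\ p'' = p + 1) \/ (p' = p + 1 /\ p'' = p) ->
  (q' = q /\ q'' = q + 1) \/ (q' = q + 1 /\ q'' = q) ->
  i0 c <= p' <= i1 c -> j0 c <= q' <= j1 c -> ~~ (i0 c <= p'' <= i1 c) ->
  ~~ (j0 c <= q'' <= j1 c) -> inR (p' + q' + e - 1) (p' - q' - 1).
Proof.
case/and5P => ii jj sL sR /and3P[sB sT sym] /and4P[x3 x4 y3 y4] hp hq pI qJ pI' qJ'.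
apply/and4P; split; rewrite leNgt; apply/negP => out.
- have [pE qE xE] : [/\ i1 c = p, j1 c = q & p + q + e = 0].
    by clear -hp hq out x3 pI qJ pI' qJ'; split; lia.
  move: sym; case/orP: sL => [h|sL]; first by clear -h ii jj pE qE xE; lia.
  by rewrite sL /= => lt; move/andP: sL => [/eqP h1 /eqP h2]; clear -h1 h2 lt pE qE xE; lia.
- have [pE qE xE] : [/\ i0 c = p + 1, j0 c = q + 1 & p + q + e = m - 1].
    by clear -hp hq out x4 pI qJ pI' qJ'; split; lia.
  move: sym; case/orP: sR => [h|sR]; first by clear -h ii jj pE qE xE; lia.
  by rewrite sR /= orbT => lt; move/andP: sR => [/eqP h1 /eqP h2]; clear -h1 h2 lt pE qE xE; lia.
- have [pE qE xE] : [/\ i1 c = p, j0 c = q + 1 & p - q - 1 = 0].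
    by clear -hp hq out y3 pI qJ pI' qJ'; split; lia.
  move: sym; case/orP: sB => [h|sB]; first by clear -h ii jj pE qE xE; lia.
  by rewrite sB /= !orbT => lt; move/andP: sB => [/eqP h1 /eqP h2]; clear -h1 h2 lt pE qE xE; lia.
have [pE qE xE] : [/\ i0 c = p + 1, j1 c = q & p - q - 1 = n - 1].
  by clear -hp hq out y4 pI qJ pI' qJ'; split; lia.
move: sym; case/orP: sT => [h|sT]; first by clear -h ii jj pE qE xE; lia.
by rewrite sT /= !orbT => lt; move/andP: sT => [/eqP h1 /eqP h2]; clear -h1 h2 lt pE qE xE; lia.
Qed.

Lemma next_tile z w : poly recthp z -> poly recthp w ->
  exists t, [/\ T t, region t z & exists2 d : R, 0 < d & region t (mix d z w)].
Proof.
move=> Xz Xw; have [finT tileT coverT _ _] := tT.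
have [|t Tt ht] := @finite_pigeonhole R _ T (fun t d => 0 < d /\ region t (mix d z w)) finT.
  move=> d d0; pose f := Order.min (d / 2) 1.
  have f0 : 0 < f by rewrite lt_min ltr01 divr_gt0.
  have : poly recthp (mix f z w).
    by apply: poly_mix => //; rewrite ltW //= ge_min lexx orbT.
  rewrite -coverT => -[t Tt tz]; exists t => //; exists f => //.
  by rewrite ltW //= gt_min; apply/orP; left; lra.
have [hs [c [tE _ _]]] := tile_open (tileT t Tt).
exists t; split=> //; last by have [d _ [d0 h]] := ht 1 ltr01; exists d.
rewrite tE; apply: (@poly_lim _ _ _ w) => d /ht[f fd [_ h]].
by exists f; rewrite -?tE.
Qed.

Lemma phi_corner c p q p' q' p'' q'' : valid c -> T (blk c) ->
  inO c (p + q + e) (p - q - 1) -> inR (p + q + e) (p - q - 1) ->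
  (p' = p /\ p'' = p + 1) \/ (p' = p + 1 /\ p'' = p) ->
  (q' = q /\ q'' = q + 1) \/ (q' = q + 1 /\ q'' = q) ->
  i0 c <= p' <= i1 c -> j0 c <= q' <= j1 c -> ~~ (i0 c <= p'' <= i1 c) ->
  ~~ (j0 c <= q'' <= j1 c) -> phi p'' q'' = false.
Proof.
move=> vc Tc cO oR pp qq pI qJ pI' qJ'.
rewrite /phi; have [oR''|//] := boolP (inR (p'' + q'' + e - 1) _); rewrite /=.
have oR' := near_block vc oR pp qq pI qJ pI' qJ'.
have ii : i0 c <= i1 c by move: pI; clear; lia.
have jj : j0 c <= j1 c by move: qJ; clear; lia.
pose o : plane := ((p + q + e)%:~R, (p - q - 1)%:~R).
have [s [Ts so [d d0 sd]]] : exists s, [/\ T s, region s o & exists2 d : R, 0 < d &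
    region s (mix d o (ept p'' q''))].
  by apply: next_tile; apply/rect_int.
have ntd : ~ region (blk c) (mix d o (ept p'' q'')).
  move=> /blkP[/octPb + _]; rewrite /mix /=.
  have [k [l [kE lE kl]]] : exists k l : int, [/\ (p'' + q'' + e - 1) = (p + q + e) + k,
      p'' - q'' - 1 = (p - q - 1) + l &
      [\/ k = 1 /\ p + q + e = i1 c + j1 c + e, k = -1 /\ p + q + e = i0 c + j0 c + e - 2,
          l = 1 /\ p - q - 1 = i1 c - j0 c | l = -1 /\ p - q - 1 = i0 c - j1 c - 2]].
    exists (p'' + q'' - 1 - p - q), (p'' - q'' - (p - q)); split; try by (clear; lia).
    move: pI qJ pI' qJ' cO; rewrite /inO; clear -pp qq.
    case: pp => -[-> ->]; case: qq => -[-> ->] => pI qJ pI' qJ' cO.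
    - by constructor 1; lia.
    - by constructor 3; lia.
    - by constructor 4; lia.
    - by constructor 2; lia.
  rewrite kE lE; case: kl => -[-> ->] /=; lra.
have sc : s <> blk c by move=> sc; apply: ntd; rewrite -sc.
have eng : engulfs (blk c) (ept p' q') by apply/engulfs_blk => //; rewrite /inB pI.
have nsp : ~ region s (ept p' q').
  by move=> sp; apply: sc; apply: engulfs_unique tT Tc Ts eng sp.
apply/negbTE; rewrite negbK; apply/asboolP.
case: (codeT Ts) => [[c' vc' sE]|[i [j [vij sE]]]].
  exists c'; split=> //; first by rewrite -sE.
  move: so; rewrite sE => /blk_int/andP[cO' _].
  have ii' : i0 c' <= i1 c' by case/andP: vc'.
  have jj' : j0 c' <= j1 c' by case/and3P: vc'.
  have : ~~ ((i0 c' <= p' <= i1 c') || (j0 c' <= q' <= j1 c')).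
    apply/negP => h; apply: nsp; rewrite sE; apply/blk_int; rewrite oR' andbT.
    apply: near_octagon cO' _ _ h ii' jj'.
      by case: pp => -[-> _]; [left|right].
    by case: qq => -[-> _]; [left|right].
  move: cO'; rewrite /inO /inB; clear -pp qq ii' jj'.
  by case: pp => -[-> ->]; case: qq => -[-> ->]; lia.
exfalso; apply: nsp; rewrite sE; apply/cell_int.
move: so; rewrite sE => /cell_int; rewrite /inC; clear -pp qq.
by case: pp => -[-> _]; case: qq => -[-> _]; lia.
Qed.

Lemma phi_even p q : inR (p + q + e) (p - q - 1) ->
  phi p q (+) phi (p + 1) q (+) phi p (q + 1) (+) phi (p + 1) (q + 1) = false.
Proof.
move=> oR; have [_ _ coverT _ _] := tT.
have : poly recthp ((p + q + e)%:~R, (p - q - 1)%:~R) by apply/rect_int.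
rewrite -coverT => -[t Tt]; case: (codeT Tt) => [[c vc tE]|[i [j [vij tE]]]]; last first.
  rewrite tE => /cell_int h; rewrite tE in Tt.
  have [-> ->] : p = i /\ q = j by move: h; rewrite /inC; clear; lia.
  by rewrite !(phi_cell vij Tt) // /inC; clear; lia.
rewrite tE => /blk_int/andP[cO _]; rewrite tE in Tt.
have ii : i0 c <= i1 c by case/andP: vc.
have jj : j0 c <= j1 c by case/and3P: vc.
have key p' q' : p' = p \/ p' = p + 1 -> q' = q \/ q' = q + 1 ->
    (i0 c <= p' <= i1 c) || (j0 c <= q' <= j1 c) ->
    phi p' q' = ~~ ((i0 c <= p' <= i1 c) && (j0 c <= q' <= j1 c)).
  move=> pp qq h; have [b|b] := boolP (_ && _); first exact: phi_block vc Tt b.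
  apply: (phi_side vc Tt) => //; first exact: near_octagon cO pp qq h ii jj.
  by apply: near_rect vc cO oR pp qq _; move: h b; case: (_ <= p' <= _); case: (_ <= q' <= _).
have pI : (i0 c <= p <= i1 c) || (i0 c <= p + 1 <= i1 c).
  by move: cO; rewrite /inO; clear -ii jj; lia.
have qJ : (j0 c <= q <= j1 c) || (j0 c <= q + 1 <= j1 c).
  by move: cO; rewrite /inO; clear -ii jj; lia.
have {}key p' q' : p' = p \/ p' = p + 1 -> q' = q \/ q' = q + 1 ->
    ((i0 c <= p' <= i1 c) || (j0 c <= q' <= j1 c)) ==>
    (phi p' q' == ~~ ((i0 c <= p' <= i1 c) && (j0 c <= q' <= j1 c))).
  by move=> pp qq; apply/implyP => h; apply/eqP; apply: key.
have C p' q' p'' q'' : (p' = p /\ p'' = p + 1) \/ (p' = p + 1 /\ p'' = p) ->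
    (q' = q /\ q'' = q + 1) \/ (q' = q + 1 /\ q'' = q) ->
    [&& i0 c <= p' <= i1 c, j0 c <= q' <= j1 c, ~~ (i0 c <= p'' <= i1 c) &
     ~~ (j0 c <= q'' <= j1 c)] ==> ~~ phi p'' q''.
  move=> pp qq; apply/implyP => /and4P[h1 h2 h3 h4].
  by rewrite (phi_corner vc Tt cO oR pp qq h1 h2 h3 h4).
have K00 := key p q (or_introl erefl) (or_introl erefl).
have K10 := key (p + 1) q (or_intror erefl) (or_introl erefl).
have K01 := key p (q + 1) (or_introl erefl) (or_intror erefl).
have K11 := key (p + 1) (q + 1) (or_intror erefl) (or_intror erefl).
have C00 := C _ _ _ _ (or_introl (conj erefl erefl)) (or_introl (conj erefl erefl)).
have C10 := C _ _ _ _ (or_intror (conj erefl erefl)) (or_introl (conj erefl erefl)).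
have C01 := C _ _ _ _ (or_introl (conj erefl erefl)) (or_intror (conj erefl erefl)).
have C11 := C _ _ _ _ (or_intror (conj erefl erefl)) (or_intror (conj erefl erefl)).
move: pI qJ K00 K10 K01 K11 C00 C10 C01 C11; clear.
by case: (i0 c <= p <= i1 c); case: (i0 c <= p + 1 <= i1 c) => //;
  case: (j0 c <= q <= j1 c); case: (j0 c <= q + 1 <= j1 c) => //;
  case: (phi p q); case: (phi (p + 1) q); case: (phi p (q + 1)); case: (phi _ _).
Qed.

Theorem tiling_sub_colour : exists G, [/\ symcol e (gcdz (m + 1) (n + 1)) G, G 0 = false,
  exists p, G p & T `<=` colour_tiles G].
Proof.
have phi_in p q : phi p q -> inR (p + q + e - 1) (p - q - 1) by case/andP.
have [G [symG G0 GE]] := parity_colouring m2 n2 e01 phi_in phi_even.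
have symM : symcol e (m + 1) G.
  by rewrite -(divzK (dvdz_gcdl (m + 1) (n + 1))); apply: symcol_dvd.
have symN : symcol e (n + 1) G.
  by rewrite -(divzK (dvdz_gcdr (m + 1) (n + 1))); apply: symcol_dvd.
have GL p : G (- e - p) = G p by case: symG.
have GR p : G (m + 1 - e - p) = G p.
  by rewrite -(GL p) -[RHS](symM.2); congr G; ring.
have GT p : G (p - (n + 1)) = G p by rewrite -[LHS](symN.2); congr G; ring.
have sub t : T t -> colour_tiles G t.
  move=> Tt; case: (codeT Tt) => [[c vc tE]|[i [j [vij tE]]]]; last first.
    rewrite tE in Tt *; right; exists i, j.
    have g (k l : int) : k = 0 \/ k = 1 -> l = 0 \/ l = 1 -> G (i + k) != G (j + l).
      move=> hk hl; have := GE (i + k) (j + l); rewrite (phi_cell vij Tt).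
        case: (G _); case: (G _) => //= h; exfalso.
          have : true = false by apply: h; move: vij; rewrite /vcell; clear -hk hl; lia.
          by [].
        have : true = false by apply: h; move: vij; rewrite /vcell; clear -hk hl; lia.
        by [].
      by rewrite /inC; clear -hk hl; lia.
    have := g 0 0 (or_introl erefl) (or_introl erefl).
    have := g 1 0 (or_intror erefl) (or_introl erefl).
    have := g 0 1 (or_introl erefl) (or_intror erefl).
    rewrite !addr0 => h1 h2 h3; split=> //.
      by move: h2 h3; case: (G i); case: (G (i + 1)); case: (G j).
    by move: h1 h3; case: (G i); case: (G (j + 1)); case: (G j).
  rewrite tE in Tt *; left; exists c.
  case/and5P: (vc) => ii jj sL sR /and3P[sB sT _].
  have [[_ xR xL _] [yB yT yB' yT']] := valid_bounds m2 n2 vc.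
  have nLR : ~~ (symL e c && symR m e c) by rewrite /symL /symR; clear -m2; lia.
  have nBT : ~~ (symB c && symT n c) by rewrite /symB /symT; clear -n2; lia.
  have base p q : inB c p q -> 0 <= p + q + e <= m + 1 -> 0 <= p - q <= n + 1 -> G p = G q.
    move=> pqc X Y; have := GE p q X Y; rewrite (phi_block vc Tt pqc).
    by case: (G p); case: (G q).
  have base2 p q : inB c p q -> 0 <= p + q + e <= m + 1 -> G p = G q.
    move=> pqc X; have [Y|Y] := boolP (0 <= p - q <= n + 1); first exact: base.
    have [hB|hB] := boolP (symB c).
      have hT : i1 c - j0 c <= n - 1.
        by move: sT nBT; rewrite hB; case: (symT n c) => //; rewrite orbF.
      by apply: esym; apply: base; move: pqc X Y hB hT; rewrite /inB /symB; clear; lia.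
    rewrite (negbTE hB) orbF in sB; have hT : symT n c.
      by move: sT pqc Y; rewrite /inB; case: (symT n c) => //; clear -sB; lia.
    rewrite -(GT p) -(symN.2 q); apply: esym; apply: base; move: pqc X Y hT;
      by rewrite /inB /symT; clear -sB n2; lia.
  have const p q : inB c p q -> G p = G q.
    move=> pqc; have [X|X] := boolP (0 <= p + q + e <= m + 1); first exact: base2.
    have [hL|hL] := boolP (symL e c).
      have hR : i1 c + j1 c + e <= m - 1.
        by move: sR nLR; rewrite hL; case: (symR m e c) => //; rewrite orbF.
      rewrite -(GL p) -(GL q); apply: esym; apply: base2; move: pqc X hL;
        by rewrite /inB /symL; clear -hR; lia.
    rewrite (negbTE hL) orbF in sL; have hR : symR m e c.
      by move: sR pqc X; rewrite /inB; case: (symR m e c) => //; clear -sL; lia.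
    rewrite -(GR p) -(GR q); apply: esym; apply: base2; move: pqc X hR;
      by rewrite /inB /symR; clear -sL m2; lia.
  have end_ p q : inO c (p + q + e - 1) (p - q - 1) -> inR (p + q + e - 1) (p - q - 1) ->
      ~~ inB c p q -> G p != G q.
    move=> pqO pqR pqc; have := GE p q; rewrite (phi_side vc Tt pqO pqR pqc) => h.
    have {}h : true = G p (+) G q by apply: h; move: pqR; rewrite /inR; clear; lia.
    by move: h; case: (G p); case: (G q).
  have cIJ p q : i0 c <= p <= i1 c -> j0 c <= q <= j1 c -> G p = G q.
    by move=> h1 h2; apply: const; rewrite /inB h1.
  pose k := G (i0 c).
  have cJ q : j0 c <= q <= j1 c -> G q = k.
    by move=> h; rewrite /k (cIJ (i0 c) q) // lexx.
  have cI p : i0 c <= p <= i1 c -> G p = k.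
    move=> h; rewrite (cIJ p (j0 c)) ?cJ // lexx //.
  have e1 : [|| symR m e c, symT n c | G (i1 c + 1) != k].
    have [//|hR] := boolP (symR m e c); have [//|hT] := boolP (symT n c).
    rewrite -(cJ (j1 c)) /=; last by rewrite jj lexx.
    rewrite (negbTE hR) orbF in sR; rewrite (negbTE hT) orbF in sT.
    by apply: end_; rewrite /inO /inR /inB; clear -ii jj sR sT xL yB'; lia.
  have e2 : [|| symR m e c, symB c | G (j1 c + 1) != k].
    have [//|hR] := boolP (symR m e c); have [//|hB] := boolP (symB c).
    rewrite eq_sym -(cI (i1 c)) /=; last by rewrite ii lexx.
    rewrite (negbTE hR) orbF in sR; rewrite (negbTE hB) orbF in sB.
    by apply: end_; rewrite /inO /inR /inB; clear -ii jj sR sB xL yT yT'; lia.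
  have e3 : [|| symL e c, symB c | G (i0 c - 1) != k].
    have [//|hL] := boolP (symL e c); have [//|hB] := boolP (symB c).
    rewrite -(cJ (j0 c)) /=; last by rewrite jj lexx.
    rewrite (negbTE hL) orbF in sL; rewrite (negbTE hB) orbF in sB.
    by apply: end_; rewrite /inO /inR /inB; clear -ii jj sL sB xR yT; lia.
  have e4 : [|| symL e c, symT n c | G (j0 c - 1) != k].
    have [//|hL] := boolP (symL e c); have [//|hT] := boolP (symT n c).
    rewrite eq_sym -(cI (i0 c)) /=; last by rewrite ii lexx.
    rewrite (negbTE hL) orbF in sL; rewrite (negbTE hT) orbF in sT.
    by apply: end_; rewrite /inO /inR /inB; clear -ii jj sL sT xR yB; lia.
  have s1 : symL e c || symR m e c ==>
      (G (i1 c + 1) == G (j0 c - 1)) && (G (i0 c - 1) == G (j1 c + 1)).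
    apply/implyP => /orP[/andP[/eqP h1 /eqP h2]|/andP[/eqP h1 /eqP h2]].
      rewrite -(GL (i1 c + 1)) -(GL (i0 c - 1)) h1 h2.
      by apply/andP; split; apply/eqP; congr G; ring.
    rewrite -(GR (i1 c + 1)) -(GR (i0 c - 1)) h1 h2.
    by apply/andP; split; apply/eqP; congr G; ring.
  have s2 : symB c || symT n c ==>
      (G (i1 c + 1) == G (j1 c + 1)) && (G (i0 c - 1) == G (j0 c - 1)).
    apply/implyP => /orP[/andP[/eqP h1 /eqP h2]|/andP[/eqP h1 /eqP h2]].
      by rewrite h1 h2 !eqxx.
    rewrite -(GT (i1 c + 1)) -(GT (i0 c - 1)) h1 h2.
    by apply/andP; split; apply/eqP; congr G; ring.
  have ends : [&& G (i1 c + 1) != k, G (i0 c - 1) != k, G (j1 c + 1) != k & G (j0 c - 1) != k].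
    move: e1 e2 e3 e4 s1 s2 nLR nBT; clear.
    by case: (symL e c); case: (symR m e c) => //; case: (symB c); case: (symT n c) => //=;
      case: (G (i1 c + 1)); case: (G (j1 c + 1)); case: (G (i0 c - 1));
      case: (G (j0 c - 1)); case: k.
  case/and4P: ends => n1 n2' n3 n4.
  have kJ : G (j0 c) = k by apply: cJ; rewrite lexx.
  split=> //.
  by split; rewrite ?kJ //; apply: cJ.
exists G; split=> //.
have [t Tt] : exists t, T t.
  have [_ _ coverT _ _] := tT; have : poly recthp (0%:~R, 0%:~R).
    by apply/rect_int; rewrite /inR; clear -m2 n2; lia.
  by rewrite -coverT => -[t Tt _]; exists t.
apply: contrapT => nG; have {}nG p : G p = false by apply/negbTE/negP => h; apply: nG; exists p.
case: (sub t Tt) => [[c [_ [_ _ h _] _ _ _]]|[i [j [_ _ _ h _]]]];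
  by move: h; rewrite !nG.
Qed.

End FromTilings.

Section ColourTilings.
Variable R : realType.
Notation plane := (R * R)%type.
Variables m n e : int.
Hypothesis m2 : 2 <= m.
Hypothesis n2 : 2 <= n.
Hypothesis e01 : 0 <= e <= 1.
Local Notation recthp := (recthp R m n).
Local Notation ept := (ept R e).
Local Notation blkhp := (blkhp R m n e).
Local Notation blk := (blk R m n e).
Local Notation cell := (cell R e).
Local Notation valid := (valid m n e).
Local Notation vcell := (vcell m n e).

Variable G : int -> bool.
Hypothesis symG : symcol e (gcdz (m + 1) (n + 1)) G.
Hypothesis G0 : G 0 = false.
Hypothesis G1 : exists p, G p.
Local Notation colour_tiles := (@colour_tiles R m n e G).

Let symM : symcol e (m + 1) G.
Proof. by rewrite -(divzK (dvdz_gcdl (m + 1) (n + 1))); apply: symcol_dvd. Qed.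

Let symN : symcol e (n + 1) G.
Proof. by rewrite -(divzK (dvdz_gcdr (m + 1) (n + 1))); apply: symcol_dvd. Qed.

Let GL p : G (- e - p) = G p. Proof. by case: symG. Qed.

Let GR p : G (m + 1 - e - p) = G p.
Proof. by rewrite -(GL p) -[RHS](symM.2); congr G; ring. Qed.

Let GT p : G (p - (n + 1)) = G p.
Proof. by rewrite -[LHS](symN.2); congr G; ring. Qed.

Lemma other_colour p : exists q, G q != G p.
Proof.
case Gp: (G p); first by exists 0; rewrite G0.
by have [q Gq] := G1; exists q; rewrite Gq.
Qed.

Lemma colour_above p : exists k : nat, G (p + k%:Z) != G p.
Proof.
have [q qp] := other_colour p.
exists (absz (q + (absz (p - q)%R)%:Z * (m + 1) - p)%R).
rewrite (_ : p + _ = q + (absz (p - q)%R)%:Z * (m + 1)); first by rewrite (symcol_mul _ _ symM).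
rewrite gez0_abs; first by ring.
have h : (absz (p - q)%R)%:Z * 1 <= (absz (p - q)%R)%:Z * (m + 1).
  by apply: ler_wpM2l => //; move: m2; clear; lia.
by move: h; rewrite mulr1; move: (_ * (m + 1)) => k; clear; lia.
Qed.

Lemma colour_below p : exists k : nat, G (p - k%:Z) != G p.
Proof.
have [k hk] := colour_above (- e - p); exists k; move: hk.
by rewrite GL -(GL (p - k%:Z)) (_ : - e - (p - k%:Z) = - e - p + k%:Z) //; ring.
Qed.

Lemma run_exists p : exists a b, run G a b /\ a <= p <= b.
Proof.
have [[|k] hk kmin] := ex_minnP (colour_above p); first by rewrite addr0 eqxx in hk.
have [[|l] hl lmin] := ex_minnP (colour_below p); first by rewrite subr0 eqxx in hl.
have up (i : nat) : (i <= k)%N -> G (p + i%:Z) = G p.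
  by move=> ik; apply/eqP/negPn/negP => /kmin; rewrite ltnNge ik.
have down (i : nat) : (i <= l)%N -> G (p - i%:Z) = G p.
  by move=> il; apply/eqP/negPn/negP => /lmin; rewrite ltnNge il.
have mid q : p - l%:Z <= q <= p + k%:Z -> G q = G p.
  move=> h; have [pq|qp] := leP p q.
    by rewrite -(up (absz (q - p)%R)); [congr G|]; lia.
  by rewrite -(down (absz (p - q)%R)); [congr G|]; lia.
exists (p - l%:Z), (p + k%:Z); split; last by lia.
split; first by lia.
- by move=> q h; rewrite mid // mid //; lia.
- rewrite (mid (p - l%:Z)); last by lia.
  by rewrite (_ : p - l%:Z - 1 = p - l.+1%:Z) //; lia.
- rewrite (mid (p - l%:Z)); last by lia.
  by rewrite (_ : p + k%:Z + 1 = p + k.+1%:Z) //; lia.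
Qed.

Lemma run_unique a b a' b' p : run G a b -> run G a' b' ->
  a <= p <= b -> a' <= p <= b' -> a = a' /\ b = b'.
Proof.
move=> [ab h1 h2 h3] [ab' h1' h2' h3'] pab pab'.
have E : G a = G a' by rewrite -(h1 p) // -(h1' p).
split.
  have [lt|lt|//] := ltgtP a a'.
    by move: h2'; rewrite (h1 (a' - 1)) ?E ?eqxx //; lia.
  by move: h2; rewrite (h1' (a - 1)) ?E ?eqxx //; lia.
have [lt|lt|//] := ltgtP b b'.
  by move: h3; rewrite (h1' (b + 1)) ?E ?eqxx //; lia.
by move: h3'; rewrite (h1 (b' + 1)) ?E ?eqxx //; lia.
Qed.

Lemma run_flip (k a b : int) : (forall p, G (k - p) = G p) -> run G a b ->
  run G (k - b) (k - a).
Proof.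
move=> Gk [ab h1 h2 h3].
have Eb : G (k - b) = G a by rewrite Gk h1 // ab lexx.
split; first by lia.
- by move=> p h; rewrite Eb -(Gk p) h1 //; lia.
- by rewrite Eb (_ : k - b - 1 = k - (b + 1)) ?Gk //; ring.
- by rewrite Eb (_ : k - a + 1 = k - (a - 1)) ?Gk //; ring.
Qed.

Lemma run_shift a b : run G a b -> run G (a - (n + 1)) (b - (n + 1)).
Proof.
move=> [ab h1 h2 h3]; split; first by lia.
- move=> p h; rewrite GT -(h1 (p + (n + 1))); last by lia.
  by rewrite symN.2.
- by rewrite addrAC !GT.
- by rewrite addrAC !GT.
Qed.

Lemma run_same a b p : run G a b -> a <= p <= b -> G p = G a.
Proof. by case=> _ h _ _; apply: h. Qed.

Lemma runs_valid c (z : plane) : run G (i0 c) (i1 c) -> run G (j0 c) (j1 c) ->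
  G (i0 c) = G (j0 c) -> poly (octhp (oblk R e c)) z -> spoly recthp z -> valid c.
Proof.
case: c => a b a' b' /= rI rJ GE /octPb /= zO /srectP[/andP[z1 z2] /andP[z3 z4]].
have h1 : 1 <= b + b' + e by rewrite -gtz0_ge1 -(ltr_int R); lra.
have h2 : a + a' + e <= m by rewrite -ltzD1 -(ltr_int R); lra.
have h3 : 1 <= b - a' by rewrite -gtz0_ge1 -(ltr_int R); lra.
have h4 : a - b' <= n by rewrite -ltzD1 -(ltr_int R); lra.
move: h1 h2 h3 h4; clear z z1 z2 z3 z4 zO => h1 h2 h3 h4.
have [ab _ I0 I1] := rI; have [ab' _ J0 J1] := rJ.
have sL : (2 <= a + a' + e) || symL e (Code a b a' b').
  have [//|lt2] := leP 2 (a + a' + e); rewrite /=.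
  have [eq1|ne1] := eqVneq (a + a' + e) 1.
    by move: I0; rewrite -(GL (a - 1)) (_ : - e - (a - 1) = a') ?GE ?eqxx //;
      clear -m2 n2 e01 ab ab' h1 h2 h3 h4 lt2 eq1; lia.
  have [] := @run_unique _ _ _ _ (- e - Num.max a (- e - b')) (run_flip GL rI) rJ; rewrite /symL /=;
    clear -m2 n2 e01 ab ab' h1 h2 h3 h4 lt2 ne1; lia.
have sR : (b + b' + e <= m - 1) || symR m e (Code a b a' b').
  have [//|lt2] := leP (b + b' + e) (m - 1); rewrite /=.
  have [eq1|ne1] := eqVneq (b + b' + e) m.
    move: I1; rewrite -(GR (b + 1)) (_ : m + 1 - e - (b + 1) = b'); last by lia.
    by rewrite (run_same rJ) ?GE ?eqxx //;
      clear -m2 n2 e01 ab ab' h1 h2 h3 h4 lt2 eq1; lia.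
  have [] := @run_unique _ _ _ _ (m + 1 - e - Num.max a (m + 1 - e - b')) (run_flip GR rI) rJ;
    rewrite /symR /=;
    clear -m2 n2 e01 ab ab' h1 h2 h3 h4 lt2 ne1; lia.
have sB : (2 <= a - b') || symB (Code a b a' b').
  have [//|lt2] := leP 2 (a - b'); rewrite /=.
  have [eq1|ne1] := eqVneq (a - b') 1.
    move: I0; rewrite (_ : a - 1 = b'); last by lia.
    by rewrite (run_same rJ) ?GE ?eqxx //;
      clear -m2 n2 e01 ab ab' h1 h2 h3 h4 lt2 eq1; lia.
  have [] := @run_unique _ _ _ _ (Num.max a a') rI rJ; rewrite /symB /=;
    clear -m2 n2 e01 ab ab' h1 h2 h3 h4 lt2 ne1; lia.
have sT : (b - a' <= n - 1) || symT n (Code a b a' b').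
  have [//|lt2] := leP (b - a') (n - 1); rewrite /=.
  have [eq1|ne1] := eqVneq (b - a') n.
    by move: I1; rewrite -(GT (b + 1)) (_ : b + 1 - (n + 1) = a') ?GE ?eqxx //;
      clear -m2 n2 e01 ab ab' h1 h2 h3 h4 lt2 eq1; lia.
  have [] := @run_unique _ _ _ _ (Num.max (a - (n + 1)) a') (run_shift rI) rJ; rewrite /symT /=;
    clear -m2 n2 e01 ab ab' h1 h2 h3 h4 lt2 ne1; lia.
rewrite /valid /= ab ab' sL sR sB sT /= /symL /symR /symB /symT /=.
by move: h1 h2 h3 h4 ab ab'; clear; lia.
Qed.

Lemma colour_tile_interior t : colour_tiles t ->
  exists hs, [/\ region t = poly hs, nondeg hs & interior (region t) = spoly hs].
Proof.
case=> [[c [_ _ _ _ ->]]|[i [j [_ _ _ _ ->]]]].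
  exists (blkhp c); split=> //; first exact: nondeg_blkhp.
  by rewrite /= interior_poly // nondeg_blkhp.
exists (octhp (ocell R e i j)); split=> //; first exact: nondeg_octhp.
by rewrite /= interior_poly // nondeg_octhp.
Qed.

Lemma real_floor (x : R) : exists i : int, i%:~R <= x < i%:~R + 1.
Proof.
exists (Num.floor x).
by have := real_floor_itv (num_real x); rewrite intrD.
Qed.

Lemma block_at (z : plane) p q : G p = G q -> spoly recthp z ->
  (forall c, i0 c <= p <= i1 c -> j0 c <= q <= j1 c ->
     run G (i0 c) (i1 c) -> run G (j0 c) (j1 c) -> poly (octhp (oblk R e c)) z) ->
  exists2 t, colour_tiles t & region t z.
Proof.
move=> pq zR hz; have [a [b [rI pI]]] := run_exists p.
have [a' [b' [rJ qJ]]] := run_exists q.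
have zO := hz (Code a b a' b') pI qJ rI rJ.
have GE : G a = G a' by rewrite -(run_same rI pI) pq (run_same rJ qJ).
exists (blk (Code a b a' b')).
  by left; exists (Code a b a' b'); split=> //; exact: (@runs_valid (Code a b a' b') z).
by apply/blkP; split=> //; apply: spolyW.
Qed.

Lemma run_next a b p : run G a b -> a <= p <= b -> G (p + 1) = G p -> p + 1 <= b.
Proof.
move=> rI pI; rewrite leNgt => E; apply/negP => h.
have pb : p = b by move: pI h; clear; lia.
by case: (rI) => _ _ _; rewrite -pb E (run_same rI pI) eqxx.
Qed.

Lemma run_prev a b p : run G a b -> a <= p <= b -> G (p - 1) = G p -> a <= p - 1.
Proof.
move=> rI pI; rewrite leNgt => E; apply/negP => h.
have pb : p = a by move: pI h; clear; lia.
by case: (rI) => _ _; rewrite -pb E eqxx.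
Qed.

Lemma colour_cover_open (z : plane) : spoly recthp z ->
  exists2 t, colour_tiles t & region t z.
Proof.
move=> zR; have [i /andP[i1' i2']] := real_floor ((z.1 + z.2 - e%:~R + 2) / 2).
have [j /andP[j1' j2']] := real_floor ((z.1 - z.2 - e%:~R) / 2).
have ij : [&& (2 * i + e - 2)%:~R <= z.1 + z.2, z.1 + z.2 <= (2 * i + e)%:~R,
    (2 * j + e)%:~R <= z.1 - z.2 & z.1 - z.2 <= (2 * j + e + 2)%:~R].
  by lra.
clear i1' i2' j1' j2'.
have [Gij|Gij] := eqVneq (G i) (G j); last first.
  have [Gi|Gi] := eqVneq (G i) (G (i + 1)); last first.
    have [Gj|Gj] := eqVneq (G j) (G (j + 1)).
      apply: (@block_at z (i + 1) j) => //.
        by move: Gij Gi; case: (G i); case: (G j); case: (G _).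
      move=> c pI qJ rI rJ; have := run_next rJ qJ (esym Gj).
      move: pI qJ => /andP[]; rewrite -!(ler_int R) => p1 p2 /andP[q1 q2] q3.
      by apply/octPb => /=; lra.
    have [y|y] := leP z.2 (i - j - 1)%:~R.
      apply: (@block_at z i (j + 1)) => //.
        by move: Gij Gj; case: (G i); case: (G j); case: (G _).
      move=> c /andP[]; rewrite -!(ler_int R) => p1 p2 /andP[q1 q2] _ _.
      by apply/octPb => /=; lra.
    apply: (@block_at z (i + 1) j) => //.
      by move: Gij Gi; case: (G i); case: (G j); case: (G _).
    move=> c /andP[]; rewrite -!(ler_int R) => p1 p2 /andP[q1 q2] _ _.
    by apply/octPb => /=; lra.
  have [Gj|Gj] := eqVneq (G j) (G (j + 1)); last first.
    apply: (@block_at z i (j + 1)) => //.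
      by move: Gij Gj; case: (G i); case: (G j); case: (G _).
    move=> c pI qJ rI rJ; have := run_next rI pI (esym Gi).
    move: pI qJ => /andP[]; rewrite -!(ler_int R) => p1 p2 /andP[q1 q2] q3.
    by apply/octPb => /=; lra.
  exists (cell i j); last by apply/octPb => /=; lra.
  right; exists i, j; split=> //.
  move/srectP: zR => [/andP[z1 z2] /andP[z3 z4]].
  have h1 : 0 <= i + j + e by rewrite -ltzD1 -(ltr_int R); lra.
  have h2 : i + j + e <= m - 1 by rewrite -ltzD1 -(ltr_int R); lra.
  have h3 : 1 <= i - j by rewrite -gtz0_ge1 -(ltr_int R); lra.
  have h4 : i - j <= n by rewrite -ltzD1 -(ltr_int R); lra.
  have n1 : i + j + e != 0.
    by apply/eqP => h; move/eqP: Gij; apply; rewrite -(GL i); congr G; clear -h; lia.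
  have n2' : i + j + e != m - 1.
    apply/eqP => h; move/eqP: Gij; apply; rewrite Gi Gj -(GR (i + 1)); congr G; clear -h; lia.
  have n3 : i - j != 1.
    by apply/eqP => h; move/eqP: Gij; apply; rewrite Gj; congr G; clear -h; lia.
  have n4 : i - j != n.
    apply/eqP => h; move/eqP: Gij; apply; rewrite Gi -(GT (i + 1)); congr G; clear -h; lia.
  by rewrite /vcell; clear -h1 h2 h3 h4 n1 n2' n3 n4; lia.
have [Gi|Gi] := eqVneq (G i) (G (i + 1)).
  apply: (@block_at z i j) => // c pI qJ rI rJ; have := run_next rI pI (esym Gi).
  move: pI qJ => /andP[]; rewrite -!(ler_int R) => p1 p2 /andP[q1 q2] q3.
  by apply/octPb => /=; lra.
have [Gj|Gj] := eqVneq (G j) (G (j + 1)).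
  apply: (@block_at z i j) => // c pI qJ rI rJ; have := run_next rJ qJ (esym Gj).
  move: pI qJ => /andP[]; rewrite -!(ler_int R) => p1 p2 /andP[q1 q2] q3.
  by apply/octPb => /=; lra.
have [x|x] := leP z.1 (i + j + e)%:~R.
  apply: (@block_at z i j) => // c /andP[]; rewrite -!(ler_int R) => p1 p2 /andP[q1 q2] _ _.
  by apply/octPb => /=; lra.
apply: (@block_at z (i + 1) (j + 1)) => //.
  by move: Gij Gi Gj; case: (G i); case: (G j); case: (G _); case: (G _).
move=> c /andP[]; rewrite -!(ler_int R) => p1 p2 /andP[q1 q2] _ _.
by apply/octPb => /=; lra.
Qed.

Lemma colour_finite : finite_set colour_tiles.
Proof.
pose B := m + n + m + n + m + n; pose K := absz (2 * B + 1)%R.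
pose f (x : 'I_K * 'I_K * 'I_K * 'I_K) : polygon R :=
  blk (Code ((x.1.1.1 : nat)%:Z - B) ((x.1.1.2 : nat)%:Z - B)
            ((x.1.2 : nat)%:Z - B) ((x.2 : nat)%:Z - B)).
pose g (x : 'I_K * 'I_K) : polygon R := cell ((x.1 : nat)%:Z - B) ((x.2 : nat)%:Z - B).
have ordB (x : int) : - B <= x <= B -> exists k : 'I_K, x = (k : nat)%:Z - B.
  move=> h; have hk : (absz (x + B)%R < K)%N by rewrite /K; lia.
  by exists (Ordinal hk) => /=; lia.
apply: (@sub_finite_set _ _ (f @` setT `|` g @` setT)); last first.
  by rewrite finite_setU; split; apply: finite_image; apply: finite_finset.
move=> t [[c [vc _ _ _ ->]]|[i [j [vij _ _ _ ->]]]].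
  left; move: vc; case: c => a b a' b' /= vc.
  have [h1 [h2 [h3 h4]]] : - B <= a <= B /\ - B <= b <= B /\ - B <= a' <= B /\ - B <= b' <= B.
    have [] := valid_bounds m2 n2 vc; rewrite /B /=; clear -m2 n2 e01.
    by move=> [x1 x2 x3 x4] [y1 y2 y3 y4]; repeat split; lia.
  have [k1 ->] := ordB _ h1; have [k2 ->] := ordB _ h2.
  have [k3 ->] := ordB _ h3; have [k4 ->] := ordB _ h4.
  by exists (k1, k2, k3, k4).
right; have [h1 h2] : - B <= i <= B /\ - B <= j <= B.
  by move: vij; rewrite /vcell /B /=; clear -m2 n2 e01; lia.
have [k1 ->] := ordB _ h1; have [k2 ->] := ordB _ h2.
by exists (k1, k2).
Qed.

Lemma colour_cover (z : plane) : poly recthp z -> exists2 t, colour_tiles t & region t z.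
Proof.
move=> zR; pose c : plane := ((m%:~R - 1) / 2, (n%:~R - 1) / 2).
have cR : spoly recthp c.
  move: m2 n2; rewrite -!(ler_int R) => m2' n2'.
  by apply/srectP => /=; lra.
have [|t Ct ht] := @finite_pigeonhole R _ colour_tiles
    (fun t d => region t (mix d z c)) colour_finite.
  move=> d d0; pose f := Order.min (d / 2) 1.
  have f0 : 0 < f by rewrite lt_min ltr01 divr_gt0.
  have [|t Ct tz] := @colour_cover_open (mix f z c).
    by apply: spoly_mix => //; rewrite f0 ge_min lexx orbT.
  exists t => //; exists f => //.
  by rewrite ltW //= gt_min; apply/orP; left; lra.
exists t => //; have [hs [tE _ _]] := colour_tile_interior Ct.
rewrite tE; apply: (@poly_lim _ _ _ c) => d /ht[f fd h].
by exists f; rewrite -?tE.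
Qed.

Lemma blocks_disjoint c c' (z : plane) : run G (i0 c) (i1 c) -> run G (j0 c) (j1 c) ->
  G (i0 c) = G (j0 c) -> run G (i0 c') (i1 c') -> run G (j0 c') (j1 c') ->
  G (i0 c') = G (j0 c') -> spoly (octhp (oblk R e c)) z -> spoly (octhp (oblk R e c')) z ->
  c = c'.
Proof.
case: c c' => a b a' b' [p q p' q'] /= rI rJ GE rI' rJ' GE'.
move=> /soctP /= [/andP[z1 z2] /andP[z3 z4] /andP[z5 z6] /andP[z7 z8]].
move=> /soctP /= [/andP[w1 w2] /andP[w3 w4] /andP[w5 w6] /andP[w7 w8]].
have h1 : p <= b + 1 by rewrite -ltzD1 -(ltr_int R); lra.
have h2 : a <= q + 1 by rewrite -ltzD1 -(ltr_int R); lra.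
have h3 : p' <= b' + 1 by rewrite -ltzD1 -(ltr_int R); lra.
have h4 : a' <= q' + 1 by rewrite -ltzD1 -(ltr_int R); lra.
have h5 : p + p' <= b + b' + 1 by rewrite -ltzD1 -(ltr_int R); lra.
have h6 : a + a' <= q + q' + 1 by rewrite -ltzD1 -(ltr_int R); lra.
have h7 : p - q' <= b - a' + 1 by rewrite -ltzD1 -(ltr_int R); lra.
have h8 : a - b' <= q - p' + 1 by rewrite -ltzD1 -(ltr_int R); lra.
clear z z1 z2 z3 z4 z5 z6 z7 z8 w1 w2 w3 w4 w5 w6 w7 w8.
have dich x y x' y' : run G x y -> run G x' y' -> x' <= y + 1 -> x <= y' + 1 ->
    [\/ x = x' /\ y = y', x' = y + 1 /\ G x' != G x | x = y' + 1 /\ G x' != G x].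
  move=> r r' le1 le2; have [xy _ g1 g2] := r; have [xy' _ g1' g2'] := r'.
  have [e1|n1] := eqVneq x' (y + 1); first by constructor 2; rewrite e1.
  have [e2|n2'] := eqVneq x (y' + 1); first by constructor 3; split=> //; rewrite e2 eq_sym.
  constructor 1; apply: (@run_unique _ _ _ _ (Num.max x x') r r');
    clear -xy xy' le1 le2 n1 n2'; lia.
case: (dich _ _ _ _ rI rI' h1 h2) => -[e1 e2]; case: (dich _ _ _ _ rJ rJ' h3 h4) => -[e3 e4].
- by rewrite e1 e2 e3 e4.
- by move: e4; rewrite -GE -GE' e1 eqxx.
- by move: e4; rewrite -GE -GE' e1 eqxx.
- by move: e2; rewrite GE GE' e3 eqxx.
- by exfalso; clear -e1 e3 h5; lia.
- by exfalso; clear -e1 e3 h7; lia.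
- by move: e2; rewrite GE GE' e3 eqxx.
- by exfalso; clear -e1 e3 h8; lia.
- by exfalso; clear -e1 e3 h6; lia.
Qed.

Lemma block_cell_disjoint c i j (z : plane) : run G (i0 c) (i1 c) -> run G (j0 c) (j1 c) ->
  G (i0 c) = G (j0 c) -> G i = G (i + 1) -> G j = G (j + 1) -> G i != G j ->
  spoly (octhp (oblk R e c)) z -> spoly (octhp (ocell R e i j)) z -> False.
Proof.
case: c => a b a' b' /= rI rJ GE Gi Gj Gij.
move=> /soctP /= [_ _ /andP[z5 z6] /andP[z7 z8]] /soctP /= [_ _ /andP[w5 w6] /andP[w7 w8]].
have h1 : i <= b by rewrite -ltzD1 -(ltr_int R); lra.
have h2 : a <= i + 1 by rewrite -ltzD1 -(ltr_int R); lra.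
have h3 : j <= b' by rewrite -ltzD1 -(ltr_int R); lra.
have h4 : a' <= j + 1 by rewrite -ltzD1 -(ltr_int R); lra.
clear z z5 z6 z7 z8 w5 w6 w7 w8.
have hit x y k : run G x y -> k <= y -> x <= k + 1 -> G k = G (k + 1) -> G k = G x.
  move=> r le1 le2 Gk; have [h|h] := leP x k; first by apply: (run_same r); rewrite h.
  by rewrite Gk; congr G; clear -h le2; lia.
by move/eqP: Gij; apply; rewrite (hit _ _ _ rI h1 h2 Gi) (hit _ _ _ rJ h3 h4 Gj).
Qed.

Theorem colour_tiling : tiling (poly recthp) colour_tiles.
Proof.
split.
- exact: colour_finite.
- by move=> t [[c [vc _ _ _ ->]]|[i [j [_ _ _ _ ->]]]]; [apply: tile_blk|apply: tile_cell].
- apply/seteqP; split => z; last by move=> /colour_cover[t Ct tz]; exists t.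
  case=> t [[c [_ _ _ _ ->]]|[i [j [vij _ _ _ ->]]]] tz; first by case/blkP: tz.
  apply/rectPb; move/octPb: tz => /=; move: vij; rewrite /vcell => /and4P[].
  by rewrite -!(ler_int R); lra.
- move=> t s Ct Cs [z []]; case: Ct => [[c [vc rI rJ GE ->]]|[i [j [vij Gi Gj Gij ->]]]];
    case: Cs => [[c' [vc' rI' rJ' GE' ->]]|[i' [j' [vij' Gi' Gj' Gij' ->]]]];
    rewrite /= !interior_poly ?nondeg_blkhp ?nondeg_octhp //.
  + move=> /sblkP[zc _] /sblkP[zc' _].
    by rewrite (blocks_disjoint rI rJ GE rI' rJ' GE' zc zc').
  + by move=> /sblkP[zc _] /(block_cell_disjoint rI rJ GE Gi' Gj' Gij' zc).
  + by move=> zi /sblkP[zc' _]; have := block_cell_disjoint rI' rJ' GE' Gi Gj Gij zc' zi.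
  + move=> /soctP /= [_ _ /andP[z5 z6] /andP[z7 z8]] /soctP /= [_ _ /andP[w5 w6] /andP[w7 w8]].
    have h1 : i <= i' by rewrite -ltzD1 -(ltr_int R); lra.
    have h2 : i' <= i by rewrite -ltzD1 -(ltr_int R); lra.
    have h3 : j <= j' by rewrite -ltzD1 -(ltr_int R); lra.
    have h4 : j' <= j by rewrite -ltzD1 -(ltr_int R); lra.
    by congr cell; apply/le_anti/andP.
move=> t s Ct; case: Ct => [[c [_ _ _ _ ->]]|[i [j [_ _ _ _ ->]]]] //.
by case=> -[_ ->] z [/blkP[_ zR] /= zs]; apply/rect_boundaryP; split=> //;
  [constructor 1|constructor 2|constructor 3|constructor 4].
Qed.

End ColourTilings.

Section Classification.
Variable R : realType.
Notation plane := (R * R)%type.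
Variables m n : int.
Hypothesis m2 : 2 <= m.
Hypothesis n2 : 2 <= n.
Local Notation recthp := (recthp R m n).
Local Notation d := (gcdz (m + 1) (n + 1)).

Definition colouring e (G : int -> bool) := [/\ symcol e d G, G 0 = false & exists p, G p].

Lemma tilingE (T : set (polygon R)) : tiling (poly recthp) T <->
  exists e G, [/\ 0 <= e <= 1, colouring e G & T = @colour_tiles R m n e G].
Proof.
split=> [tT|[e [G [e01 [sG G0 G1] ->]]]]; last exact: colour_tiling.
have [e e01 cT] := tiling_codes m2 n2 tT.
have [G [sG G0 G1 sub]] := tiling_sub_colour m2 n2 e01 tT cT.
exists e, G; split=> //; apply/seteqP; split=> // t Ct.
have cG := colour_tiling R m2 n2 e01 sG G0 G1.
have [_ tileC coverC _ _] := cG; have [_ _ coverT _ _] := tT.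
have [hs [c [tE nd tc]]] := tile_open (tileC t Ct).
have : poly recthp c by rewrite -coverC; exists t => //; rewrite tE; apply: spolyW.
rewrite -coverT => -[s Ts sc]; suff -> : t = s by [].
apply: esym; apply: (tiling_unique cG) sc _ => //; first exact: sub.
by rewrite tE interior_poly.
Qed.

Lemma colour_engulfs e G p q : 0 <= e <= 1 -> colouring e G ->
  inR m n (p + q + e - 1) (p - q - 1) ->
  G p = G q <-> exists2 t, @colour_tiles R m n e G t & engulfs m n t (ept R e p q).
Proof.
move=> e01 [sG G0 G1] pqR; split=> [pq|[t [[c [vc rI rJ GE ->]]|[i [j [_ _ _ _ ->]]]]]]; last first.
- by move=> h; case: (@engulfs_cell R m n e i j p q pqR h).
- move/(engulfs_blk R m2 n2 e01 vc pqR) => /andP[pI qJ].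
  by rewrite (run_same rI pI) (run_same rJ qJ).
have [a [b [rI pI]]] := run_exists m2 n2 e01 sG G0 G1 p.
have [a' [b' [rJ qJ]]] := run_exists m2 n2 e01 sG G0 G1 q.
pose c := Code a b a' b'.
have zO : spoly (octhp (oblk R e c)) (ept R e p q).
  apply/soctP; rewrite /= -!intrD -!intrB !ltr_int.
  by move: pI qJ; clear; move=> *; split; lia.
pose w : plane := ((m%:~R - 1) / 2, (n%:~R - 1) / 2).
have wR : spoly recthp w.
  move: m2 n2; rewrite -!(ler_int R) => m2' n2'.
  by apply/srectP => /=; lra.
have [f f0 fP] := spoly_near w zO.
pose g := Order.min (f / 2) 1.
have g0 : 0 < g by rewrite lt_min ltr01 divr_gt0.
have g1 : 0 < g <= 1 by rewrite g0 ge_min lexx orbT.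
have gf : 0 <= g < f by rewrite ltW //= gt_min; apply/orP; left; lra.
have GE : G a = G a' by rewrite -(run_same rI pI) pq (run_same rJ qJ).
have vc : valid m n e c.
  apply: (@runs_valid R m n e m2 n2 e01 G sG G0 c (mix g (ept R e p q) w)) => //.
    exact: spolyW (fP _ gf).
  by apply: spoly_mix => //; apply/rect_int.
exists (blk R m n e c); first by left; exists c.
by apply/(engulfs_blk R m2 n2 e01 vc pqR); rewrite /inB pI.
Qed.

Lemma symcolM e G : symcol e d G -> symcol e (m + 1) G.
Proof. by move=> sG; rewrite -(divzK (dvdz_gcdl (m + 1) (n + 1))); apply: symcol_dvd. Qed.

Lemma colour_tiles_inj e G G' : 0 <= e <= 1 -> colouring e G -> colouring e G' ->
  @colour_tiles R m n e G = @colour_tiles R m n e G' -> G =1 G'.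
Proof.
move=> e01 cG cG' E; have [sG G0 _] := cG; have [sG' G0' _] := cG'.
have M1 : 1 <= m + 1 by move: m2; clear; lia.
have key (k : nat) : 2 * k%:Z + e <= m + 1 -> G k%:Z = G' k%:Z.
  elim: k => [|k IH] h; first by rewrite G0 G0'.
  have {}IH : G k%:Z = G' k%:Z by apply: IH; move: h; clear; lia.
  have kR : inR m n (k.+1%:Z + k%:Z + e - 1) (k.+1%:Z - k%:Z - 1).
    by move: h; rewrite /inR; clear -m2 n2 e01; lia.
  have := colour_engulfs e01 cG kR; have := colour_engulfs e01 cG' kR; rewrite -E => h1 h2.
  have h3 : G k.+1%:Z = G k%:Z <-> G' k.+1%:Z = G' k%:Z by rewrite h1 h2.
  move: h3; rewrite IH; case: (G k.+1%:Z); case: (G' k.+1%:Z); case: (G' k%:Z) => // -[h3 h4];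
    first [by move: (h3 erefl)|by move: (h4 erefl)].
move=> p; rewrite -(fold_repr e01 M1 p (symcolM sG)) -(fold_repr e01 M1 p (symcolM sG')).
exact/key/fold_bound.
Qed.

Lemma colour_tiles_parity G G' : colouring 0 G -> colouring 1 G' ->
  @colour_tiles R m n 0 G <> @colour_tiles R m n 1 G'.
Proof.
move=> _ [sG G0 G1] E; have e01 : 0 <= (1 : int) <= 1 by [].
have [a [b [rI h0]]] := run_exists m2 n2 e01 sG G0 G1 0.
have GL p : G' (- 1 - p) = G' p by case: sG.
have a1 : a <= 0 - 1.
  by apply: (run_prev rI h0); rewrite -GL.
have [aE bE] : a = - 1 - b /\ b = - 1 - a.
  by apply: (@run_unique m n 1 m2 n2 e01 G' G0 _ _ _ _ (-1) rI (run_flip m2 n2 e01 G0 GL rI));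
    move: h0 a1; clear; lia.
pose c := Code a b a b.
have vc : valid m n 1 c.
  apply: (@runs_valid R m n 1 m2 n2 e01 G' sG G0 c (4^-1, 4^-1)) => //.
    have b0 : 0 <= b by case/andP: h0.
    move: b0; rewrite -(ler_int R) => b0.
    by apply/octPb; rewrite /= aE; lra.
  move: m2 n2; rewrite -!(ler_int R) => m2' n2'.
  by apply/srectP => /=; lra.
pose A := 2 * b + 1.
have b0 : 0 <= b by case/andP: h0.
have [Am An] : A <= m - 1 /\ A <= n - 1.
  move: vc; rewrite /valid /symL /symR /symB /symT /= aE /A; clear -m2 n2 b0; lia.
have PQ (x y : int) : 0 <= x -> 0 <= y -> x + y = A -> poly (blkhp R m n 1 c) (x%:~R, y%:~R).
  move=> x0 y0 xy; apply/blk_int; rewrite /inO /inR /= aE; move: x0 y0 xy Am An; rewrite /A.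
  by clear -m2 n2 b0; lia.
have Ct : @colour_tiles R m n 1 G' (blk R m n 1 c) by left; exists c.
rewrite -E in Ct.
pose z : plane := (A%:~R / 2 + 4^-1, A%:~R / 2 + 4^-1).
have nz : ~ poly (blkhp R m n 1 c) z.
  by move=> /blkP[/octPb /=]; rewrite /A; lra.
have A0 : 1 <= A by rewrite /A; move: b0; clear; lia.
have P : poly (blkhp R m n 1 c) (A%:~R, 0%:~R) by apply: PQ; move: A0; clear; lia.
have Q : poly (blkhp R m n 1 c) (0%:~R, A%:~R) by apply: PQ; move: A0; clear; lia.
case: Ct => [[c' [_ _ _ _ tE]]|[i [j [_ _ _ _ tE]]]].
  have rE : poly (blkhp R m n 1 c) = poly (blkhp R m n 0 c') := congr1 (@region R) tE.
  rewrite rE in nz P Q; move: P Q => /blk_int/andP[PO PR] /blk_int/andP[QO QR].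
  have Ai : A + 1 <= 2 * i1 c' by move: PO; rewrite /inO /A; clear; lia.
  apply: nz; apply/blkP; split.
    apply/octPb; rewrite /z /=; move: PO QO A0 Ai; rewrite /inO -!(ler_int R) => PO QO A0' Ai.
    by lra.
  apply/rectPb; rewrite /z /=; move: PR QR A0; rewrite /inR -!(ler_int R) => PR QR A0'.
  by lra.
have rE : poly (blkhp R m n 1 c) = poly (octhp (ocell R 0 i j)) := congr1 (@region R) tE.
rewrite rE in nz P Q; move: P Q => /cell_int PO /cell_int QO.
have Ai : A + 1 <= 2 * i by move: PO; rewrite /inC /A; clear; lia.
apply: nz; apply/octPb; rewrite /z /=; move: PO QO A0 Ai.
rewrite /inC -!(ler_int R) => PO QO A0' Ai.
by lra.
Qed.

End Classification.

(** * Counting *)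

Lemma fintype_set_card (F : finType) (P : pred F) : ([set x | P x] #= `I_#|P|)%card.
Proof.
have -> : [set x | P x] = [set` [fset x in P]%fset].
  by apply/seteqP; split=> x /=; rewrite !inE.
by apply/card_eq_fsetP; rewrite card_finset.
Qed.

Lemma card_mem_true k : #|[pred s : k.-tuple bool | true \in tval s]| = (2 ^ k - 1)%N.
Proof.
have := cardC [pred s : k.-tuple bool | true \in tval s].
rewrite card_tuple card_bool => <-.
rewrite [X in (_ + X)%N](_ : _ = 1%N) ?addnK //.
rewrite -(card1 [tuple of nseq k false]); apply: eq_card => s; rewrite !inE.
apply/idP/eqP => [h|->]; last by rewrite mem_nseq andbF.
apply/val_inj => /=; rewrite -[in RHS](size_tuple s); apply/all_pred1P.
by apply/allP => -[] // xs; rewrite xs in h.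
Qed.

Definition sum_pred (A B : Type) (P : pred A) (Q : pred B) (x : A + B) :=
  match x with inl a => P a | inr b => Q b end.

Lemma card_sum_pred (A B : finType) (P : pred A) (Q : pred B) :
  #|sum_pred P Q| = (#|P| + #|Q|)%N.
Proof. by rewrite -!sum1_card big_sumType. Qed.

Section Counting.
Variables (e d : int) (k : nat).
Hypothesis e01 : 0 <= e <= 1.
Hypothesis d1 : 1 <= d.
Hypothesis dk : 2 * k%:Z + e <= d < 2 * k%:Z + e + 2.

Definition word_colour (s : seq bool) (p : int) := nth false (false :: s) (fold e d p).

Lemma word_colourE (s : seq bool) i : (i <= k)%N ->
  word_colour s i%:Z = nth false (false :: s) i.
Proof.
move=> ik; rewrite /word_colour; congr nth; apply/eqP; rewrite -eqz_nat; apply/eqP.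
by apply: fold_small => //; move: ik dk; clear; lia.
Qed.

Lemma word_colouring s : symcol e d (word_colour s) /\ word_colour s 0 = false.
Proof. by split; [apply: symcol_fold|rewrite (word_colourE s (leq0n k))]. Qed.

Lemma word_colour_true (s : k.-tuple bool) : true \in tval s -> exists p, word_colour s p.
Proof.
move=> /(nthP false)[i]; rewrite size_tuple => ik si.
by exists i.+1%:Z; rewrite word_colourE.
Qed.

Lemma word_colour_inj (s s' : k.-tuple bool) : word_colour s =1 word_colour s' -> s = s'.
Proof.
move=> E; apply/val_inj/(@eq_from_nth _ false) => [|i]; rewrite !size_tuple // => ik.
by have := E i.+1%:Z; rewrite !word_colourE.
Qed.

Lemma word_colour_surj G : symcol e d G -> G 0 = false -> (exists p, G p) ->
  exists2 s : k.-tuple bool, true \in tval s & word_colour s = G.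
Proof.
move=> sG G0 [p Gp]; pose s := [tuple G i.+1%:Z | i < k].
have sE : word_colour s = G.
  apply/funext => q; rewrite /word_colour -(fold_repr e01 d1 q sG).
  have := fold_bound e01 d1 q; case: (fold e d q) => [|i] ib //=.
  have ik : (i < k)%N by move: ib dk; clear; lia.
  by have := tnth_mktuple (fun i : 'I_k => G i.+1%:Z) (Ordinal ik); rewrite (tnth_nth false).
exists s => //; have := Gp; rewrite -sE /word_colour.
case: (fold e d p) => //= i si; rewrite -si mem_nth // ltnNge.
by apply/negP => /(nth_default false) h; rewrite h in si.
Qed.

End Counting.

Section Rectangle.
Variables (R : realType) (m n : nat).

Lemma rectangleE : @rectangle R m n = poly (recthp R m%:Z n%:Z).
Proof.
apply/seteqP; split=> z.
  by case=> /=; rewrite !in_itv /= => z1 z2; apply/rectP; rewrite /= -!pmulrn; move: z1 z2; lra.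
move=> /rectP /= h; split; rewrite /= in_itv /=; move: h; rewrite /= -!pmulrn; lra.
Qed.

End Rectangle.

Theorem theorem1 (R : realType) (m n c beta omega : nat)
    (hm : (2 <= m)%N) (hn : (2 <= n)%N)
    (hc : c = (gcdn (m + 1) (n + 1) - 1)%N)
    (hbeta : (2 * beta)%N = (c + c %% 2)%N)
    (homega : (2 * omega)%N = (c - c %% 2)%N) :
  [set T | tiling (@rectangle R m n) T]
    #= `I_(2 ^ beta + 2 ^ omega - 2)%N.
Proof.
have m2 : 2 <= m%:Z by lia.
have n2 : 2 <= n%:Z by lia.
set d := gcdz (m%:Z + 1) (n%:Z + 1).
have dE : d = c%:Z + 1.
  have : (0 < gcdn (m + 1) (n + 1))%N by rewrite gcdn_gt0 addn1.
  by rewrite /d /gcdz -!PoszD /= hc; lia.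
have d1 : 1 <= d by lia.
have h0 : 0 <= (0 : int) <= 1 by [].
have h1 : 0 <= (1 : int) <= 1 by [].
have k0 : 2 * beta%:Z + 0 <= d < 2 * beta%:Z + 0 + 2 by lia.
have k1 : 2 * omega%:Z + 1 <= d < 2 * omega%:Z + 1 + 2 by lia.
pose A := sum_pred [pred s : beta.-tuple bool | true \in tval s]
                   [pred s : omega.-tuple bool | true \in tval s].
pose F (x : beta.-tuple bool + omega.-tuple bool) := match x with
  | inl s => @colour_tiles R m%:Z n%:Z 0 (word_colour 0 d s)
  | inr s => @colour_tiles R m%:Z n%:Z 1 (word_colour 1 d s) end.
have cA : #|A| = (2 ^ beta + 2 ^ omega - 2)%N.
  rewrite card_sum_pred !card_mem_true.
  by have := expn_gt0 2 beta; have := expn_gt0 2 omega; lia.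
have col0 (s : beta.-tuple bool) : true \in tval s -> colouring m%:Z n%:Z 0 (word_colour 0 d s).
  move=> st; have [sy z0] := word_colouring h0 d1 k0 s.
  by split=> //; apply: word_colour_true st.
have col1 (s : omega.-tuple bool) : true \in tval s -> colouring m%:Z n%:Z 1 (word_colour 1 d s).
  move=> st; have [sy z0] := word_colouring h1 d1 k1 s.
  by split=> //; apply: word_colour_true st.
have -> : [set T | tiling (@rectangle R m n) T] = F @` [set x | A x].
  rewrite rectangleE; apply/seteqP; split=> [T /(tilingE m2 n2)[e [G [e01 [sG G0 G1] ->]]]|T].
    have [e0|e1] : e = 0 \/ e = 1 by lia.
      subst e.
      by have [s st <-] := word_colour_surj h0 d1 k0 sG G0 G1; exists (inl s).
    subst e.
    by have [s st <-] := word_colour_surj h1 d1 k1 sG G0 G1; exists (inr s).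
  case=> -[s|s] st <-; apply/(tilingE m2 n2).
    by exists 0, (word_colour 0 d s); split=> //; apply: col0.
  by exists 1, (word_colour 1 d s); split=> //; apply: col1.
apply: (card_eq_trans (inj_card_eq _)); last by rewrite -cA; apply: fintype_set_card.
move=> x y /set_mem Ax /set_mem Ay; move: Ax Ay.
case: x y => [s|s] [s'|s'] /= st st' E.
- by congr inl; apply: (word_colour_inj h0 d1 k0); apply: colour_tiles_inj E; auto.
- by case: (colour_tiles_parity m2 n2 (col0 _ st) (col1 _ st') E).
- by case: (colour_tiles_parity m2 n2 (col0 _ st') (col1 _ st) (esym E)).
- by congr inr; apply: (word_colour_inj h1 d1 k1); apply: colour_tiles_inj E; auto.
Qed.
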